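(* Let $M$ be a space-like hypersurface in the Minkowski space $\mathbb{E}^4_1$ with position vector $x$ satisfying $\langle x,x\rangle>0$ and $x^T\neq 0$ on $M$, and suppose that the Gauss-Kronecker curvature of $M$ vanishes. Then $M$ is a generalized constant ratio (GCR) hypersurface if and only if it is congruent to one of the following three types of hypersurfaces: (i) A part of the hypercylinder $\mathbb{H}^2(-c^{-2})\times\mathbb{E}^1=\{(x_1,x_2,x_3,u)\in\mathbb{E}^4_1:\ -x_1^2+x_2^2+x_3^2=-c^2\}$ for some constant $c>0$. (ii) A hypersurface parametrized by $$x(s,t,u)=s\,\alpha(u)-c\Big(F_1(u)\cosh\big(\tfrac{t}{c}\big)+F_2(u)\sinh\big(\tfrac{t}{c}\big)\Big),$$ where $c$ is a non-zero constant, $\alpha$ is a unit speed curve lying on $\mathbb{S}^3_1(1)\subset\mathbb{E}^4_1$, and $F_1,F_2$ are orthonormal vector fields along $\alpha$ spanning the normal space of $\alpha$ in $\mathbb{S}^3_1(1)$, i.e. $\langle F_1,F_2\rangle=\langle F_1,\alpha\rangle=\langle F_1,\alpha'\rangle=\langle F_2,\alpha\rangle=\langle F_2,\alpha'\rangle=0$, $\langle F_1,F_1\rangle=-1$, $\langle F_2,F_2\rangle=1$. (iii) A hypersurface parametrized by $x:I\times\Lambda\to\mathbb{E}^4_1$, $$x(s,t,u)=s\,y(t,u)-c\,N(t,u),$$ where $I$ is an open interval, $\Lambda$ is an open subset of $\mathbb{R}^2$, $c$ is a constant, and $y:\Lambda\to\mathbb{S}^3_1(1)\subset\mathbb{E}^4_1$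 is an oriented regular surface with spherical normal $N$.
   Context: $\mathbb{E}^4_1$ is $\mathbb{R}^4$ with the metric $\langle\ ,\ \rangle=-dx_1^2+dx_2^2+dx_3^2+dx_4^2$, and $\mathbb{S}^3_1(1)=\{p\in\mathbb{E}^4_1:\langle p,p\rangle=1\}$ (de Sitter space). A hypersurface $M$ is space-like if its induced metric is Riemannian; its unit normal is then time-like. The shape operator $S$ is defined by $\widetilde\nabla_X N=-S(X)$, where $\widetilde\nabla$ is the flat connection of $\mathbb{E}^4_1$ and $N$ is the unit normal. The Gauss-Kronecker curvature is $\det S=k_1k_2k_3$, where $k_1,k_2,k_3$ are the principal curvatures (eigenvalues of $S$). The position vector decomposes as $x=x^T+x^\perp$ into tangential and normal parts along $M$. $M$ is a generalized constant ratio (GCR) hypersurface if $x^T$ is a principal direction of $M$, i.e. an eigenvector of $S$ at each point. The spherical normal of a regular surface $y$ in $\mathbb{S}^3_1(1)$ is the unit vector field $N$ along $y$ with $\langle N,y\rangle=\langle N,y_t\rangle=\langle N,y_u\rangle=0$ (time-like here, since it is also the unit normal of the space-like hypersurface $M$). In (ii) and (iii) the parameters range over open sets on which $x$ is a space-like immersion. ''Congruent'' means related by a linear isometry of $\mathbb{E}^4_1$ (the origin is fixed, since the notion of GCR depends on the position vector). The classification is local.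
   Formalization: The equivalence is local and generic: M is GCR iff each point of some dense open subset of M has a neighbourhood congruent to type (i), (ii) or (iii). At points where the rank of the differential of x^T/|x^T| jumps, M may be of none of the three types. *)

(* Defs.v *)
From HB Require Import structures.
From mathcomp Require Import all_boot all_order all_algebra.
From mathcomp Require Import all_classical all_reals all_analysis.

Set Implicit Arguments.
Unset Strict Implicit.
Unset Printing Implicit Defensive.

Import Order.TTheory GRing.Theory Num.Theory.
Import numFieldNormedType.Exports.

Local Open Scope classical_set_scope.
Local Open Scope ring_scope.

(* Points and vectors of E^4_1 are row vectors; the coordinates x_1, ..., x_4
   have indices 0, ..., 3, index 0 being the time-like one. *)
Definition mink {R : realType} (a b : 'rV[R]_4) : R :=
  - (a 0 0 * b 0 0) + \sum_(i < 4 | i != 0) a 0 i * b 0 i.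

Definition linear_isometry {R : realType} (A : 'M[R]_4) : Prop :=
  forall a b : 'rV[R]_4, mink (a *m A) (b *m A) = mink a b.

Definition de_sitter {R : realType} : set 'rV[R]_4 := [set p | mink p p = 1].

Definition cosh {R : realType} (t : R) : R := (expR t + expR (- t)) / 2.
Definition sinh {R : realType} (t : R) : R := (expR t - expR (- t)) / 2.

(* C^k and C^oo on a set U, meant for U open (the derivatives are those of the
   ambient space) and V finite-dimensional. *)
Fixpoint Ck {R : realType} {V W : normedModType R} (k : nat) (U : set V)
    (f : V -> W) : Prop :=
  if k is k'.+1 then
    (forall p, U p -> differentiable f p) /\
    (forall v : V, Ck k' U (fun p => 'D_v f p))
  else forall p, U p -> {for p, continuous f}.

Definition smooth {R : realType} {V W : normedModType R} (U : set V)
    (f : V -> W) : Prop := forall k : nat, Ck k U f.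

Definition diffeomorphism {R : realType} {V W : normedModType R}
    (U : set V) (D : set W) (phi : V -> W) : Prop :=
  exists psi : W -> V,
    [/\ smooth U phi, smooth D psi,
        (forall p, U p -> D (phi p) /\ psi (phi p) = p) &
        (forall q, D q -> U (psi q) /\ phi (psi q) = q)].

(* A hypersurface is given by a parametrization x on an open set U of R^3; the
   tangent space at x(p) is identified with R^3 through v |-> 'D_v x p. *)
Definition spacelike_immersion {R : realType} (U : set 'rV[R]_3)
    (x : 'rV[R]_3 -> 'rV[R]_4) : Prop :=
  smooth U x /\
  forall p, U p -> forall v, v != 0 -> 0 < mink ('D_v x p) ('D_v x p).

Definition timelike_unit_normal {R : realType} {n : nat}
    (U : set 'rV[R]_n.+1) (x N : 'rV[R]_n.+1 -> 'rV[R]_4) : Prop :=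
  smooth U N /\
  forall p, U p ->
    mink (N p) (N p) = -1 /\ forall v, mink (N p) ('D_v x p) = 0.

(* S p is the matrix, acting on row vectors of R^3, of the shape operator at p:
   the flat derivative of N along X is - S(X). *)
Definition shape_operator {R : realType} (U : set 'rV[R]_3)
    (x N : 'rV[R]_3 -> 'rV[R]_4) (S : 'rV[R]_3 -> 'M[R]_3) : Prop :=
  forall p, U p -> forall v, 'D_v N p = - 'D_(v *m S p) x p.

Definition gauss_kronecker {R : realType} (S : 'rV[R]_3 -> 'M[R]_3)
    (p : 'rV[R]_3) : R := \det (S p).

(* Since <N, N> = -1, the normal part of x is - <x, N> N. *)
Definition tangential_part {R : realType} (x N : 'rV[R]_3 -> 'rV[R]_4)
    (p : 'rV[R]_3) : 'rV[R]_4 := x p + mink (x p) (N p) *: N p.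

Definition GCR {R : realType} (U : set 'rV[R]_3)
    (x N : 'rV[R]_3 -> 'rV[R]_4) (S : 'rV[R]_3 -> 'M[R]_3) : Prop :=
  forall p, U p -> exists (v : 'rV[R]_3) (k : R),
    [/\ 'D_v x p = tangential_part x N p, v != 0 & v *m S p = k *: v].

Definition congruent {R : realType} (W : set 'rV[R]_3)
    (x : 'rV[R]_3 -> 'rV[R]_4) (D : set 'rV[R]_3)
    (X : 'rV[R]_3 -> 'rV[R]_4) : Prop :=
  exists (A : 'M[R]_4) (phi : 'rV[R]_3 -> 'rV[R]_3),
    [/\ linear_isometry A, diffeomorphism W D phi &
        forall p, W p -> x p *m A = X (phi p)].

Definition hypercylinder {R : realType} (c : R) : set 'rV[R]_4 :=
  [set q | - q 0 0 ^+ 2 + q 0 1 ^+ 2 + q 0 2 ^+ 2 = - c ^+ 2].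

Definition hypercylinder_type {R : realType} (W : set 'rV[R]_3)
    (x : 'rV[R]_3 -> 'rV[R]_4) : Prop :=
  exists (c : R) (A : 'M[R]_4),
    [/\ 0 < c, linear_isometry A &
        forall p, W p -> hypercylinder c (x p *m A)].

(* alpha is a unit speed curve on de Sitter space (necessarily space-like, as
   its normal space has signature (-, +)) and F1, F2 an orthonormal frame of its
   normal space. *)
Definition normal_frame {R : realType} (J : set R)
    (alpha F1 F2 : R -> 'rV[R]_4) : Prop :=
  [/\ smooth J alpha, smooth J F1, smooth J F2 &
   forall u, J u ->
   [/\ de_sitter (alpha u), mink ('D_1 alpha u) ('D_1 alpha u) = 1,
     mink (F1 u) (F1 u) = -1, mink (F2 u) (F2 u) = 1 &
     [/\ mink (F1 u) (F2 u) = 0,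
       mink (F1 u) (alpha u) = 0, mink (F1 u) ('D_1 alpha u) = 0,
       mink (F2 u) (alpha u) = 0 & mink (F2 u) ('D_1 alpha u) = 0]]].

(* The parameters (s, t, u) are the entries 0, 1, 2 of q. *)
Definition curve_param {R : realType} (c : R) (alpha F1 F2 : R -> 'rV[R]_4)
    (q : 'rV[R]_3) : 'rV[R]_4 :=
  let s := q 0 0 in let t := q 0 1 in let u := q 0 2 in
  s *: alpha u - c *: (cosh (t / c) *: F1 u + sinh (t / c) *: F2 u).

Definition curve_type {R : realType} (W : set 'rV[R]_3)
    (x : 'rV[R]_3 -> 'rV[R]_4) : Prop :=
  exists (c : R) (J : set R) (alpha F1 F2 : R -> 'rV[R]_4) (D : set 'rV[R]_3),
    [/\ c != 0, open J /\ is_interval J, normal_frame J alpha F1 F2,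
        open D /\ (forall q, D q -> J (q 0 2)) &
        spacelike_immersion D (curve_param c alpha F1 F2) /\
        congruent W x D (curve_param c alpha F1 F2)].

Definition regular_surface {R : realType} (L : set 'rV[R]_2)
    (y : 'rV[R]_2 -> 'rV[R]_4) : Prop :=
  [/\ smooth L y, (forall w, L w -> de_sitter (y w)) &
      forall w, L w -> forall v, 'D_v y w = 0 -> v = 0].

Definition spherical_normal {R : realType} (L : set 'rV[R]_2)
    (y n : 'rV[R]_2 -> 'rV[R]_4) : Prop :=
  timelike_unit_normal L y n /\ forall w, L w -> mink (n w) (y w) = 0.

(* (s, t, u) |-> (t, u) *)
Definition tu {R : realType} (q : 'rV[R]_3) : 'rV[R]_2 := col' 0 q.

Definition surface_param {R : realType} (c : R) (y n : 'rV[R]_2 -> 'rV[R]_4)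
    (q : 'rV[R]_3) : 'rV[R]_4 := q 0 0 *: y (tu q) - c *: n (tu q).

Definition surface_type {R : realType} (W : set 'rV[R]_3)
    (x : 'rV[R]_3 -> 'rV[R]_4) : Prop :=
  exists (c : R) (I : set R) (L : set 'rV[R]_2) (y n : 'rV[R]_2 -> 'rV[R]_4),
    let D := [set q : 'rV[R]_3 | I (q 0 0) /\ L (tu q)] in
    [/\ open I /\ is_interval I, open L, regular_surface L y,
        spherical_normal L y n &
        spacelike_immersion D (surface_param c y n) /\
        congruent W x D (surface_param c y n)].

(* Local classification, on a dense open subset: it leaves out the points near
   which the differential of x^T / |x^T| does not have constant rank, where M may
   be of none of the three types (the surface y of surface_param is then singular
   without being a curve or a point). *)
Definition locally_classified {R : realType} (U : set 'rV[R]_3)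
    (x : 'rV[R]_3 -> 'rV[R]_4) : Prop :=
  exists V : set 'rV[R]_3,
    [/\ open V, V `<=` U, U `<=` closure V &
     forall p, V p -> exists W : set 'rV[R]_3,
       [/\ open W, W p, W `<=` U &
        hypercylinder_type W x \/ curve_type W x \/ surface_type W x]].

(* Main.v *)
Require Import Defs.
From HB Require Import structures.
From mathcomp Require Import all_boot all_order all_algebra.
From mathcomp Require Import all_classical all_reals all_analysis.
From mathcomp Require Import ring lra.

Set Implicit Arguments.
Unset Strict Implicit.
Unset Printing Implicit Defensive.

Import Order.TTheory GRing.Theory Num.Theory.
Import numFieldNormedType.Exports.
Local Open Scope classical_set_scope.
Local Open Scope ring_scope.

(* Write b = -<x, N>, k for the principal curvature along x^T, and Z for the
   tangent field with Z_* = x^T. Then db = k <x^T, dx>. If k were nonzero on an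
   open set, then det S = 0 would give a nonzero kernel field W of S there, and
   the Codazzi equation for Z and W would force k |W|^2 = 0. Hence k = 0: both
   N and y = x^T / |x^T| are constant along the integral curves of Z, b is
   locally constant, and x = a y + b N with a = |x^T|. On a dense open set dy
   has locally constant rank 2, 1 or 0, and there the inverse function theorem
   gives coordinates of the shapes (a, y_i, y_j) and (a, t, arc length of y),
   or y is constant; these are the types (iii), (ii) and (i). Conversely, on
   each of the three types N is constant along the integral curves of Z; this
   is a closed condition, so it passes from a dense open set to U. *)

(** * Differentiation and the Minkowski product *)

(** Codazzi enters as [D_W D_Z N - D_Z D_W N = D_[W,Z] N], that is, as the symmetry of the second
    derivatives of [N] seen as a map into flat space. The obstacle is the smoothness of a kernel
    field: the rank of [S] may jump, and an eigenvector given by an existential statement need not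
    vary smoothly. Matrices that are polynomial in the entries of [S] and annihilate it provide
    smooth fields instead. Each of their rows has to vanish, and when all of them vanish so does
    [S]. The rank of [dy] is not stratified either. On an open set without classified points the
    failure of each type yields a linear relation between [da], [dy] and the coordinate
    differentials, until [dy = 0]. No vector field is integrated. Charts from the inverse function
    theorem turn constancy along the radial curves into constancy along coordinate segments, and
    these segments stay in the chart because its image is a ball of the sup norm, that is, a
    cube. *)

Section Differentiability.
Context {R : realType}.
Implicit Types V W : normedModType R.

(** The expansion of [f] at [p] serves for [g] as well, and uniqueness of the differential
    identifies its linear part with ['d g p]. *)
Lemma differentiable_near_eq {V W} {f g : V -> W} {p : V} :
  {near p, f =1 g} -> differentiable f p -> differentiable g p.
Proof.
move=> fg df.
have E : g \o shift p = cst (g p) + 'd f p +o_ 0 id.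
  apply/eqaddoP => eps eps0; have /eqaddoP/(_ eps eps0) := diff_locally df.
  have fg1 : \forall h \near (0 : V), f (h + p) = g (h + p).
    have := fg; rewrite (near_shift 0 p) /=; apply: filterS => h /=.
    by rewrite subr0.
  apply: filter_app; near=> h.
  have -> : (f \o shift p - (cst (f p) + 'd f p)) h
          = (g \o shift p - (cst (g p) + 'd f p)) h.
    rewrite /= !fctE /= (nbhs_singleton fg); congr (_ - _).
    by near: h.
  by [].
apply/diff_locallyP.
have c : continuous ('d f p) by exact: diff_continuous.
by rewrite (diff_unique c E).
Unshelve. all: by end_near. Qed.

Lemma derive_comp {V W} {X : normedModType R} (f : V -> W) (g : W -> X) p v :
  differentiable f p -> differentiable g (f p) ->
  'D_v (g \o f) p = 'D_('D_v f p) g (f p).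
Proof.
move=> df dg; rewrite (deriveE v (differentiable_comp df dg)) (diff_comp df dg).
by rewrite (deriveE v df) (deriveE _ dg).
Qed.

Lemma deriveDr {V W} {f : V -> W} {p : V} v w : differentiable f p ->
  'D_(v + w) f p = 'D_v f p + 'D_w f p.
Proof. by move=> df; rewrite !deriveE// linearD. Qed.

Lemma deriveZr {V W} {f : V -> W} {p : V} a v : differentiable f p ->
  'D_(a *: v) f p = a *: 'D_v f p.
Proof. by move=> df; rewrite !deriveE// linearZ. Qed.

Lemma deriveBr {V W} {f : V -> W} {p : V} v w : differentiable f p ->
  'D_(v - w) f p = 'D_v f p - 'D_w f p.
Proof. by move=> df; rewrite !deriveE// linearB. Qed.

Lemma derive_lin2 {V W : normedModType R} {f : V -> W} {p} s t v w :
  differentiable f p ->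
  'D_(s *: v + t *: w) f p = s *: 'D_v f p + t *: 'D_w f p.
Proof. by move=> df; rewrite !deriveE// linearD !linearZ. Qed.

Lemma derive_sumr {V W} {f : V -> W} {p : V} {n} (a : 'I_n -> R) (v : 'I_n -> V) :
  differentiable f p ->
  'D_(\sum_i a i *: v i) f p = \sum_i a i *: 'D_(v i) f p.
Proof.
move=> df; rewrite deriveE// linear_sum; apply: eq_bigr => i _.
by rewrite linearZ deriveE.
Qed.

Lemma derive_row {W} {n} {f : 'rV[R]_n -> W} {p} (v : 'rV[R]_n) :
  differentiable f p -> 'D_v f p = \sum_i v 0 i *: 'D_(delta_mx 0 i) f p.
Proof. by move=> df; rewrite {1}(row_sum_delta v) derive_sumr. Qed.

Lemma derive_coord {V} {m n} {f : V -> 'M[R]_(m, n)} {p : V} v i j :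
  derivable f p v -> 'D_v (fun q => f q i j) p = 'D_v f p i j.
Proof. by move=> df; rewrite (derive_mx df) mxE. Qed.

Lemma differentiable_mx_coord {V} {m n} {f : V -> 'M[R]_(m, n)} {p : V} i j :
  differentiable f p -> differentiable (fun q => f q i j) p.
Proof.
move=> df; apply: (@differentiable_comp _ _ _ _ f (fun M => M i j)) => //.
exact: differentiable_coord.
Qed.

Lemma differentiable_rowP {V} {n} {f : V -> 'rV[R]_n} {p : V} :
  (forall j, differentiable (fun q => f q 0 j) p) -> differentiable f p.
Proof.
move=> df.
have -> : f = \sum_(j < n) (fun q => f q 0 j *: (delta_mx 0 j : 'rV[R]_n)).
  by rewrite funeqE => q; rewrite fct_sumE {1}(row_sum_delta (f q)).
by apply: differentiable_sum => j; exact: differentiableZl.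
Qed.

Lemma differentiable_scale {V} {n} {a : V -> R} {f : V -> 'rV[R]_n} {p : V} :
  differentiable a p -> differentiable f p ->
  differentiable (fun q => a q *: f q) p.
Proof.
move=> da df; apply: differentiable_rowP => j.
have -> : (fun q => (a q *: f q) 0 j) = a * (fun q => f q 0 j).
  by rewrite funeqE => q; rewrite mxE fctE.
by apply: differentiableM => //; exact: differentiable_mx_coord.
Qed.

Lemma derive_scale {V} {n} {a : V -> R} {f : V -> 'rV[R]_n} {p : V} v :
  differentiable a p -> differentiable f p ->
  'D_v (fun q => a q *: f q) p = 'D_v a p *: f p + a p *: 'D_v f p.
Proof.
move=> da df; apply/rowP => j.
rewrite -derive_coord; last exact/diff_derivable/differentiable_scale.
have -> : (fun q => (a q *: f q) 0 j) = a * (fun q => f q 0 j).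
  by rewrite funeqE => q; rewrite mxE fctE.
have dfj := differentiable_mx_coord 0 j df.
rewrite deriveM; [|exact: diff_derivable|exact: diff_derivable].
rewrite derive_coord; last exact: diff_derivable.
by rewrite !mxE /GRing.scale /=; ring.
Qed.

Lemma minkE (a b : 'rV[R]_4) :
  mink a b = - (a 0 0 * b 0 0) + a 0 1 * b 0 1 + a 0 2 * b 0 2 + a 0 3 * b 0 3.
Proof.
rewrite /mink big_mkcond !big_ord_recl big_ord0 /= add0r addr0.
rewrite -!addrA; congr (_ + (_ + (_ + _))); congr (a _ _ * b _ _);
  exact/val_inj.
Qed.

Lemma minkC (a b : 'rV[R]_4) : mink a b = mink b a.
Proof. by rewrite !minkE ![b _ _ * _]mulrC. Qed.

Lemma minkDl (a b c : 'rV[R]_4) : mink (a + b) c = mink a c + mink b c.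
Proof. by rewrite !minkE !mxE; ring. Qed.

Lemma minkZl k (a c : 'rV[R]_4) : mink (k *: a) c = k * mink a c.
Proof. by rewrite !minkE !mxE; ring. Qed.

Lemma minkNl (a c : 'rV[R]_4) : mink (- a) c = - mink a c.
Proof. by rewrite !minkE !mxE; ring. Qed.

Lemma minkBl (a b c : 'rV[R]_4) : mink (a - b) c = mink a c - mink b c.
Proof. by rewrite minkDl minkNl. Qed.

Lemma minkDr (a b c : 'rV[R]_4) : mink c (a + b) = mink c a + mink c b.
Proof. by rewrite !(minkC c) minkDl. Qed.

Lemma minkZr k (a c : 'rV[R]_4) : mink c (k *: a) = k * mink c a.
Proof. by rewrite !(minkC c) minkZl. Qed.

Lemma minkNr (a c : 'rV[R]_4) : mink c (- a) = - mink c a.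
Proof. by rewrite !(minkC c) minkNl. Qed.

Lemma minkBr (a b c : 'rV[R]_4) : mink c (a - b) = mink c a - mink c b.
Proof. by rewrite minkDr minkNr. Qed.

Lemma mink0l (c : 'rV[R]_4) : mink 0 c = 0.
Proof. by rewrite -(scale0r c) minkZl mul0r. Qed.

Lemma mink0r (c : 'rV[R]_4) : mink c 0 = 0.
Proof. by rewrite minkC mink0l. Qed.

Lemma mink_funE {V : Type} (f g : V -> 'rV[R]_4) :
  (fun q => mink (f q) (g q)) =
  - ((fun q => f q 0 0) * (fun q => g q 0 0)) +
    (fun q => f q 0 1) * (fun q => g q 0 1) +
    (fun q => f q 0 2) * (fun q => g q 0 2) +
    (fun q => f q 0 3) * (fun q => g q 0 3).
Proof. by rewrite funeqE => q; rewrite minkE. Qed.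

Lemma differentiable_mink {V} {f g : V -> 'rV[R]_4} {p : V} :
  differentiable f p -> differentiable g p ->
  differentiable (fun q => mink (f q) (g q)) p.
Proof.
move=> df dg; rewrite mink_funE.
have d (h : V -> 'rV[R]_4) :
    differentiable h p -> forall j, differentiable (fun q => h q 0 j) p.
  by move=> dh j; exact: differentiable_mx_coord.
by do ![apply: differentiableD|apply: differentiableN|apply: differentiableM];
  exact: d.
Qed.

Lemma derive_mink {V} {f g : V -> 'rV[R]_4} {p : V} v :
  differentiable f p -> differentiable g p ->
  'D_v (fun q => mink (f q) (g q)) p =
  mink ('D_v f p) (g p) + mink (f p) ('D_v g p).
Proof.
move=> df dg; rewrite mink_funE.
have d (h : V -> 'rV[R]_4) : differentiable h p -> forall j,
    is_derive p v (fun q => h q 0 j) ('D_v h p 0 j).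
  move=> dh j; rewrite -derive_coord; last exact: diff_derivable.
  exact/derivableP/diff_derivable/differentiable_mx_coord.
have m j := is_deriveM (d f df j) (d g dg j).
rewrite (@derive_val _ _ _ _ _ _ _ (is_deriveD (is_deriveD (is_deriveD
  (is_deriveN (m 0)) (m 1)) (m 2)) (m 3))) !minkE /GRing.scale /=.
move: ('D_v f p) ('D_v g p) (f p) (g p) => a b c e.
ring.
Qed.

End Differentiability.

(** * Calculus of C^k maps *)

Section CkTheory.
Context {R : realType}.
Implicit Types V W : normedModType R.

Lemma open_near {T : topologicalType} {U : set T} {P : T -> Prop} {p : T} :
  open U -> (forall q, U q -> P q) -> U p -> \forall q \near p, P q.
Proof. by move=> oU UP Up; apply: filterS (open_nbhs_nbhs (conj oU Up)). Qed.

Lemma derive_open_eq {V W} {U : set V} {f g : V -> W} {p} v : open U ->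
  (forall q, U q -> f q = g q) -> U p -> 'D_v f p = 'D_v g p.
Proof. by move=> oU fg Up; apply: near_eq_derive; exact: open_near Up. Qed.

Lemma derive_open_cst {V W} {U : set V} {f : V -> W} {p} v (w : W) : open U ->
  (forall q, U q -> f q = w) -> U p -> 'D_v f p = 0.
Proof.
move=> oU fw Up; rewrite (derive_open_eq (g := cst w) v oU fw Up).
exact: derive_cst.
Qed.

Lemma Ck_sub {V W} k (U U' : set V) (f : V -> W) :
  U' `<=` U -> Ck k U f -> Ck k U' f.
Proof.
move=> U'U; elim: k f => [|k IH] f /=; first by move=> cf p /U'U; exact: cf.
by move=> [df Df]; split => [p /U'U|v]; [exact: df|exact: IH].
Qed.

Lemma Ck_ext {V W} k (U : set V) (f g : V -> W) : open U ->
  (forall p, U p -> f p = g p) -> Ck k U f -> Ck k U g.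
Proof.
move=> oU; elim: k f g => [|k IH] f g fg /=.
  move=> cf p Up; have nfg := open_near oU fg Up.
  rewrite /prop_for /continuous_at -fg//.
  by apply: cvg_trans (cf p Up); exact: near_eq_cvg.
move=> [df Df]; split => [p Up|v].
  apply: differentiable_near_eq (df p Up); exact: open_near Up.
by apply: IH (Df v) => p Up; exact: derive_open_eq Up.
Qed.

Lemma Ck_pred {V W} k (U : set V) (f : V -> W) : Ck k.+1 U f -> Ck k U f.
Proof.
elim: k f => [|k IH] f /= [df Df].
  by move=> p /df; exact: differentiable_continuous.
by split=> // v; apply: IH; exact: Df.
Qed.

Lemma Ck_cst {V W} k (U : set V) (w : W) : Ck k U (fun=> w).
Proof.
elim: k w => [|k IH] w /=; first by move=> p _; exact: cst_continuous.
split=> [p _|v]; first exact: differentiable_cst.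
rewrite (_ : (fun p => 'D_v (fun=> w) p) = fun=> 0); first exact: IH.
by rewrite funeqE => p; exact: derive_cst.
Qed.

Lemma CkD {V W} k (U : set V) (f g : V -> W) : open U ->
  Ck k U f -> Ck k U g -> Ck k U (fun p => f p + g p).
Proof.
move=> oU; elim: k f g => [|k IH] f g /=.
  by move=> cf cg p Up; apply: continuousD; [exact: cf|exact: cg].
move=> [df Df] [dg Dg]; split=> [p Up|v].
  by apply: differentiableD; [exact: df|exact: dg].
apply: Ck_ext oU _ (IH _ _ (Df v) (Dg v)) => p Up /=.
by rewrite deriveD//; apply: diff_derivable; [exact: df|exact: dg].
Qed.

Lemma CkM {V} k (U : set V) (f g : V -> R) : open U ->
  Ck k U f -> Ck k U g -> Ck k U (fun p => f p * g p).
Proof.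
move=> oU; elim: k f g => [|k IH] f g.
  by move=> cf cg p Up; apply: continuousM; [exact: cf|exact: cg].
move=> Cf Cg; have Cf' := Ck_pred Cf; have Cg' := Ck_pred Cg.
move: Cf Cg => [df Df] [dg Dg]; split=> [p Up|v].
  by apply: differentiableM; [exact: df|exact: dg].
apply: Ck_ext oU _ (CkD oU (IH _ _ Cf' (Dg v)) (IH _ _ Cg' (Df v))) => p Up /=.
by rewrite deriveM//; apply: diff_derivable; [exact: df|exact: dg].
Qed.

Lemma CkN {V W} k (U : set V) (f : V -> W) : open U ->
  Ck k U f -> Ck k U (fun p => - f p).
Proof.
move=> oU; elim: k f => [|k IH] f /=.
  by move=> cf p Up; apply: continuousN; exact: cf.
move=> [df Df]; split=> [p Up|v]; first by apply: differentiableN; exact: df.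
apply: Ck_ext oU _ (IH _ (Df v)) => p Up /=.
by rewrite deriveN//; apply: diff_derivable; exact: df.
Qed.

Lemma Ck_sum {V W} k (U : set V) (I : finType) (P : pred I) (F : I -> V -> W) :
  open U -> (forall i, P i -> Ck k U (F i)) ->
  Ck k U (fun p => \sum_(i | P i) F i p).
Proof.
move=> oU CF; rewrite (_ : (fun p => _) = \sum_(i | P i) F i); last first.
  by rewrite funeqE => p; rewrite fct_sumE.
by elim/big_ind : _ => // [|f g]; [exact: Ck_cst|exact: CkD].
Qed.

Lemma Ck_prod {V} k (U : set V) (I : finType) (P : pred I) (F : I -> V -> R) :
  open U -> (forall i, P i -> Ck k U (F i)) ->
  Ck k U (fun p => \prod_(i | P i) F i p).
Proof.
move=> oU CF; rewrite (_ : (fun p => _) = \prod_(i | P i) F i); last first.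
  by rewrite funeqE => p; rewrite fct_prodE.
by elim/big_ind : _ => // [|f g]; [exact: Ck_cst|exact: CkM].
Qed.

Lemma Ck_coord {V} {m n} k (U : set V) (f : V -> 'M[R]_(m, n)) i j : open U ->
  Ck k U f -> Ck k U (fun p => f p i j).
Proof.
move=> oU; elim: k f => [|k IH] f /=.
  move=> cf p Up; apply: (@continuous_comp _ _ _ f (fun M => M i j)).
    exact: cf.
  exact: coord_continuous.
move=> [df Df]; split=> [p Up|v]; first exact/differentiable_mx_coord/df.
apply: Ck_ext oU _ (IH _ (Df v)) => p Up /=.
by rewrite derive_coord//; apply: diff_derivable; exact: df.
Qed.

Lemma Ck_row {V} {n} k (U : set V) (f : V -> 'rV[R]_n) : open U ->
  (forall j, Ck k U (fun p => f p 0 j)) -> Ck k U f.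
Proof.
move=> oU; elim: k f => [|k IH] f /= Cf.
  move=> p Up.
  have -> : f = \sum_(j < n) (fun q => f q 0 j *: (delta_mx 0 j : 'rV[R]_n)).
    by rewrite funeqE => q; rewrite fct_sumE {1}(row_sum_delta (f q)).
  apply: (big_ind (fun h => {for p, continuous h})).
  - exact: cst_continuous.
  - by move=> g h; exact: continuousD.
  - by move=> j _; apply: continuousZl; exact: Cf.
have df p : U p -> differentiable f p.
  by move=> Up; apply: differentiable_rowP => j; have [+ _] := Cf j; exact.
split=> // v; apply: IH => j; have [_ Df] := Cf j.
apply: Ck_ext oU _ (Df v) => p Up.
by rewrite derive_coord//; apply: diff_derivable; exact: df.
Qed.

Lemma Ck_scale {V} {n} k (U : set V) (a : V -> R) (f : V -> 'rV[R]_n) :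
  open U -> Ck k U a -> Ck k U f -> Ck k U (fun p => a p *: f p).
Proof.
move=> oU Ca Cf; apply: (Ck_row oU) => j.
apply: Ck_ext oU _ (CkM oU Ca (Ck_coord 0 j oU Cf)) => p _.
by rewrite mxE.
Qed.

(** Induction on the order through the chain rule in coordinates: ['D_v (g \o f)] is the sum of the
    coordinates of ['D_v f] times the maps ['D_(b i) g \o f]. The basis is abstract so that row
    vectors and the line share one proof, and [g] is scalar so that the summands are products of
    real functions. *)
Let Ck_comp_basis {V W} {n} k (U : set V) (D : set W) (f : V -> W) (g : W -> R)
    (b : 'I_n -> W) (c : 'I_n -> W -> R) :
  open U -> (forall w, w = \sum_i c i w *: b i) ->
  (forall k (h : V -> W) i, Ck k U h -> Ck k U (fun p => c i (h p))) ->
  (forall p, U p -> D (f p)) ->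
  Ck k U f -> Ck k D g -> Ck k U (g \o f).
Proof.
move=> oU bc Cc UD; elim: k g => [|k IH] g.
  by move=> cf cg p Up; apply: continuous_comp; [exact: cf|exact/cg/UD].
move=> Cf [dg Dg]; have Cf' := Ck_pred Cf; have [df Df] := Cf.
split=> [p Up|v].
  by apply: differentiable_comp; [exact: df|exact/dg/UD].
have C i : Ck k U (fun p => c i ('D_v f p) * 'D_(b i) g (f p)).
  apply: CkM => //; first exact: Cc (Df v).
  by apply: (IH (fun w => 'D_(b i) g w)) => //; exact: Dg.
apply: Ck_ext oU _ (Ck_sum (P := predT) oU (fun i _ => C i)) => p Up.
have dgp := dg _ (UD _ Up); rewrite (derive_comp v (df p Up) dgp).
by rewrite [in RHS](bc ('D_v f p)) derive_sumr.
Qed.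

Lemma Ck_comp {V} {n m} k (U : set V) (D : set 'rV[R]_n) (f : V -> 'rV[R]_n)
    (g : 'rV[R]_n -> 'rV[R]_m) :
  open U -> (forall p, U p -> D (f p)) -> open D ->
  Ck k U f -> Ck k D g -> Ck k U (g \o f).
Proof.
move=> oU UD oD Cf Cg; apply: (Ck_row oU) => j.
apply: (Ck_comp_basis (g := fun w => g w 0 j) (b := fun i => delta_mx 0 i)
  (c := fun i w => w 0 i) oU _ _ UD) => //.
- by move=> w; exact: row_sum_delta.
- by move=> ? ? ?; exact: Ck_coord.
- exact: Ck_coord.
Qed.

Lemma Ck_compR {V} {n} k (U : set V) (D : set 'rV[R]_n) (f : V -> 'rV[R]_n)
    (g : 'rV[R]_n -> R) :
  open U -> (forall p, U p -> D (f p)) ->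
  Ck k U f -> Ck k D g -> Ck k U (g \o f).
Proof.
move=> oU UD Cf Cg.
apply: (Ck_comp_basis (b := fun i => delta_mx 0 i)
  (c := fun i w => w 0 i) oU _ _ UD) => //.
- by move=> w; exact: row_sum_delta.
- by move=> ? ? ?; exact: Ck_coord.
Qed.

Lemma Ck_comp1R {V} k (U : set V) (D : set R) (f : V -> R) (g : R -> R) :
  open U -> (forall p, U p -> D (f p)) ->
  Ck k U f -> Ck k D g -> Ck k U (g \o f).
Proof.
move=> oU UD Cf Cg.
apply: (Ck_comp_basis (n := 1) (b := fun=> 1 : R) (c := fun=> id) oU _ _ UD
  Cf Cg) => //.
by move=> w; rewrite big_ord_recl big_ord0 addr0 [RHS]mulr1.
Qed.

Lemma Ck_comp1 {V} {m} k (U : set V) (D : set R) (f : V -> R)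
    (g : R -> 'rV[R]_m) :
  open U -> (forall p, U p -> D (f p)) -> open D ->
  Ck k U f -> Ck k D g -> Ck k U (g \o f).
Proof.
move=> oU UD oD Cf Cg; apply: (Ck_row oU) => j.
apply: (Ck_comp1R (g := fun w => g w 0 j) oU UD) => //.
exact: Ck_coord.
Qed.

Lemma Ck_lin {V W} k (U : set V) (f : {linear V -> W}) : continuous f ->
  Ck k U f.
Proof.
move=> cf; case: k => [|k] /=; first by move=> p _; exact: cf.
split=> [p _|v]; first exact: linear_differentiable.
rewrite (_ : (fun p => 'D_v f p) = fun=> f v); first exact: Ck_cst.
rewrite funeqE => p; rewrite deriveE ?diff_lin//; exact: linear_differentiable.
Qed.

Lemma Ck_id {V : normedModType R} k (U : set V) : Ck k U (fun q => q).
Proof. by apply: (Ck_lin k U (f := idfun)) => q. Qed.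

End CkTheory.

(** * Smoothness of elementary functions, determinants and inverse matrices *)

Section SmoothFunctions.
Context {R : realType}.
Implicit Types V W : normedModType R.

(** On the line ['D_v f] is [v] times the derivative, so a formula for the derivative gains one
    order. Where that formula involves the function itself, as for the inverse, the exponential and
    the square root, this closes an induction. *)
Lemma Ck_line k (U : set R) (f df : R -> R) : open U ->
  (forall t, U t -> is_derive t 1 f (df t)) -> Ck k U df -> Ck k.+1 U f.
Proof.
move=> oU fdf Cdf.
have d t : U t -> differentiable f t.
  by move=> /fdf Ut; apply/derivable1_diffP; exact: ex_derive.
split=> [//|v]; apply: Ck_ext oU _ (CkM oU (Ck_cst k U v) Cdf) => t Ut.
rewrite -[v in RHS]mulr1 (_ : v * 1 = v *: (1 : R))// (deriveZr _ _ (d t Ut)).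
by rewrite (@derive_val _ _ _ _ _ _ _ (fdf t Ut)).
Qed.

Lemma open_neq0 : open [set t : R | t != 0].
Proof.
rewrite (_ : [set _ | _] = ~` [set 0]); first exact/closed_openC/closed_eq.
by apply/seteqP; split => t /= /eqP.
Qed.

Lemma open_pos : open [set t : R | 0 < t].
Proof. exact: open_gt. Qed.

Lemma Ck_inv k : Ck k [set t : R | t != 0] (fun t => t^-1).
Proof.
elim: k => [|k IH]; first by move=> t /= t0; exact: inv_continuous.
apply: Ck_line open_neq0 _ (CkN open_neq0 (CkM open_neq0 IH IH)) => t /= t0.
have d : is_derive t 1 (fun t : R => t) 1 by exact: is_derive_id.
have := is_deriveV t0 d; rewrite /= => /is_derive_eq; apply.
by rewrite /GRing.scale /= mulr1 expr2 invfM.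
Qed.

Lemma Ck_expR k : Ck k [set: R] expR.
Proof.
elim: k => [|k IH]; first by move=> t _; exact: continuous_expR.
by apply: Ck_line openT _ IH => t _; exact: is_derive_expR.
Qed.

Lemma Ck_ln k : Ck k [set t : R | 0 < t] (@ln R).
Proof.
case: k => [|k]; first by move=> t t0; exact: continuous_ln.
apply: Ck_line open_pos _ (Ck_sub _ (Ck_inv k)) => t /= t0.
by rewrite gt_eqF.
Qed.

Lemma Ck_sqrt k : Ck k [set t : R | 0 < t] Num.sqrt.
Proof.
elim: k => [|k IH]; first by move=> t _; exact: sqrt_continuous.
have C := CkM open_pos (Ck_cst k _ (2 : R)) IH.
apply: Ck_line open_pos _ (Ck_comp1R open_pos _ C (Ck_inv k)) => t /= t0.
by rewrite mulf_neq0// gt_eqF ?sqrtr_gt0.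
Qed.

Lemma CkV {V} k (U : set V) (f : V -> R) : open U ->
  (forall p, U p -> f p != 0) -> Ck k U f -> Ck k U (fun p => (f p)^-1).
Proof. by move=> oU f0 Cf; exact: (Ck_comp1R oU f0 Cf (Ck_inv k)). Qed.

Lemma Ck_mink {V} k (U : set V) (f g : V -> 'rV[R]_4) : open U ->
  Ck k U f -> Ck k U g -> Ck k U (fun p => mink (f p) (g p)).
Proof.
move=> oU Cf Cg; have C j := CkM oU (Ck_coord 0 j oU Cf) (Ck_coord 0 j oU Cg).
rewrite mink_funE.
exact: (CkD oU (CkD oU (CkD oU (CkN oU (C 0)) (C 1)) (C 2)) (C 3)).
Qed.

Lemma Ck_det {V} {n} k (U : set V) (M : V -> 'M[R]_n) : open U ->
  (forall i j, Ck k U (fun p => M p i j)) -> Ck k U (fun p => \det (M p)).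
Proof.
move=> oU CM; rewrite /determinant.
apply: (Ck_sum oU) => s _; apply: (CkM oU); first exact: Ck_cst.
by apply: (Ck_prod oU) => i _.
Qed.

Lemma Ck_adj {V} {n} k (U : set V) (M : V -> 'M[R]_n) i j : open U ->
  (forall i j, Ck k U (fun p => M p i j)) -> Ck k U (fun p => (\adj (M p)) i j).
Proof.
move=> oU CM.
rewrite (_ : (fun p => _) = fun p => (-1) ^+ (j + i) * \det (row' j (col' i (M p)))).
  apply: (CkM oU); first exact: Ck_cst.
  apply: (Ck_det oU) => a b.
  by rewrite (_ : (fun p => _) = fun p => M p (lift j a) (lift i b));
    [exact: CM | rewrite funeqE => p; rewrite !mxE].
by rewrite funeqE => p; rewrite mxE.
Qed.

Lemma Ck_invmx {V} {n} k (U : set V) (M : V -> 'M[R]_n) i j : open U ->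
  (forall p, U p -> \det (M p) != 0) ->
  (forall i j, Ck k U (fun p => M p i j)) -> Ck k U (fun p => (invmx (M p)) i j).
Proof.
move=> oU M0 CM.
apply: Ck_ext oU _ (CkM oU (CkV oU M0 (Ck_det oU CM)) (Ck_adj i j oU CM)).
move=> p Up /=; rewrite /invmx unitmxE unitfE (M0 p Up). by rewrite [RHS]mxE.
Qed.

Lemma smooth_diff {V W} (U : set V) (f : V -> W) p :
  smooth U f -> U p -> differentiable f p.
Proof. by move=> sf; have [+ _] := sf 1; exact. Qed.

Lemma smooth_derive {V W} (U : set V) (f : V -> W) v :
  smooth U f -> smooth U (fun p => 'D_v f p).
Proof. by move=> sf k; have [_] := sf k.+1; exact. Qed.

Lemma smooth_continuous {V W} (U : set V) (f : V -> W) p :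
  smooth U f -> U p -> {for p, continuous f}.
Proof. by move=> sf; exact: (sf 0). Qed.

Lemma smooth_field {V} {n m} (U : set V) (P : V -> 'rV[R]_n)
    (f : 'I_n -> V -> 'rV[R]_m) : open U ->
  smooth U P -> (forall i, smooth U (f i)) ->
  smooth U (fun p => \sum_i P p 0 i *: f i p).
Proof.
move=> oU sP sf k; apply: (Ck_sum oU) => i _.
by apply: (Ck_scale oU); [exact: (Ck_coord _ _ oU (sP k))|exact: sf].
Qed.

Lemma jacobianE {n m} (f : 'rV[R]_n -> 'rV[R]_m) p i j :
  differentiable f p -> jacobian f p i j = 'D_(delta_mx 0 i) f p 0 j.
Proof. by move=> df; rewrite /jacobian mxE deriveE. Qed.

Lemma Ck_jacobian {n m} k (U : set 'rV[R]_n) (f : 'rV[R]_n -> 'rV[R]_m) i j :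
  open U -> smooth U f -> Ck k U (fun p => jacobian f p i j).
Proof.
move=> oU sf.
apply: Ck_ext oU _ (Ck_coord 0 j oU (smooth_derive (delta_mx 0 i) sf k)).
by move=> p Up; rewrite jacobianE//; exact: smooth_diff Up.
Qed.

End SmoothFunctions.

(** * Mean values and symmetry of second derivatives *)

Section MeanValue.
Context {R : realType}.
Implicit Types V : normedModType R.

Lemma is_derive_line {V W : normedModType R} (F : V -> W) p w s :
  differentiable F (p + s *: w) ->
  is_derive s 1 (fun t : R => F (p + t *: w)) ('D_w F (p + s *: w)).
Proof.
move=> dF; pose l : R -> V := *:%R ^~ w; pose g := cst p + l.
have dl : is_diff s l ( *:%R ^~ w) := is_diff_scalel s w.
have dlx : differentiable l s := @ex_diff _ _ _ _ _ _ _ dl.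
have dc : differentiable (cst p : R -> V) s by exact: differentiable_cst.
have dg : differentiable g s := differentiableD dc dlx.
have Dg : 'D_1 g s = w.
  rewrite /g deriveD; [|exact: diff_derivable..].
  by rewrite derive_cst add0r deriveE// (@diff_val _ _ _ _ _ _ _ dl) scale1r.
have dF' : differentiable F (g s) by [].
have -> : (fun t : R => F (p + t *: w)) = F \o g by [].
split; first exact/diff_derivable/differentiable_comp.
by rewrite (derive_comp (1 : R) dg dF') Dg.
Qed.

Lemma MVT_line {V} (F : V -> R) p w (h : R) : 0 < h ->
  (forall s, 0 <= s <= h -> differentiable F (p + s *: w)) ->
  exists2 s, 0 <= s <= h & F (p + h *: w) - F p = h * 'D_w F (p + s *: w).
Proof.
move=> h0 dF.
have d s : 0 <= s <= h -> is_derive s 1 (fun t : R => F (p + t *: w))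
    ('D_w F (p + s *: w)) by move=> /dF; exact: is_derive_line.
have d' s : s \in `]0, h[%R -> is_derive s 1 (fun t : R => F (p + t *: w))
    ('D_w F (p + s *: w)).
  by rewrite in_itv /= => /andP[s0 sh]; apply: d; rewrite !ltW.
have c : {within `[0, h], continuous (fun t : R => F (p + t *: w))}.
  apply: derivable_within_continuous => s; rewrite in_itv /= => sh.
  exact: (@ex_derive _ _ _ _ _ _ _ (d s sh)).
have [s sh E] := MVT_segment (ltW h0) d' c.
exists s; first by move: sh; rewrite in_itv.
by move: E; rewrite scale0r addr0 subr0 mulrC.
Qed.

Lemma ball_line {V} (c p q : V) r s : ball c r p -> ball c r q ->
  0 <= s <= 1 -> ball c r (p + s *: (q - p)).
Proof.
rewrite -!ball_normE /= => cp cq /andP[s0 s1].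
have -> : c - (p + s *: (q - p)) = (1 - s) *: (c - p) + s *: (c - q).
  rewrite opprD addrA [in RHS]scalerBl scale1r -[in RHS]addrA.
  rewrite [- _ + _ in RHS]addrC -scalerBr -scalerN opprB; congr (_ + _ *: _).
  by rewrite opprB [RHS]addrC addrA subrK.
apply: le_lt_trans (ler_normD _ _) _; rewrite !normrZ.
rewrite (ger0_norm s0) ger0_norm ?subr_ge0//.
have [->|sN0] := eqVneq s 0; first by rewrite subr0 mul1r mul0r addr0.
have {}s0 : 0 < s by rewrite lt_neqAle eq_sym sN0.
have -> : r = (1 - s) * r + s * r by rewrite -mulrDl subrK mul1r.
by rewrite ler_ltD// ?ltr_pM2l// ler_wpM2l ?subr_ge0// ltW.
Qed.

(** Only the direction [q - p] is differentiated, so the lemma serves both for locally constant maps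
    and for maps that are constant along coordinate lines. *)
Lemma derive0_ball_eq {V} {n} (F : V -> 'rV[R]_n) c r p q :
  ball c r p -> ball c r q ->
  (forall z, ball c r z -> differentiable F z) ->
  (forall z, ball c r z -> 'D_(q - p) F z = 0) -> F q = F p.
Proof.
move=> cp cq dF DF; apply/rowP => j; apply/eqP; rewrite -subr_eq0; apply/eqP.
have b s : 0 <= s <= 1 -> ball c r (p + s *: (q - p)) by exact: ball_line.
have [s /b bs|s /b bs] := @MVT_line V (fun z => F z 0 j) p (q - p) 1 ltr01.
  exact/differentiable_mx_coord/dF.
rewrite scale1r [p + _]addrC subrK => ->.
by rewrite derive_coord ?DF// ?mxE ?mulr0//; exact/diff_derivable/dF.
Qed.

Lemma derive0_ball_eqR {V} (F : V -> R) c r p q :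
  ball c r p -> ball c r q ->
  (forall z, ball c r z -> differentiable F z) ->
  (forall z, ball c r z -> 'D_(q - p) F z = 0) -> F q = F p.
Proof.
move=> cp cq dF DF; apply/eqP; rewrite -subr_eq0; apply/eqP.
have b s : 0 <= s <= 1 -> ball c r (p + s *: (q - p)) by exact: ball_line.
have [s /b bs|s /b bs] := @MVT_line V F p (q - p) 1 ltr01; first exact: dF.
by rewrite scale1r [p + _]addrC subrK => ->; rewrite DF// mulr0.
Qed.

(** The mean value theorem in the direction [u] for [q |-> f (q + h *: v) - f q], then in the
    direction [v] for ['D_u f]. *)
Let second_difference {V} (f : V -> R) U p u v (h : R) : 0 < h -> smooth U f ->
  (forall s t, 0 <= s <= h -> 0 <= t <= h -> U (p + s *: u + t *: v)) ->
  exists s t, [/\ 0 <= s <= h, 0 <= t <= h &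
    (f (p + h *: u + h *: v) - f (p + h *: u)) - (f (p + h *: v) - f p) =
    h * (h * 'D_v (fun q => 'D_u f q) (p + s *: u + t *: v))].
Proof.
move=> h0 sf hU; have hh : 0 <= h <= h by rewrite lexx ltW.
have zh0 : 0 <= (0 : R) <= h by rewrite lexx ltW.
have U0 s : 0 <= s <= h -> U (p + s *: u).
  by move=> sh; have := hU s 0 sh zh0; rewrite scale0r addr0.
pose T q := q + h *: v.
have dT q : differentiable T q by apply: differentiableD.
have DT q : 'D_u T q = u by rewrite deriveD// derive_id derive_cst addr0.
have dfT q : U (T q) -> differentiable (f \o T) q.
  by move=> UTq; apply: differentiable_comp => //; exact: smooth_diff UTq.
have [s sh|s sh] := @MVT_line V (f \o T - f) p u h h0.
  apply: differentiableB; last exact/(smooth_diff sf)/U0.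
  by apply: dfT; exact: hU.
rewrite /GRing.add /= /GRing.opp /= => ->.
have UT := hU s h sh hh.
rewrite deriveB; last 2 first.
  exact/diff_derivable/dfT.
  exact/diff_derivable/(smooth_diff sf)/U0.
rewrite (derive_comp _ (dT _) (smooth_diff sf UT)) DT /T.
have [t th|t th ->] := @MVT_line V (fun q => 'D_u f q) (p + s *: u) v h h0.
  exact: smooth_diff (smooth_derive u sf) (hU _ _ sh th).
by exists s, t.
Qed.

(** The two orders of differencing produce different intermediate points, so equality is available
    only between two points [q] and [q'] near [p]. *)
Let eq_at_limit {V} (A B : V -> R) p :
  {for p, continuous A} -> {for p, continuous B} ->
  (forall d : R, 0 < d ->
    exists q q', [/\ ball p d q, ball p d q' & A q = B q']) -> A p = B p.
Proof.
move=> cA cB AB; apply: contrapT => /eqP neq.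
have e0 : 0 < `|A p - B p| / 2 by rewrite divr_gt0// normr_gt0 subr_eq0.
have /cvgrPdist_lt/(_ _ e0)/nbhs_ballP[dA /= dA0 dAP] := cA.
have /cvgrPdist_lt/(_ _ e0)/nbhs_ballP[dB /= dB0 dBP] := cB.
have [|q [q' [pq pq' E]]] := AB (Num.min dA dB); first by rewrite lt_min dA0.
have Aq : `|A p - A q| < `|A p - B p| / 2.
  by apply: dAP; apply: le_ball pq; rewrite ge_min lexx.
have Bq : `|B p - B q'| < `|A p - B p| / 2.
  by apply: dBP; apply: le_ball pq'; rewrite ge_min lexx orbT.
have := ler_distD (A q) (A p) (B p).
rewrite {2}E [`|B q' - B p|]distrC leNgt => /negP; apply.
by rewrite [ltRHS]splitr ltrD.
Qed.

(** The second difference over the parallelogram with sides [h *: u] and [h *: v] is symmetric in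
    [u] and [v], and it equals [h ^+ 2] times either mixed derivative at some point of the
    parallelogram. *)
Lemma derive_swapR {V} (f : V -> R) U p u v : open U -> smooth U f -> U p ->
  'D_v (fun q => 'D_u f q) p = 'D_u (fun q => 'D_v f q) p.
Proof.
move=> oU sf Up.
have sA := smooth_derive v (smooth_derive u sf).
have sB := smooth_derive u (smooth_derive v sf).
apply: eq_at_limit (smooth_continuous sA Up) (smooth_continuous sB Up) _.
move=> d' d'0; have /nbhs_ballP[dU /= dU0 dUP] := open_nbhs_nbhs (conj oU Up).
pose d := Num.min d' dU; have d0 : 0 < d by rewrite lt_min d'0.
(* With [h = d / K] the whole parallelogram lies within [d] of [p]; the summand 1 makes [K] positive
   and the bound strict. *)
pose K := `|u| + `|v| + 1; have K0 : 0 < K by rewrite ltr_wpDl// addr_ge0.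
pose h := d / K; have h0 : 0 < h by rewrite divr_gt0.
have dP' s t : 0 <= s <= h -> 0 <= t <= h ->
    ball p d (p + s *: u + t *: v).
  move=> /andP[s0 sh] /andP[t0 th]; rewrite -ball_normE /= -addrA opprD addrA.
  rewrite subrr add0r normrN; apply: le_lt_trans (ler_normD _ _) _.
  rewrite !normrZ (ger0_norm s0) (ger0_norm t0).
  apply: (@le_lt_trans _ _ (h * `|u| + h * `|v|)).
    by rewrite lerD// ler_wpM2r.
  by rewrite -mulrDr -[ltRHS](divfK (lt0r_neq0 K0)) ltr_pM2l// ltrDl.
have hU s t : 0 <= s <= h -> 0 <= t <= h -> U (p + s *: u + t *: v).
  move=> sh th; apply: dUP; apply: le_ball (dP' s t sh th).
  by rewrite ge_min lexx orbT.
have hU' s t : 0 <= s <= h -> 0 <= t <= h -> U (p + s *: v + t *: u).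
  by move=> sh th; rewrite addrAC; exact: hU.
have [s [t [sh th E]]] := second_difference h0 sf hU.
have [s' [t' [sh' th' E']]] := second_difference h0 sf hU'.
have dd : d <= d' by rewrite ge_min lexx.
exists (p + s *: u + t *: v), (p + t' *: u + s' *: v); split.
- exact: le_ball (dP' _ _ sh th).
- exact: le_ball (dP' _ _ th' sh').
apply: (mulfI (lt0r_neq0 h0)); apply: (mulfI (lt0r_neq0 h0)).
have AC a b : p + a *: v + b *: u = p + b *: u + a *: v by rewrite addrAC.
rewrite !AC in E'.
apply: (etrans (esym E)); apply: (etrans _ E').
move: (f _) (f _) (f _) (f _) => a b c e.
by ring.
Qed.

Lemma derive_swap {V} {n} (f : V -> 'rV[R]_n) U p u v :
  open U -> smooth U f -> U p ->
  'D_v (fun q => 'D_u f q) p = 'D_u (fun q => 'D_v f q) p.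
Proof.
move=> oU sf Up; apply/rowP => j.
have sj : smooth U (fun q => f q 0 j) by move=> k; exact: Ck_coord.
have d w q : U q -> 'D_w (fun q => f q 0 j) q = 'D_w f q 0 j.
  by move=> Uq; rewrite derive_coord//; exact/diff_derivable/(smooth_diff sf).
have d2 w w' : 'D_w' (fun q => 'D_w f q) p 0 j =
    'D_w' (fun q => 'D_w (fun q => f q 0 j) q) p.
  rewrite -derive_coord; last first.
    exact/diff_derivable/(smooth_diff (smooth_derive w sf)).
  by apply: (derive_open_eq _ oU) => // q Uq; rewrite d.
exact: etrans (d2 u v) (etrans (derive_swapR u v oU sj Up) (esym (d2 v u))).
Qed.

End MeanValue.

(** * The inverse function theorem *)

Section LinearApproximation.
Context {R : realType}.
Implicit Types V W : normedModType R.

Lemma differentiable_approx {V W} (f : V -> W) p :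
  differentiable f p -> forall e : R, 0 < e ->
  \forall h \near (0 : V), `|f (h + p) - f p - 'D_h f p| <= e * `|h|.
Proof.
move=> df e e0; have /eqaddoP/(_ e e0) := diff_locally df.
apply: filterS => h; rewrite /= !fctE /= opprD addrA deriveE//.
Qed.

Lemma approx_differentiable {V W} (f : V -> W) (L : {linear V -> W}) p :
  continuous L ->
  (forall e : R, 0 < e ->
    \forall h \near (0 : V), `|f (h + p) - f p - L h| <= e * `|h|) ->
  differentiable f p /\ forall v, 'D_v f p = L v.
Proof.
move=> cL fL.
have E : f \o shift p = cst (f p) + L +o_ 0 id.
  apply/eqaddoP => e e0; apply: filterS (fL e e0) => h.
  by rewrite /= !fctE /= opprD addrA.
have dL := diff_unique cL E.
have df : differentiable f p by apply/diff_locallyP; rewrite dL.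
by split=> // v; rewrite deriveE// dL.
Qed.

End LinearApproximation.

Section RowNorm.
Context {R : realType}.

Lemma rV_norm_le {n} (v : 'rV[R]_n) c : 0 <= c ->
  (forall j, `|v 0 j| <= c) -> `|v| <= c.
Proof.
move=> c0 vc; rewrite /Num.Def.normr /= mx_normrE.
by apply: bigmax_le => // -[i j] _ /=; rewrite (ord1 i).
Qed.

Lemma rV_coord_le {n} (v : 'rV[R]_n) j : `|v 0 j| <= `|v|.
Proof.
rewrite [leRHS]/Num.Def.normr /= mx_normrE.
exact: (le_bigmax _ (fun i : 'I_1 * 'I_n => `|v i.1 i.2|) (0, j)).
Qed.

Lemma norm_mulmx_le {n m} (v : 'rV[R]_n) (M : 'M[R]_(n, m)) (c : R) : 0 <= c ->
  (forall i j, `|M i j| <= c) -> `|v *m M| <= n%:R * c * `|v|.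
Proof.
move=> c0 Mc; apply: rV_norm_le => [|j]; first by rewrite !mulr_ge0.
rewrite mxE; apply: le_trans (ler_norm_sum _ _ _) _.
apply: (@le_trans _ _ (\sum_(i < n) c * `|v|)).
  by apply: ler_sum => i _; rewrite normrM mulrC ler_pM// rV_coord_le.
by rewrite sumr_const card_ord -[leLHS]mulr_natl mulrA.
Qed.

Lemma norm_mulmx_bound {n m} (M : 'M[R]_(n, m)) :
  exists2 c : R, 0 < c & forall v : 'rV[R]_n, `|v *m M| <= c * `|v|.
Proof.
pose s := \sum_i \sum_j `|M i j|.
have s0 : 0 <= s by apply: sumr_ge0 => i _; exact: sumr_ge0.
exists (n%:R * s + 1) => [|v]; first by rewrite ltr_wpDl// mulr_ge0.
apply: (@le_trans _ _ (n%:R * s * `|v|)); last by rewrite ler_wpM2r// lerDl.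
apply: norm_mulmx_le => // i j; rewrite /s (bigD1 i)//= (bigD1 j)//= -addrA.
by rewrite lerDl addr_ge0// ?sumr_ge0// => k _; exact: sumr_ge0.
Qed.

Lemma mulmxr_continuous {n m} (M : 'M[R]_(n, m)) :
  continuous (mulmxr M : 'rV[R]_n -> 'rV[R]_m).
Proof.
apply: bounded_linear_continuous.
have [c c0 cP] := norm_mulmx_bound M.
apply/(bounded_funP (mulmxr M : {linear 'rV[R]_n -> 'rV[R]_m})) => r.
exists (c * r) => v vr /=.
by rewrite (le_trans (cP v))// ler_wpM2l// ltW.
Qed.

End RowNorm.

Section InverseFunction.
Context {R : realType} {n : nat}.
Implicit Types f psi : 'rV[R]_n -> 'rV[R]_n.

(** The inverse Jacobian turns the expansion of [f] at [psi q] into one of [psi], with an error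
    small against [psi q' - psi q]; the Lipschitz bound makes it small against [q' - q]. *)
Lemma inverse_differentiable f psi q (K : R) :
  \det (jacobian f (psi q)) != 0 -> differentiable f (psi q) -> 0 < K ->
  (\forall q' \near q, f (psi q') = q') ->
  (\forall q' \near q, `|psi q' - psi q| <= K * `|q' - q|) ->
  differentiable psi q /\
  forall v, 'D_v psi q = v *m invmx (jacobian f (psi q)).
Proof.
set z := psi q; set J := jacobian f z => J0 df K0 fpsi psiK.
have uJ : J \in unitmx by rewrite unitmxE unitfE.
pose L : {linear 'rV[R]_n -> 'rV[R]_n} := mulmxr (invmx J).
have cL : continuous L by exact: mulmxr_continuous.
have [C C0 CP] := norm_mulmx_bound (invmx J).
have near0 (P : 'rV[R]_n -> Prop) : (\forall q' \near q, P q') ->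
    \forall h \near (0 : 'rV[R]_n), P (h + q).
  rewrite (near_shift 0 q); apply: filterS => h /=.
  by rewrite subr0.
suff E (eps : R) : 0 < eps -> \forall h \near (0 : 'rV[R]_n),
    `|psi (h + q) - psi q - L h| <= eps * `|h|.
  by have [dpsi Dpsi] := approx_differentiable cL E.
move=> eps0.
(* [C] bounds the inverse Jacobian and [K] the growth of [psi], so this tolerance for [f] becomes
   [eps] for [psi]. *)
have e'0 : 0 < eps / (C * K) by rewrite divr_gt0// mulr_gt0.
have /nbhs_ballP[d /= d0 dP] := differentiable_approx df e'0.
have nd : \forall h \near (0 : 'rV[R]_n), `|h| < d / K.
  apply/nbhs_ballP; exists (d / K) => /=; first exact: divr_gt0.
  by move=> h; rewrite -ball_normE /= sub0r normrN.
near=> h.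
have psih : `|psi (h + q) - z| <= K * `|h|.
  have -> : `|h| = `|h + q - q| by rewrite addrK.
  by near: h; exact: near0 psiK.
have hd : `|psi (h + q) - z| < d.
  apply: le_lt_trans psih _; rewrite mulrC -ltr_pdivlMr//.
  by near: h.
have fh : f (psi (h + q)) = h + q by near: h; exact: near0 fpsi.
have fq : f z = q by exact: nbhs_singleton fpsi.
have := dP (psi (h + q) - z); rewrite -ball_normE /= sub0r normrN => /(_ hd).
rewrite /= subrK fh fq deriveEjacobian// addrK -/J => fle.
rewrite -/z.
have -> : psi (h + q) - z - h *m invmx J =
    - ((h - (psi (h + q) - z) *m J) *m invmx J).
  by rewrite mulmxBl mulmxK// opprB.
rewrite normrN; apply: le_trans (CP _) _.
apply: (@le_trans _ _ (C * (eps / (C * K) * `|psi (h + q) - z|))).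
  by rewrite ler_pM2l.
apply: (@le_trans _ _ (C * (eps / (C * K) * (K * `|h|)))).
  by rewrite !ler_pM2l.
rewrite le_eqVlt; apply/orP; left; apply/eqP.
by field; rewrite !gt_eqF.
Unshelve. all: by end_near. Qed.

End InverseFunction.

(** [banach_fixed_point] speaks of complete normed modules; this makes spaces of rows available to
    it. *)
HB.instance Definition _ (R : realType) m n := Complete.on 'M[R]_(m, n).

Section InverseFunctionTheorem.
Context {R : realType}.

Lemma differentiable_mulmxr {n m} (A : 'M[R]_(n, m)) (w : 'rV[R]_n) :
  differentiable (fun w : 'rV[R]_n => w *m A) w.
Proof. exact: (linear_differentiable w (@mulmxr_continuous _ _ _ A)). Qed.

Lemma derive_mulmxr {n m} (A : 'M[R]_(n, m)) (w v : 'rV[R]_n) :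
  'D_v (fun w : 'rV[R]_n => w *m A) w = v *m A.
Proof.
rewrite deriveE; last exact: differentiable_mulmxr.
by rewrite (diff_lin w (@mulmxr_continuous _ _ _ A)).
Qed.

Lemma differentiable_comp_mulmxr {V : normedModType R} {n m}
    (A : 'M[R]_(n, m)) (f : V -> 'rV[R]_n) p :
  differentiable f p -> differentiable (fun q => f q *m A) p.
Proof.
by move=> df; exact: (differentiable_comp df (differentiable_mulmxr _ _)).
Qed.

Lemma derive_comp_mulmxr {V : normedModType R} {n m} (A : 'M[R]_(n, m))
    (f : V -> 'rV[R]_n) p v :
  differentiable f p -> 'D_v (fun q => f q *m A) p = 'D_v f p *m A.
Proof.
move=> df; apply: etrans (derive_comp v df (differentiable_mulmxr A _)) _.
exact: derive_mulmxr.
Qed.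

Context {n : nat}.
Implicit Types (f psi : 'rV[R]_n -> 'rV[R]_n) (U : set 'rV[R]_n).

Let jacobian_close f U p : open U -> smooth U f -> U p ->
  \det (jacobian f p) != 0 ->
  exists2 r : R, 0 < r & forall z, ball p r z -> U z /\
    forall v : 'rV[R]_n,
      `|v - v *m (jacobian f z *m invmx (jacobian f p))| <= 2^-1 * `|v|.
Proof.
move=> oU sf Up J0; set A : 'M[R]_n := invmx _.
have AP : jacobian f p *m A = 1%:M by rewrite mulmxV// unitmxE unitfE.
(* [norm_mulmx_le] costs a factor [n], so entries of size at most [c] give the bound one half;
   [n.+1] keeps the denominator nonzero for [n = 0]. *)
pose c : R := (2 * n.+1%:R)^-1.
have c0 : 0 < c by rewrite invr_gt0 mulr_gt0.
pose M (z : 'rV[R]_n) : 'M[R]_n := 1%:M - jacobian f z *m A.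
have MC k i j : Ck k U (fun z => M z i j).
  rewrite (_ : (fun z => _) = fun z => (1%:M : 'M[R]_n) i j +
      (- \sum_l jacobian f z i l * A l j)); last first.
    by rewrite funeqE => z; rewrite /M !mxE.
  apply: (CkD oU); first exact: Ck_cst.
  apply: (CkN oU); apply: (Ck_sum oU) => l _.
  by apply: (CkM oU); [exact: Ck_jacobian|exact: Ck_cst].
have Mp : M p = 0 by rewrite /M AP subrr.
have ME z (v : 'rV[R]_n) : v - v *m (jacobian f z *m A) = v *m M z.
  by rewrite /M mulmxBr mulmx1.
clearbody M; have Mc i j : \forall z \near p, `|M z i j| <= c.
  have /cvgrPdist_le/(_ c c0) := MC 0%N i j p Up.
  by rewrite Mp mxE; apply: filterS => z; rewrite sub0r normrN.
have : \forall z \near p, U z /\ forall i j, `|M z i j| <= c.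
  apply: filterI; first exact: open_nbhs_nbhs.
  apply: (@filter_forall _ _ (fun i z => forall j, `|M z i j| <= c) (nbhs p)).
  move=> i; apply: (@filter_forall _ _ (fun j z => `|M z i j| <= c) (nbhs p)).
  exact: Mc.
move=> /nbhs_ballP[r /= r0 rP]; exists r => // z /rP[Uz Mz]; split=> // v.
rewrite ME; apply: le_trans (norm_mulmx_le v (ltW c0) Mz) _.
rewrite ler_wpM2r// /c invfM mulrCA -[leRHS]mulr1 ler_wpM2l//.
by rewrite ler_pdivrMr// mul1r ler_nat.
Qed.

(** The map [w |-> w - f w *m A] has differential [v |-> v - v *m (J *m A)], of norm at most one
    half near [p]; the sup norm lets the mean value theorem act on one coordinate at a time. A
    vector killed by the Jacobian at [z] would satisfy [|v| <= |v| / 2]. *)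
Let local_contraction f U p : open U -> smooth U f -> U p ->
  \det (jacobian f p) != 0 ->
  let A : 'M[R]_n := invmx (jacobian f p) in
  exists2 r : R, 0 < r & forall z, ball p r z -> [/\ U z,
    \det (jacobian f z) != 0 &
    forall w, ball p r w ->
      `|(w - f w *m A) - (z - f z *m A)| <= 2^-1 * `|w - z|].
Proof.
move=> oU sf Up J0 A; have [r r0 rP] := jacobian_close oU sf Up J0.
rewrite -/A in rP; clearbody A; exists r; first exact: r0.
move=> z zr; have [Uz Jz] := rP z zr; split; [exact: Uz| |move=> w wr].
  apply/negP => /det0P[v v0 vJ]; have := Jz v.
  rewrite mulmxA vJ mul0mx subr0 -subr_ge0 -{2}[`|v|]mul1r -mulrBl leNgt.
  move=> /negP; apply.
  by rewrite nmulr_rlt0 ?normr_gt0//; lra.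
pose G j (y : 'rV[R]_n) : R := (y - f y *m A) 0 j.
apply: rV_norm_le => [|j]; first by rewrite mulr_ge0.
have dG y : U y -> differentiable (fun y : 'rV[R]_n => y - f y *m A) y.
  move=> Uy; apply: differentiableB => //.
  exact/differentiable_comp_mulmxr/(smooth_diff sf).
have bU s : 0 <= s <= 1 -> ball p r (z + s *: (w - z)) by exact: ball_line.
have [s /bU /rP[]|s /bU /rP[Us Js]] := @MVT_line _ _ (G j) z (w - z) 1 ltr01.
  by move=> Us _; exact/differentiable_mx_coord/dG.
have zw : z + (w - z) = w by rewrite addrC subrK.
rewrite scale1r zw mul1r => E.
have -> : (w - f w *m A - (z - f z *m A)) 0 j = G j w - G j z.
  by rewrite mxE [X in _ + X]mxE.
rewrite E (derive_coord 0 j (diff_derivable (dG _ Us))).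
apply: le_trans (rV_coord_le _ _) (le_trans _ (Js _)).
rewrite deriveB; last 2 first.
- exact: derivable_id.
- exact/diff_derivable/differentiable_comp_mulmxr/(smooth_diff sf).
rewrite derive_id derive_comp_mulmxr; last exact: (smooth_diff sf).
by rewrite deriveEjacobian ?mulmxA//; exact: (smooth_diff sf).
Qed.

(** Solutions of [f z = q] are the fixed points of [z |-> z - f z *m A + q *m A], the Newton map
    with the inverse Jacobian frozen at [p], which is a contraction of a closed ball. *)
Theorem inverse_function f U p : open U -> smooth U f -> U p ->
  \det (jacobian f p) != 0 ->
  exists (r : R) (W : set 'rV[R]_n) psi,
    [/\ 0 < r, open W, W p & W `<=` U] /\
    [/\ smooth (ball (f p) r) psi,
        forall z, W z -> ball (f p) r (f z) /\ psi (f z) = z &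
        forall q, ball (f p) r q -> W (psi q) /\ f (psi q) = q].
Proof.
move=> oU sf Up J0; have [r1 r1_gt0 r1P] := local_contraction oU sf Up J0.
have [C C0 CP] := norm_mulmx_bound (invmx (jacobian f p)).
have uA : invmx (jacobian f p) \in unitmx by rewrite unitmx_inv unitmxE unitfE.
set A : 'M[R]_n := invmx (jacobian f p) in uA r1P CP; clearbody A.
(* As [w - f w *m A] has Lipschitz constant one half, half of [|w - z|] is absorbed on the left,
   which doubles [C]. *)
have lip z w : ball p r1 z -> ball p r1 w -> `|w - z| <= 2 * C * `|f w - f z|.
  move=> Bz Bw; have [_ _ /(_ _ Bw) gzw] := r1P z Bz.
  have E : w - z = (w - f w *m A - (z - f z *m A)) + (f w - f z) *m A.
    rewrite mulmxBl; move: (f w *m A) (f z *m A) => a b.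
    by apply/rowP => j; rewrite !mxE; ring.
  have := ler_normD (w - f w *m A - (z - f z *m A)) ((f w - f z) *m A).
  rewrite -E; have := CP (f w - f z); lra.
have finj z w : ball p r1 z -> ball p r1 w -> f z = f w -> z = w.
  move=> Bz Bw fzw; apply/esym/eqP; rewrite -subr_eq0 -normr_le0.
  by apply: le_trans (lip z w Bz Bw) _; rewrite fzw subrr normr0 mulr0.
pose r2 := r1 / 2; have r2_gt0 : 0 < r2 by rewrite divr_gt0.
pose Bc : set 'rV[R]_n := [set z | `|p - z| <= r2].
have BcB z : Bc z -> ball p r1 z.
  rewrite -ball_normE /= => /le_lt_trans; apply.
  by rewrite /r2 ltr_pdivrMr// ltr_pMr// ltr1n.
have Bp : ball p r1 p by exact: ballxx.
(* The Newton map for [q] moves [p] by at most [C * r = r2 / 2], and its contraction contributes at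
   most [r2 / 2] more, so it preserves the closed ball of radius [r2]. *)
pose r := r2 / (2 * C); have r0 : 0 < r by rewrite divr_gt0// mulr_gt0.
have rE : C * r = r2 / 2 by rewrite /r; field; rewrite gt_eqF.
have surj q : ball (f p) r q -> exists z, Bc z /\ f z = q.
  rewrite -ball_normE /= => qr.
  pose T z := z - f z *m A + q *m A.
  have TB : set_fun Bc Bc T.
    move=> z Bz; have [_ _ /(_ _ Bp) gz] := r1P z (BcB z Bz).
    have E : p - T z = (p - f p *m A - (z - f z *m A)) + (f p - q) *m A.
      rewrite /T mulmxBl; move: (f p *m A) (f z *m A) (q *m A) => a b c.
      by apply/rowP => j; rewrite !mxE; ring.
    have Cq : `|(f p - q) *m A| <= r2 / 2.
      by apply: le_trans (CP _) _; rewrite -rE ler_pM2l// ltW.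
    rewrite /Bc /= E; apply: le_trans (ler_normD _ _) _.
    have := Bz; rewrite /Bc /= => Bz'; lra.
  have half : (0 : R) <= 2^-1 by [].
  have Tc : contraction (NngNum half) (mkfun TB).
    split=> /=; first by lra.
    move=> [w z] [/= Bw Bz]; have [_ _ /(_ _ (BcB w Bw)) gz] := r1P z (BcB z Bz).
    apply: le_trans gz; rewrite /T opprD addrACA subrr addr0.
    by [].
  have [|||z Bz Tz] := @banach_fixed_point R 'rV[R]_n Bc (mkfun TB).
  - by exists (NngNum half).
  - have -> : Bc = closed_ball p r2 by rewrite closed_ballE.
    exact: closed_ball_closed.
  - by exists p; rewrite /Bc /= subrr normr0 ltW.
  exists z; split=> //; apply: (can_inj (mulmxK uA)).
  have := Tz; rewrite /= /T /mkfun; move: (f z *m A) (q *m A) => a b /rowP ab.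
  by apply/rowP => j; have := ab j; rewrite !mxE; lra.
have [psi psiP] : exists psi, forall q, ball (f p) r q ->
    Bc (psi q) /\ f (psi q) = q.
  have [|psi psiP] := @choice _ _ (fun q z => ball (f p) r q -> Bc z /\ f z = q).
    move=> q; have [/surj[z zq]|nq] := pselect (ball (f p) r q).
      by exists z.
    by exists 0.
  by exists psi.
pose W := [set z | ball p r1 z /\ ball (f p) r (f z)].
exists r, W, psi; split; split.
- by [].
- rewrite openE => z [Bz fz]; have [Uz _ _] := r1P z Bz.
  apply: (@filterI _ (nbhs z) _ (ball p r1) (f @^-1` ball (f p) r)).
    by apply: open_nbhs_nbhs; split; [exact: ball_open|exact: Bz].
  apply: (smooth_continuous sf Uz).
  by apply: open_nbhs_nbhs; split; [exact: ball_open|exact: fz].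
- by split; exact: ballxx.
- by move=> z [/r1P[]].
- move=> k; have oB : open (ball (f p) r) by exact: ball_open.
  have psiD q : ball (f p) r q -> differentiable psi q /\
      forall v, 'D_v psi q = v *m invmx (jacobian f (psi q)).
    move=> qr; have [/BcB Bq fq] := psiP q qr; have [Uq Jq _] := r1P _ Bq.
    apply: inverse_differentiable Jq (smooth_diff sf Uq) (_ : 0 < 2 * C) _ _.
    - by rewrite mulr_gt0.
    - by apply: (open_near oB) qr => q' /psiP[].
    - apply: (open_near oB) qr => q' /psiP[/BcB Bq' fq'].
      by apply: le_trans (lip _ _ Bq Bq') _; rewrite fq fq'.
  (* The differential of [psi] is the inverse Jacobian of [f] taken at [psi], so order [k] for [psi]
     gives order [k] for its derivatives. *)
  elim: k => [|k IH].
    by move=> q /psiD[dq _]; exact: differentiable_continuous.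
  split=> [q /psiD[]//|v]; apply: (Ck_row oB) => j.
  have oU1 : open (ball p r1) by exact: ball_open.
  have sf1 : smooth (ball p r1) f.
    by move=> l; apply: Ck_sub (sf l) => z /r1P[].
  have CJ i := Ck_compR oB (fun q qr => BcB _ (psiP q qr).1) IH
    (Ck_invmx i j oU1 (fun z zr => let: And3 _ J _ := r1P z zr in J)
       (fun i j => Ck_jacobian k i j oU1 sf1)).
  apply: Ck_ext oB _ (Ck_sum (P := predT) oB
    (fun i _ => CkM oB (Ck_cst k _ (v 0 i)) (CJ i))) => q /psiD[_ ->] /=.
  by rewrite [RHS]mxE.
- move=> z [Bz fz]; split=> //; have [/BcB Bpsi fpsi] := psiP _ fz.
  exact: finj.
- move=> q qr; have [/BcB Bpsi fpsi] := psiP _ qr; split=> //.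
  by split=> //; rewrite fpsi.
Qed.

End InverseFunctionTheorem.

(** * Smooth antiderivatives on an interval *)

Section Antiderivative.
Context {R : realType}.

Lemma antiderivative (g : R -> R) (c r : R) : 0 < r ->
  (forall t, ball c r t -> {for t, continuous g}) ->
  exists l : R -> R, forall t, ball c (r / 2) t -> is_derive t 1 l (g t).
Proof.
(* Halving the radius keeps the closed segment from [a] to [b] inside the ball where [g] is
   continuous, so that [g] is integrable on it. *)
move=> r0 cg; pose a := c - r / 2; pose b := c + r / 2.
have inB t : a <= t <= b -> ball c r t.
  rewrite /a /b -ball_normE /= => /andP[at_ tb].
  by rewrite ltr_norml; apply/andP; split; lra.
pose mu := @lebesgue_measure R.
have ab : a < b by rewrite /a /b; lra.
have ig : mu.-integrable `[a, b] (EFin \o g).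
  apply: continuous_compact_integrable; first exact: segment_compact.
  apply: continuous_in_subspaceT => t; rewrite inE /= in_itv /= => /inB.
  exact: cg.
exists (fun x => \int[mu]_(t in [set` Interval (BLeft a) (BRight x)]) g t).
move=> t; rewrite -ball_normE /= ltr_norml => /andP[t1 t2].
have at_ : a < t by rewrite /a; lra.
have tb : t < b by rewrite /b; lra.
have [||D E] := @continuous_FTC1 R g (BLeft a) t b tb ig.
- by rewrite lte_fin.
- by apply: cg; apply: inB; rewrite !ltW.
- exact: (DeriveDef D (etrans (esym (derive1E _ _)) E)).
Qed.

Lemma smooth_antiderivative (g : R -> R) (c r : R) : 0 < r ->
  smooth (ball c r) g ->
  exists l : R -> R, smooth (ball c (r / 2)) l /\
    forall t, ball c (r / 2) t -> 'D_1 l t = g t.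
Proof.
move=> r0 sg; have r20 : 0 < r / 2 by rewrite divr_gt0.
have [l lP] := antiderivative r0 (fun t => @smooth_continuous _ _ _ _ g t sg).
exists l; split; last by move=> t /lP lt; exact: (@derive_val _ _ _ _ _ _ _ lt).
have oB : open (ball c (r / 2)) by exact: ball_open.
have sub : ball c (r / 2) `<=` ball c r.
  by apply: le_ball; rewrite ler_pdivrMr// ler_pMr// ler1n.
move=> k; apply: Ck_pred; apply: Ck_line oB lP _.
exact: Ck_sub sub (sg k).
Qed.

End Antiderivative.

(** * Space-like hypersurfaces *)

Section Hypersurface.
Context {R : realType}.
Implicit Types (U : set 'rV[R]_3) (x N : 'rV[R]_3 -> 'rV[R]_4).

Definition hypersurface U x N : Prop :=
  [/\ open U, spacelike_immersion U x & timelike_unit_normal U x N].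

(** The size is spelled [3 + 1] so that block operations separate the tangent coordinates from the
    coefficient of [N]. *)
Definition frame x N (p : 'rV[R]_3) : 'M[R]_(3 + 1) := col_mx (jacobian x p) (N p).

(** The coordinates of the projection of [w] onto the tangent space along [N]. The inverse matrix
    makes them depend smoothly on [p], by Cramer's rule. *)
Definition tangent_coord x N (p : 'rV[R]_3) (w : 'rV[R]_(3 + 1)) : 'rV[R]_3 :=
  lsubmx (w *m invmx (frame x N p)).

Context {U x N} (H : hypersurface U x N).

Let oU : open U. Proof. by have [] := H. Qed.
Let sx : smooth U x. Proof. by have [_ []] := H. Qed.
Let sN : smooth U N. Proof. by have [_ _ []] := H. Qed.
Let x_gt0 p v : U p -> v != 0 -> 0 < mink ('D_v x p) ('D_v x p).
Proof. by move=> Up; have [_ [_ xP] _] := H; exact: xP. Qed.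
Let dx p : U p -> differentiable x p. Proof. exact: smooth_diff. Qed.
Let dN p : U p -> differentiable N p. Proof. exact: smooth_diff. Qed.

Lemma mink_NN p : U p -> mink (N p) (N p) = -1.
Proof. by move=> Up; have [_ _ [_ /(_ p Up)[]]] := H. Qed.

Lemma mink_Ndx p v : U p -> mink (N p) ('D_v x p) = 0.
Proof. by move=> Up; have [_ _ [_ /(_ p Up)[]]] := H. Qed.

Lemma immersion_inj p v : U p -> 'D_v x p = 0 -> v = 0.
Proof.
move=> Up Dv; apply/eqP; apply: contraT => v0.
by have := x_gt0 Up v0; rewrite Dv mink0l ltxx.
Qed.

Lemma frame_det p : U p -> \det (frame x N p) != 0.
Proof.
move=> Up; apply/negP => /det0P[v v0].
rewrite /frame -(hsubmxK v) mul_row_col -deriveEjacobian; last exact: dx.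
set w := lsubmx v; set c := rsubmx v; rewrite [c]mx11_scalar mul_scalar_mx.
move=> E; have c0 : c 0 0 = 0.
  have := congr1 (mink (N p)) E; rewrite minkDr minkZr mink_Ndx// mink_NN//.
  by rewrite mink0r add0r mulrN1 => /eqP; rewrite oppr_eq0 => /eqP.
move: E; rewrite c0 scale0r addr0 => /(immersion_inj Up) w0.
move: v0; rewrite -(hsubmxK v) -/w -/c w0 [c]mx11_scalar c0.
by rewrite raddf0 row_mx0 eqxx.
Qed.

(** Pairing [w] with [N p] gives minus its coefficient along [N p], because [N] is time-like; hence
    the plus sign. *)
Lemma tangent_coordP p w : U p ->
  'D_(tangent_coord x N p w) x p = w + mink w (N p) *: N p.
Proof.
move=> Up; have uF : frame x N p \in unitmx by rewrite unitmxE unitfE frame_det.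
pose u := (w : 'rV[R]_(3 + 1)) *m invmx (frame x N p).
pose c : 'rV[R]_1 := rsubmx u.
have E : w = 'D_(tangent_coord x N p w) x p + c 0 0 *: N p.
  have cN : c *m N p = c 0 0 *: N p by rewrite {1}[c]mx11_scalar mul_scalar_mx.
  have Eu : u *m frame x N p = w by rewrite /u mulmxKV.
  rewrite -cN (deriveEjacobian _ (dx Up)).
  by move: Eu; rewrite -{1}(hsubmxK u) /frame mul_row_col.
have -> : mink w (N p) = - c 0 0.
  by rewrite E minkDl minkZl mink_NN// [mink _ (N p)]minkC mink_Ndx//; ring.
by rewrite {2}E scaleNr addrK.
Qed.

Lemma tangent_coord_unique p v w : U p -> 'D_v x p = 'D_w x p -> v = w.
Proof.
move=> Up E; apply/eqP; rewrite -subr_eq0; apply/eqP; apply: (immersion_inj Up).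
by rewrite (deriveBr v w (dx Up)) E subrr.
Qed.

Lemma smooth_tangent_coord (w : 'rV[R]_3 -> 'rV[R]_4) : smooth U w ->
  smooth U (fun p => tangent_coord x N p (w p)).
Proof.
move=> sw k; apply: (Ck_row oU) => j.
apply: (@Ck_ext _ _ _ _ _ (fun p => \sum_i (w p : 'rV_(3 + 1)) 0 i *
    invmx (frame x N p) i (lshift 1 j))) => //.
  by move=> p _; rewrite /tangent_coord mxE [RHS]mxE.
apply: (Ck_sum oU) => i _; apply: (CkM oU); first exact: (Ck_coord 0 i oU (sw k)).
apply: (Ck_invmx _ _ oU) => [p|{}i {}j]; first exact: frame_det.
rewrite /frame; case: (splitP i) => i' Ei.
- rewrite (_ : (fun p => _) = fun p => jacobian x p i' j); last first.
    rewrite funeqE => p; have -> : i = lshift 1 i' by exact/val_inj.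
    by rewrite col_mxEu.
  exact: Ck_jacobian.
- rewrite (_ : (fun p => _) = fun p => N p i' j); last first.
    rewrite funeqE => p; have -> : i = rshift 3 i' by exact/val_inj.
    by rewrite col_mxEd.
  exact: (Ck_coord _ _ oU (sN k)).
Qed.

Lemma mink_NdN p v : U p -> mink (N p) ('D_v N p) = 0.
Proof.
move=> Up; have : 'D_v (fun q => mink (N q) (N q)) p = 0.
  rewrite (derive_open_eq _ oU (fun q Uq => mink_NN Uq) Up); exact: derive_cst.
rewrite (derive_mink v (dN Up) (dN Up)) [mink ('D_v N p) _]minkC.
lra.
Qed.

(** Differentiating the orthogonality of [N] and ['D_w x] along [v] turns either side into minus the
    product of [N] with a second derivative of [x], which is symmetric. *)
Lemma shape_selfadjoint p v w : U p ->
  mink ('D_v N p) ('D_w x p) = mink ('D_w N p) ('D_v x p).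
Proof.
move=> Up.
have E u u' : mink ('D_u' N p) ('D_u x p) =
    - mink (N p) ('D_u' (fun q => 'D_u x q) p).
  have : 'D_u' (fun q => mink (N q) ('D_u x q)) p = 0.
    rewrite (derive_open_eq _ oU (fun q Uq => mink_Ndx u Uq) Up).
    exact: derive_cst.
  rewrite (derive_mink _ (dN Up) (smooth_diff (smooth_derive u sx) Up)).
  by move/eqP; rewrite addr_eq0 => /eqP.
have swap := congr1 (fun u => - mink (N p) u) (derive_swap w v oU sx Up).
exact: etrans (E w v) (etrans swap (esym (E v w))).
Qed.

(** The Minkowski product is indefinite, but a vector orthogonal to [N p] is tangent, and on tangent
    vectors the product is positive definite. *)
Lemma mink_frame_eq0 p w : U p -> mink w (N p) = 0 ->
  (forall v, mink w ('D_v x p) = 0) -> w = 0.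
Proof.
move=> Up wN wx; have := tangent_coordP w Up.
rewrite wN scale0r addr0 => E; rewrite -E.
set v := tangent_coord _ _ _ _ in E *.
have [->|v0] := eqVneq v 0; first by rewrite derive0.
by have := x_gt0 Up v0; rewrite {1}E wx ltxx.
Qed.

End Hypersurface.

Lemma adj_eq0_minor {F : fieldType} (S : 'M[F]_3) : \adj S = 0 ->
  forall i j k l, S i j * S k l = S i l * S k j.
Proof.
(* With entries indexed by natural numbers [bump] computes, and each cofactor unfolds to an explicit
   minor of order two. *)
move=> aS; pose s (i j : nat) := S (inord i) (inord j).
have sE i j : S i j = s i j by rewrite /s !inord_val.
have m i j : cofactor S i j = 0.
  have := congr1 (fun M : 'M[F]_3 => M j i) aS.
  by rewrite /= [X in X = _]mxE [RHS]mxE.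
have {m} m (i j : 'I_3) :
    s (bump i 0) (bump j 0) * s (bump i 1) (bump j 1) =
    s (bump i 0) (bump j 1) * s (bump i 1) (bump j 0).
  have /eqP := m i j; rewrite /cofactor mulf_eq0 signr_eq0 /=.
  rewrite (expand_det_row _ ord0) !big_ord_recl big_ord0 /cofactor !det_mx11.
  rewrite !mxE !sE /= /bump /= !addr0 expr0 mul1r expr1 mulN1r mulrN subr_eq0.
  by move/eqP.
have m00 := m 0 0; have m01 := m 0 1; have m02 := m 0 2.
have m10 := m 1 0; have m11 := m 1 1; have m12 := m 1 2.
have m20 := m 2 0; have m21 := m 2 1; have m22 := m 2 2.
rewrite /= /bump /= in m00 m01 m02 m10 m11 m12 m20 m21 m22.
have mm := (m00, m01, m02, m10, m11, m12, m20, m21, m22).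
move=> i j k l; rewrite !sE.
case: i => [[|[|[|//]]] ?]; case: k => [[|[|[|//]]] ?] /=;
case: j => [[|[|[|//]]] ?]; case: l => [[|[|[|//]]] ?] /=;
  by [|rewrite mulrC|rewrite ?mm|rewrite [LHS]mulrC [RHS]mulrC ?mm].
Qed.

(** Vanishing minors of order two mean rank at most one, and the square of a column times a row is
    its trace times itself. *)
Lemma adj_eq0_sqr {F : fieldType} (S : 'M[F]_3) : \adj S = 0 ->
  S *m S = \tr S *: S.
Proof.
move=> /adj_eq0_minor m; apply/matrixP => i j; rewrite !mxE /mxtrace mulr_suml.
by apply: eq_bigr => k _; rewrite m mulrC.
Qed.

(** * The radial principal curvature vanishes *)

Section Gauss.
Context {R : realType}.
Implicit Types (U : set 'rV[R]_3) (x N : 'rV[R]_3 -> 'rV[R]_4).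

(** Expand [W] in the standard basis and exchange the second derivatives. Applied to two fields with
    their roles exchanged, the difference is a derivative along their bracket. *)
Lemma derive_field {n m} (U : set 'rV[R]_n) (f : 'rV[R]_n -> 'rV[R]_m)
    (W : 'rV[R]_n -> 'rV[R]_n) p v : open U -> smooth U f -> U p ->
  differentiable W p ->
  'D_v (fun q => 'D_(W q) f q) p =
  'D_('D_v W p) f p + 'D_(W p) (fun q => 'D_v f q) p.
Proof.
move=> oU sf Up dW.
pose h (i : 'I_n) q := W q 0 i *: 'D_(delta_mx 0 i) f q.
have Wh q : U q -> 'D_(W q) f q = (\sum_i h i) q.
  by move=> Uq; rewrite fct_sumE (derive_row _ (smooth_diff sf Uq)).
have dWi i := differentiable_mx_coord 0 i dW.
have sDf w := smooth_derive w sf.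
have dDf w := smooth_diff (sDf w) Up.
have dh i : derivable (h i) p v.
  exact/diff_derivable/(differentiable_scale (dWi i))/dDf.
apply: etrans (derive_open_eq v oU Wh Up) _.
apply: etrans (derive_sum dh) _.
rewrite (derive_row ('D_v W p) (smooth_diff sf Up)) (derive_row (W p) (dDf v)).
rewrite -big_split; apply: eq_bigr => i _ /=.
apply: etrans (derive_scale v (dWi i) (dDf _)) _.
have A := derive_coord 0 i (@diff_derivable _ _ _ _ _ v dW).
have B := derive_swap (delta_mx 0 i) v oU sf Up.
exact: (congr2 +%R (congr1 (fun a => a *: 'D_(delta_mx 0 i) f p) A)
  (congr1 ( *:%R (W p 0 i)) B)).
Qed.

Lemma smooth_derive_field {n m} (U : set 'rV[R]_n) (f : 'rV[R]_n -> 'rV[R]_m)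
    (W : 'rV[R]_n -> 'rV[R]_n) : open U -> smooth U f -> smooth U W ->
  smooth U (fun q => 'D_(W q) f q).
Proof.
move=> oU sf sW k.
have C := smooth_field oU sW (fun i => smooth_derive (delta_mx 0 i) sf) k.
by apply: Ck_ext oU _ C => p Up; rewrite (derive_row _ (smooth_diff sf Up)).
Qed.

Lemma smooth_sub {V W : normedModType R} (U O : set V) (f : V -> W) :
  O `<=` U -> smooth U f -> smooth O f.
Proof. by move=> OU sf k; exact: Ck_sub (sf k). Qed.

Lemma hypersurface_sub U O x N : open O -> O `<=` U ->
  hypersurface U x N -> hypersurface O x N.
Proof.
move=> oO OU [_ [sx xP] [sN NP]]; split=> //; split.
- exact: smooth_sub sx.
- by move=> p /OU; exact: xP.
- exact: smooth_sub sN.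
- by move=> p /OU; exact: NP.
Qed.

Definition radial x N p := tangent_coord x N p (x p).

Lemma derive_radial U x N p : hypersurface U x N -> U p ->
  'D_(radial x N p) x p = tangential_part x N p.
Proof. by move=> H Up; rewrite (tangent_coordP H). Qed.

Lemma mink_tangential_N U x N p : hypersurface U x N -> U p ->
  mink (tangential_part x N p) (N p) = 0.
Proof.
move=> H Up; rewrite /tangential_part minkDl minkZl (mink_NN H)//.
by rewrite mulrN1 subrr.
Qed.

Lemma derive_tangential U x N p v : hypersurface U x N -> U p ->
  'D_v (tangential_part x N) p = 'D_v x p + mink (x p) ('D_v N p) *: N p
    + mink (x p) (N p) *: 'D_v N p.
Proof.
move=> H Up; have [_ [sx _] [sN _]] := H.
have dx := smooth_diff sx Up; have dN := smooth_diff sN Up.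
have dm := differentiable_mink dx dN; have ds := differentiable_scale dm dN.
have -> : tangential_part x N = x + (fun q => mink (x q) (N q) *: N q) by [].
rewrite deriveD; [|exact: diff_derivable..].
rewrite (derive_scale v dm dN) (derive_mink v dx dN) addrA; congr (_ + _ *: _ + _).
by rewrite [mink ('D_v x p) _]minkC (mink_Ndx H)// add0r.
Qed.

Lemma smooth_tangential U x N : hypersurface U x N ->
  smooth U (tangential_part x N).
Proof.
move=> [oU [sx _] [sN _]] k; apply: (CkD oU (sx k)).
by apply: (Ck_scale oU); [exact: (Ck_mink oU)|].
Qed.

Lemma smooth_radial U x N : hypersurface U x N -> smooth U (radial x N).
Proof. by move=> H; apply: (smooth_tangent_coord H); have [_ []] := H. Qed.

(* Codazzi for the principal field [Z] and a kernel field [W]: pairing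
   [D_W D_Z N - D_Z D_W N] with [D_W x] gives [k |W|^2 = 0]. *)
Lemma principal_kernel_eq0 U x N W (k : 'rV[R]_3 -> R) p :
  hypersurface U x N -> smooth U W -> U p ->
  (forall q, U q -> 'D_(radial x N q) N q = - k q *: tangential_part x N q) ->
  (forall q, U q -> 'D_(W q) N q = 0) ->
  (forall q, U q -> k q != 0) -> W p = 0.
Proof.
move=> H sW Up NZ NW k0; have [oU [sx _] [sN _]] := H.
set z := tangential_part x N in NZ *; set Z := radial x N in NZ *.
have sZ : smooth U Z := smooth_radial H.
have xZ q : U q -> 'D_(Z q) x q = z q := fun Uq => derive_radial H Uq.
have dW := smooth_diff sW Up; have dZ := smooth_diff sZ Up.
have sDZN := smooth_derive_field oU sN sZ.
have sDWx := smooth_derive_field oU sx sW.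
have dz := smooth_diff (smooth_tangential H) Up.
have orth q : U q -> mink ('D_(Z q) N q) ('D_(W q) x q) = 0.
  by move=> Uq; rewrite (shape_selfadjoint H)// NW// mink0l.
have orthz q : U q -> mink (z q) ('D_(W q) x q) = 0.
  move=> Uq; have := orth q Uq; rewrite NZ// minkZl => /eqP.
  by rewrite mulf_eq0 oppr_eq0 (negbTE (k0 q Uq)) => /eqP.
set w := W p; set DDW := 'D_w (fun q => 'D_(W q) x q) p.
have const0 (g : 'rV[R]_3 -> R) : (forall q, U q -> g q = 0) -> 'D_w g p = 0.
  by move=> g0; exact: (derive_open_cst w oU g0 Up).
have E1 : mink ('D_w (fun q => 'D_(Z q) N q) p) ('D_w x p) =
    k p * mink (z p) DDW.
  have := const0 _ orth.
  rewrite (derive_mink w (smooth_diff sDZN Up) (smooth_diff sDWx Up)) NZ//.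
  rewrite -/w -/DDW minkZl => /eqP; rewrite addr_eq0 => /eqP ->.
  by rewrite mulNr opprK.
(* Along [W] the normal is constant, so [z] and [x] have the same derivative there. *)
have E2 : mink (z p) DDW = - mink ('D_w x p) ('D_w x p).
  have := const0 _ orthz.
  rewrite (derive_mink w dz (smooth_diff sDWx Up)) -/w -/DDW.
  rewrite (derive_tangential w H Up) (NW p Up) mink0r scale0r scaler0 !addr0.
  by move/eqP; rewrite addrC addr_eq0 => /eqP.
(* The bracket of [W] and [Z] appears on the right; the derivative of [N] along it, paired with the
   kernel direction [w], vanishes by self-adjointness. *)
have E3 : 'D_w (fun q => 'D_(Z q) N q) p = 'D_('D_w Z p - 'D_(Z p) W p) N p.
  have dN := smooth_diff sN Up.
  have F1 := derive_field w oU sN Up dZ.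
  have F2 := derive_field (Z p) oU sN Up dW.
  have F3 := derive_open_cst (Z p) oU NW Up.
  have F4 := derive_swap (Z p) w oU sN Up.
  have alg (a b c d e f : 'rV[R]_4) :
      a = b + c -> d = e + f -> d = 0 -> f = c -> a = b - e.
    by move=> -> -> /eqP; rewrite addrC addr_eq0 => /eqP -> <-.
  exact: etrans (alg _ _ _ _ _ _ F1 F2 F3 F4) (esym (deriveBr _ _ dN)).
have E4 : mink ('D_w (fun q => 'D_(Z q) N q) p) ('D_w x p) = 0.
  by rewrite E3 (shape_selfadjoint H)// NW// mink0l.
move: E1; rewrite E4 E2 mulrN => /esym/eqP; rewrite oppr_eq0 mulf_eq0.
rewrite (negbTE (k0 p Up)) => /eqP w0.
apply/eqP; apply: contraT => wN0; have [_ [_ /(_ p Up _ wN0)]] := H.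
by rewrite w0 ltxx.
Qed.

End Gauss.

Section VanishingRadialCurvature.
Context {R : realType}.
Implicit Types (U : set 'rV[R]_3) (x N : 'rV[R]_3 -> 'rV[R]_4).

Lemma open_preimage_in {V : normedModType R} (U : set V) (D : set R) (g : V -> R) :
  open U -> open D -> smooth U g -> open [set q | U q /\ D (g q)].
Proof.
move=> oU oD sg; rewrite openE => q [Uq Dgq].
apply: (@filterI _ (nbhs q) _ U (g @^-1` D)).
  by apply: open_nbhs_nbhs; split.
apply: (smooth_continuous sg Uq).
by apply: open_nbhs_nbhs; split.
Qed.

(** [S] is only given pointwise. Since the differential of [x] is injective, its rows are forced to
    be the tangent coordinates of the derivatives of [- N], which are smooth. *)
Lemma shape_operator_smooth U x N S k i j : hypersurface U x N ->
  shape_operator U x N S -> Ck k U (fun p => S p i j).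
Proof.
move=> H HS; have [oU [sx _] [sN _]] := H.
have sDN : smooth U (fun p => - 'D_(delta_mx 0 i) N p).
  by move=> l; apply: (CkN oU); exact: smooth_derive.
apply: Ck_ext oU _ (Ck_coord 0 j oU (smooth_tangent_coord H sDN k)) => p Up.
rewrite (_ : tangent_coord x N p _ = row i (S p)) ?mxE//.
apply: (tangent_coord_unique H Up); rewrite (tangent_coordP H)//.
rewrite minkNl minkC (mink_NdN H)// oppr0 scale0r addr0.
by rewrite rowE; exact: (canLR (@opprK _) (HS p Up (delta_mx 0 i))).
Qed.

Lemma derive_kernel U x N S p v : hypersurface U x N ->
  shape_operator U x N S -> U p -> v *m S p = 0 -> 'D_v N p = 0.
Proof. by move=> H HS Up vS; rewrite (HS p Up) vS derive0 oppr0. Qed.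

(* Where [k] is nonzero, a smooth kernel field of [S] is a row of [\adj S] or,
   where [\adj S] vanishes and hence [S^2 = tr S * S], of [tr S - S]. *)
Lemma GCR_radial U x N S : hypersurface U x N -> shape_operator U x N S ->
  (forall p, U p -> gauss_kronecker S p = 0) -> GCR U x N S ->
  forall p, U p -> 'D_(radial x N p) N p = 0.
Proof.
move=> H HS GK0 HG; have [oU [sx xP] [sN _]] := H.
set z := tangential_part x N; set Z := radial x N.
have sz : smooth U z := smooth_tangential H.
have sZ : smooth U Z := smooth_radial H.
have xZ q : U q -> 'D_(Z q) x q = z q := fun Uq => derive_radial H Uq.
have sS l i j := @shape_operator_smooth U x N S l i j H HS.
have GC q : U q -> exists k, Z q != 0 /\ Z q *m S q = k *: Z q.
  move=> Uq; have [v [k [Dv v0 vS]]] := HG q Uq; exists k.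
  by rewrite -(tangent_coord_unique H Uq (etrans Dv (esym (xZ q Uq)))).
have zz q : U q -> 0 < mink (z q) (z q).
  by move=> Uq; rewrite -xZ//; apply: xP => //; have [k []] := GC q Uq.
have sDZN := smooth_derive_field oU sN sZ.
pose g (q : 'rV[R]_3) : R := mink ('D_(Z q) N q) (z q).
have sg : smooth U g by move=> l; exact: (Ck_mink oU).
(* The eigenvalue in [GCR] is chosen point by point; this quotient recovers it from smooth data, and
   its zeros are those of [g]. *)
pose k (q : 'rV[R]_3) : R := - g q / mink (z q) (z q).
have kP q : U q -> Z q *m S q = k q *: Z q /\ 'D_(Z q) N q = - k q *: z q.
  move=> Uq; have [c [_ Zc]] := GC q Uq.
  have DN : 'D_(Z q) N q = - c *: z q.
    by rewrite (HS q Uq) Zc (deriveZr _ _ (smooth_diff sx Uq)) xZ// scaleNr.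
  have -> : k q = c.
    by rewrite /k /g DN minkZl; field; rewrite gt_eqF// zz.
  by [].
pose O := [set q | U q /\ g q != 0].
have oO : open O := open_preimage_in oU open_neq0 sg.
have OU : O `<=` U by move=> q [].
have Ok q : O q -> k q != 0.
  by move=> [Uq gq]; rewrite /k mulf_neq0 ?oppr_eq0// invr_neq0// gt_eqF// zz.
have noW (O' : set 'rV[R]_3) (W : 'rV[R]_3 -> 'rV[R]_3) p :
    open O' -> O' `<=` O -> O' p -> smooth O' W ->
    (forall q, O' q -> W q *m S q = 0) -> W p = 0.
  move=> oO' O'O Op sW WS; have O'U := subset_trans O'O OU.
  apply: (principal_kernel_eq0 (hypersurface_sub oO' O'U H) sW Op (k := k)).
  - by move=> q /O'U /kP[].
  - by move=> q Oq; apply: (derive_kernel H HS (O'U q Oq)); exact: WS.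
  - by move=> q /O'O /Ok.
(* The rows of a matrix [M] with [M *m S = 0] are smooth kernel fields, which [noW] makes zero. *)
have sub_entry (M : 'rV[R]_3 -> 'M[R]_3) i j p : O p ->
    (forall l i j, Ck l O (fun q => M q i j)) ->
    (forall q, O q -> M q *m S q = 0) -> M p i j = 0.
  move=> Op sM MS; apply: contrapT => /eqP Mp.
  pose O' := [set q | O q /\ M q i j != 0].
  have oO' : open O' := open_preimage_in oO open_neq0 (fun l => sM l i j).
  have O'O : O' `<=` O by move=> q [].
  have := noW O' (fun q => row i (M q)) p oO' O'O.
  move=> /(_ (conj Op Mp)) rowM; move: Mp; apply/negP; rewrite negbK.
  have -> : M p i j = row i (M p) 0 j by rewrite mxE.
  rewrite rowM ?mxE//.
    move=> l; apply: (Ck_row oO') => j'; apply: Ck_sub O'O _.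
    by apply: Ck_ext oO _ (sM l i j') => q _; rewrite mxE.
  by move=> q /O'O /MS MSq; rewrite -row_mul MSq row0.
have adj0 q : O q -> \adj (S q) = 0.
  move=> Oq; apply/matrixP => i j; rewrite [RHS]mxE.
  apply: (sub_entry (fun q => \adj (S q))) => // [l i' j'|q' [Uq' _]].
    by apply: (Ck_adj _ _ oO) => a b; exact: Ck_sub OU (sS l a b).
  rewrite mul_adj_mx; have := GK0 q' Uq'; rewrite /gauss_kronecker => ->.
  by rewrite raddf0.
have trS q : O q -> S q = (\tr (S q))%:M.
  move=> Oq; apply/esym/eqP; rewrite -subr_eq0; apply/eqP/matrixP => i j.
  rewrite [RHS]mxE.
  apply: (sub_entry (fun q => (\tr (S q))%:M - S q)) => // [l i' j'|q' Oq'].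
    have sS' a b : Ck l O (fun q => S q a b) by exact: Ck_sub OU (sS l a b).
    apply: (@Ck_ext _ _ _ _ _ (fun q =>
      (\sum_a S q a a) * (i' == j')%:R + - S q i' j')) => //.
      by move=> q' _; rewrite !mxE mulr_natr.
    apply: (CkD oO); last exact: (CkN oO).
    by apply: (CkM oO); [exact: (Ck_sum oO)|exact: Ck_cst].
  by rewrite mulmxBl mul_scalar_mx (adj_eq0_sqr (adj0 _ Oq')) subrr.
move=> p Up; rewrite (kP p Up).2.
have [gp|gp] := eqVneq (g p) 0.
  by rewrite /k gp oppr0 mul0r oppr0 scale0r.
have Op : O p by [].
have [c [Zp _]] := GC p Up; have [ZS _] := kP p Up.
(* [S p] is scalar with zero adjugate, so its determinant, the cube of [\tr (S p)], vanishes; then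
   [S p = 0], against [k p != 0]. *)
have tr0 : \tr (S p) = 0.
  have := mul_adj_mx (S p); rewrite (adj0 p Op) mul0mx {1}(trS p Op) det_scalar.
  move=> /(congr1 (fun M : 'M[R]_3 => M 0 0)); rewrite [LHS]mxE [RHS]mxE eqxx.
  by rewrite mulr1n => /esym/eqP; rewrite expf_eq0 => /eqP.
have := Ok p Op; move: ZS; rewrite trS// tr0 raddf0 mulmx0 => /esym/eqP.
by rewrite scaler_eq0 (negbTE Zp) orbF => /eqP ->; rewrite eqxx.
Qed.

End VanishingRadialCurvature.

(** * Ruled structure and local models *)

Section Ruled.
Context {R : realType}.
Implicit Types (U : set 'rV[R]_3) (x N : 'rV[R]_3 -> 'rV[R]_4).

(** Zero radial curvature. The integral curves of the radial field are then straight segments,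
    because [direction] turns out to be constant along them. *)
Definition ruled U x N : Prop :=
  [/\ hypersurface U x N, (forall p, U p -> tangential_part x N p != 0) &
      forall p, U p -> 'D_(radial x N p) N p = 0].

Lemma ruled_sub U O x N : open O -> O `<=` U -> ruled U x N -> ruled O x N.
Proof.
move=> oO OU [H z0 NZ]; split; first exact: hypersurface_sub H.
- by move=> p /OU; exact: z0.
- by move=> p /OU; exact: NZ.
Qed.

(* [x = slant * direction + offset * N], where [slant * direction = x^T]. *)
Definition offset x N p : R := - mink (x p) (N p).

Definition slant x N p : R :=
  Num.sqrt (mink (tangential_part x N p) (tangential_part x N p)).

Definition direction x N p : 'rV[R]_4 := (slant x N p)^-1 *: tangential_part x N p.

Context {U x N} (H : ruled U x N).

Local Notation z := (tangential_part x N).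
Local Notation Z := (radial x N).
Local Notation a := (slant x N).
Local Notation b := (offset x N).
Local Notation y := (direction x N).

Let H' : hypersurface U x N. Proof. by case: H. Qed.
Let oU : open U. Proof. by case: H'. Qed.
Let sx : smooth U x. Proof. by have [_ []] := H'. Qed.
Let sN : smooth U N. Proof. by have [_ _ []] := H'. Qed.
Let x_gt0 p v : U p -> v != 0 -> 0 < mink ('D_v x p) ('D_v x p).
Proof. by move=> Up; have [_ [_ xP] _] := H'; exact: xP. Qed.
Let dx p : U p -> differentiable x p. Proof. exact: smooth_diff. Qed.
Let dN p : U p -> differentiable N p. Proof. exact: smooth_diff. Qed.
Let sz : smooth U z. Proof. exact: smooth_tangential. Qed.
Let dz p : U p -> differentiable z p. Proof. exact: smooth_diff. Qed.
Let xZ p : U p -> 'D_(Z p) x p = z p. Proof. exact: derive_radial. Qed.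

Let zz_gt0 p : U p -> 0 < mink (z p) (z p).
Proof.
move=> Up; rewrite -xZ//; apply: x_gt0 => //; apply/negP => /eqP Z0.
by have [_ /(_ p Up) + _] := H; rewrite -xZ// Z0 derive0 eqxx.
Qed.

Lemma slant_gt0 p : U p -> 0 < a p.
Proof. by move=> Up; rewrite sqrtr_gt0 zz_gt0. Qed.

Let a_neq0 p : U p -> a p != 0. Proof. by move=> Up; rewrite gt_eqF// slant_gt0. Qed.

Lemma smooth_slant : smooth U a.
Proof.
by move=> k; exact: (Ck_comp1R oU zz_gt0 (Ck_mink oU (sz k) (sz k)) (Ck_sqrt k)).
Qed.

Lemma smooth_direction : smooth U y.
Proof.
by move=> k; exact: (Ck_scale oU (CkV oU a_neq0 (smooth_slant k)) (sz k)).
Qed.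

Lemma smooth_offset : smooth U b.
Proof. by move=> k; exact: (CkN oU (Ck_mink oU (sx k) (sN k))). Qed.

Let da p : U p -> differentiable a p. Proof. exact: smooth_diff smooth_slant. Qed.
Let dy p : U p -> differentiable y p.
Proof. exact: smooth_diff smooth_direction. Qed.
Let db p : U p -> differentiable b p. Proof. exact: smooth_diff smooth_offset. Qed.

Lemma slant_direction p : U p -> z p = a p *: y p.
Proof. by move=> Up; rewrite scalerA mulfV ?scale1r// a_neq0. Qed.

Lemma ruled_decomp p : U p -> x p = a p *: y p + b p *: N p.
Proof. by move=> Up; rewrite -slant_direction// scaleNr addrK. Qed.

Lemma mink_direction p : U p -> mink (y p) (y p) = 1.
Proof.
move=> Up; have E : mink (z p) (z p) = a p ^+ 2 by rewrite sqr_sqrtr// ltW// zz_gt0.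
by rewrite minkZl minkZr E; field; exact: a_neq0.
Qed.

Lemma mink_direction_N p : U p -> mink (y p) (N p) = 0.
Proof. by move=> Up; rewrite minkZl (mink_tangential_N H')// mulr0. Qed.

(** Up to sign the derivative is [<x, 'D_v N>]. This equals [<z, 'D_v N>], because ['D_v N] is
    orthogonal to [N], and by self-adjointness it is [<'D_Z N, 'D_v x> = 0]. *)
Lemma derive_offset p v : U p -> 'D_v b p = 0.
Proof.
move=> Up; have dm := differentiable_mink (dx Up) (dN Up).
have -> : b = - (fun q => mink (x q) (N q)) by [].
rewrite (deriveN (@diff_derivable _ _ _ _ _ v dm)) (derive_mink v (dx Up) (dN Up)).
rewrite [mink ('D_v x p) _]minkC (mink_Ndx H')// add0r.
have : mink (z p) ('D_v N p) = 0.
  rewrite -xZ// minkC (shape_selfadjoint H')//.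
  by have [_ _ ->] := H; rewrite ?mink0l.
rewrite /tangential_part minkDl minkZl (mink_NdN H')// mulr0 addr0 => ->.
exact: oppr0.
Qed.

Let Dz p v : U p -> 'D_v z p = 'D_v x p - b p *: 'D_v N p.
Proof.
move=> Up; rewrite (derive_tangential v H' Up) scaleNr opprK.
have := derive_offset v Up; have -> : b = - (fun q => mink (x q) (N q)) by [].
have dm := differentiable_mink (dx Up) (dN Up).
rewrite (deriveN (@diff_derivable _ _ _ _ _ v dm)) (derive_mink v (dx Up) (dN Up)).
rewrite [mink ('D_v x p) _]minkC (mink_Ndx H')// add0r => /eqP.
by rewrite oppr_eq0 => /eqP ->; rewrite scale0r addr0.
Qed.

Lemma derive_slant p v : U p -> 'D_v a p = mink (y p) ('D_v x p).
Proof.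
move=> Up.
have aa q : U q -> a q * a q = mink (z q) (z q).
  by move=> Uq; rewrite -expr2 sqr_sqrtr// ltW// zz_gt0.
have := derive_open_eq v oU aa Up.
have -> : (fun q => a q * a q) = a * a by [].
have da' := @diff_derivable _ _ _ _ _ v (da Up); rewrite (deriveM da' da').
rewrite (derive_mink v (dz Up) (dz Up)) (Dz v Up).
have zN : mink (z p) ('D_v N p) = 0.
  rewrite -xZ// minkC (shape_selfadjoint H')//.
  by have [_ _ ->] := H; rewrite ?mink0l.
rewrite [mink _ (z p)]minkC minkBr minkZr zN mulr0 subr0 minkZl /GRing.scale /= => E.
apply: (mulfI (a_neq0 Up)); rewrite mulVKf ?a_neq0//; lra.
Qed.

Lemma derive_decomp p v : U p ->
  'D_v x p = 'D_v a p *: y p + a p *: 'D_v y p + b p *: 'D_v N p.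
Proof.
move=> Up; rewrite -(derive_scale v (da Up) (dy Up)).
rewrite -(derive_open_eq v oU slant_direction Up) (Dz v Up).
by rewrite subrK.
Qed.

Lemma derive_slant_radial p : U p -> 'D_(Z p) a p = a p.
Proof.
move=> Up; rewrite derive_slant// xZ// slant_direction// minkZr.
by rewrite mink_direction// mulr1.
Qed.

Lemma derive_direction_radial p : U p -> 'D_(Z p) y p = 0.
Proof.
move=> Up; have := derive_decomp (Z p) Up.
rewrite xZ// derive_slant_radial// {1}slant_direction//.
have [_ _ ->//] := H; rewrite scaler0 addr0 => /eqP.
rewrite addrC -subr_eq subrr eq_sym scaler_eq0 (negbTE (a_neq0 Up)) /=.
by move/eqP.
Qed.

(** This is what makes [N] a spherical normal of [y]. Paired with [N], the derivative of
    [x = a y + b N] leaves only [a] times the product in question. *)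
Lemma mink_derive_direction_N p v : U p -> mink ('D_v y p) (N p) = 0.
Proof.
move=> Up; have alg (n u d e : 'rV[R]_4) (s t r : R) : mink n u = 0 ->
    mink n e = 0 -> mink n (s *: u + t *: d + r *: e) = t * mink n d.
  by move=> nu ne; rewrite 2!minkDr !minkZr nu ne !mulr0 add0r addr0.
have := esym (congr1 (mink (N p)) (derive_decomp v Up)).
have Ny : mink (N p) (y p) = 0 by rewrite minkC mink_direction_N.
rewrite (mink_Ndx H')// (alg _ _ _ _ _ _ _ Ny (mink_NdN H' v Up)) minkC => /eqP.
by rewrite mulf_eq0 (negbTE (a_neq0 Up)) => /eqP.
Qed.

(** Being orthogonal to [N], the vector ['D_v y] is tangent to the hypersurface. *)
Lemma derive_direction_spacelike p v : U p -> 'D_v y p != 0 ->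
  0 < mink ('D_v y p) ('D_v y p).
Proof.
move=> Up Dy0; have := tangent_coordP H' ('D_v y p) Up.
rewrite mink_derive_direction_N// scale0r addr0 => E; rewrite -E.
apply: x_gt0 => //; apply/negP => /eqP t0.
by move: Dy0; rewrite -E t0 derive0 eqxx.
Qed.

End Ruled.

(** * Coordinate charts of the parameter space *)

Section Charts.
Context {R : realType}.

(** The norm of a row is the sup norm, so a ball is a cube, and replacing one coordinate by a value
    from its interval does not leave it. *)
Lemma rV_ballP {n} (c q : 'rV[R]_n) (r : R) : 0 < r ->
  ball c r q <-> forall j, ball (c 0 j) r (q 0 j).
Proof.
move=> r0; rewrite -ball_normE /=; split=> [cq j|cq].
  rewrite -ball_normE /=; apply: le_lt_trans cq.
  by have := rV_coord_le (c - q) j; rewrite !mxE.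
rewrite /Num.Def.normr /= mx_normrE; apply: bigmax_lt => // -[i j] _ /=.
by rewrite (ord1 i) !mxE; have := cq j; rewrite -ball_normE.
Qed.

Lemma row3P (a b : 'rV[R]_3) :
  a 0 0 = b 0 0 -> a 0 1 = b 0 1 -> a 0 2 = b 0 2 -> a = b.
Proof.
move=> E0 E1 E2; apply/rowP => -[[|[|[|//]]] kP].
- by move: E0; congr (a _ _ = b _ _); exact/val_inj.
- by move: E1; congr (a _ _ = b _ _); exact/val_inj.
- by move: E2; congr (a _ _ = b _ _); exact/val_inj.
Qed.

Lemma delta3E (i j : 'I_3) :
  (delta_mx 0 i : 'rV[R]_3) 0 j = (i == j)%:R.
Proof. by rewrite mxE eqxx eq_sym. Qed.

Lemma lin3E (s t : R) (i j k : 'I_3) :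
  (s *: delta_mx 0 i + t *: delta_mx 0 j : 'rV[R]_3) 0 k =
  s * (i == k)%:R + t * (j == k)%:R.
Proof. by rewrite mxE [X in X + _]mxE [X in _ + X]mxE !delta3E. Qed.

Definition triple {V : normedModType R} (f0 f1 f2 : V -> R) (p : V) : 'rV[R]_3 :=
  \row_j tnth [tuple f0 p; f1 p; f2 p] j.

Lemma tripleE {V : normedModType R} (f0 f1 f2 : V -> R) p :
  (triple f0 f1 f2 p 0 0 = f0 p) * (triple f0 f1 f2 p 0 1 = f1 p) *
  (triple f0 f1 f2 p 0 2 = f2 p).
Proof. by rewrite !mxE. Qed.

Lemma smooth_triple {V : normedModType R} (U : set V) (f0 f1 f2 : V -> R) :
  open U -> smooth U f0 -> smooth U f1 -> smooth U f2 ->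
  smooth U (triple f0 f1 f2).
Proof.
move=> oU s0 s1 s2 k; apply: (Ck_row oU) => j.
case: j => [[|[|[|//]]] jP].
- by apply: Ck_ext oU _ (s0 k) => p _; rewrite mxE.
- by apply: Ck_ext oU _ (s1 k) => p _; rewrite mxE.
- by apply: Ck_ext oU _ (s2 k) => p _; rewrite mxE.
Qed.

Lemma derive_triple {V : normedModType R} (f0 f1 f2 : V -> R) p v :
  differentiable f0 p -> differentiable f1 p -> differentiable f2 p ->
  'D_v (triple f0 f1 f2) p = triple ('D_v f0) ('D_v f1) ('D_v f2) p.
Proof.
move=> d0 d1 d2.
have E0 j (jP : (j < 3)%N) : (fun q => triple f0 f1 f2 q 0 (Ordinal jP)) =
    [:: f0; f1; f2]`_j.
  by rewrite funeqE => q; rewrite mxE; case: j jP => [|[|[|//]]].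
have d : differentiable (triple f0 f1 f2) p.
  apply: differentiable_rowP => -[j jP]; rewrite E0.
  by case: j jP => [|[|[|//]]].
apply/rowP => -[j jP]; rewrite -(derive_coord 0 _ (@diff_derivable _ _ _ _ _ v d)).
by rewrite E0 mxE; case: j jP => [|[|[|//]]].
Qed.

Definition chart {V W : normedModType R} (O : set V) (D : set W)
    (f : V -> W) (psi : W -> V) : Prop :=
  [/\ open O /\ open D, smooth O f, smooth D psi,
      forall p, O p -> D (f p) /\ psi (f p) = p &
      forall q, D q -> O (psi q) /\ f (psi q) = q].

Lemma chart_derive {V W : normedModType R} (O : set V) (D : set W)
    (f : V -> W) (psi : W -> V) p v :
  chart O D f psi -> O p -> 'D_('D_v f p) psi (f p) = v.
Proof.
move=> [[oO oD] sf spsi fP psiP] Op; have [Df _] := fP p Op.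
have := derive_comp v (smooth_diff sf Op) (smooth_diff spsi Df) => <-.
have id_ q : O q -> (psi \o f) q = id q by move=> /fP[].
by apply: etrans (derive_open_eq v oO id_ Op) _; exact: derive_id.
Qed.

Lemma chart_sym {V W : normedModType R} (O : set V) (D : set W)
    (f : V -> W) (psi : W -> V) : chart O D f psi -> chart D O psi f.
Proof. by move=> [[oO oD] sf spsi fP psiP]; split. Qed.

Lemma chart_derive_comp {V W X : normedModType R} (O : set V) (D : set W)
    (f : V -> W) (psi : W -> V) (g : V -> X) q v :
  chart O D f psi -> D q -> differentiable g (psi q) ->
  'D_v (g \o psi) q = 'D_('D_v psi q) g (psi q).
Proof.
by move=> [_ _ spsi _ _] Dq dg; exact: (derive_comp v (smooth_diff spsi Dq) dg).
Qed.

Lemma chart_exists (U : set 'rV[R]_3) (f0 f1 f2 : 'rV[R]_3 -> R) p :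
  open U -> U p -> smooth U f0 -> smooth U f1 -> smooth U f2 ->
  (forall v, 'D_v f0 p = 0 -> 'D_v f1 p = 0 -> 'D_v f2 p = 0 -> v = 0) ->
  exists (r : R) (O : set 'rV[R]_3) psi, [/\ 0 < r, O p, O `<=` U &
    chart O (ball (triple f0 f1 f2 p) r) (triple f0 f1 f2) psi].
Proof.
move=> oU Up s0 s1 s2 inj; have sf := smooth_triple oU s0 s1 s2.
have J0 : \det (jacobian (triple f0 f1 f2) p) != 0.
  apply/negP => /det0P[v v0]; rewrite -deriveEjacobian; last exact: smooth_diff Up.
  rewrite derive_triple; try exact: smooth_diff Up.
  move=> /rowP E; move: v0; rewrite (inj v) ?eqxx//.
  - by have := E 0; rewrite !mxE.
  - by have := E 1; rewrite !mxE.
  - by have := E 2; rewrite !mxE.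
have [r [Q [psi [[r0 oQ Qp QU] [spsi fP psiP]]]]] := inverse_function oU sf Up J0.
exists r, Q, psi; split=> //; split=> //.
- by split=> //; exact: ball_open.
- exact: smooth_sub sf.
Qed.

Lemma chart_immersion (O D : set 'rV[R]_3) f psi (x X : 'rV[R]_3 -> 'rV[R]_4) :
  chart O D f psi -> spacelike_immersion O x ->
  (forall q, D q -> X q = x (psi q)) -> spacelike_immersion D X.
Proof.
move=> C [sx xP] XE; have [[oO oD] sf spsi fP psiP] := C; split.
  move=> k; apply: (@Ck_ext _ _ _ _ _ (x \o psi)) => //.
    by move=> q /XE.
  by apply: (Ck_comp (D := O)) => // q /psiP[].
move=> q Dq v v0; rewrite (derive_open_eq v oD XE Dq).
have [Oq fq] := psiP q Dq; have dx := smooth_diff sx Oq.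
have -> : 'D_v (fun q => x (psi q)) q = 'D_('D_v psi q) x (psi q).
  exact: (chart_derive_comp v C Dq dx).
apply: xP => //; apply/negP => /eqP Dpsi.
have := chart_derive v (chart_sym C) Dq; rewrite Dpsi derive0 => /esym/eqP.
by rewrite (negbTE v0).
Qed.

Lemma chart_congruent (O D : set 'rV[R]_3) f psi (x X : 'rV[R]_3 -> 'rV[R]_4) :
  chart O D f psi -> (forall q, D q -> X q = x (psi q)) -> congruent O x D X.
Proof.
move=> [[oO oD] sf spsi fP psiP] XE; exists 1%:M, f; split.
- by move=> a b; rewrite !mulmx1.
- by exists psi.
- by move=> p /fP[Df E]; rewrite mulmx1 XE// E.
Qed.

End Charts.

(** * Direction of rank two: type (iii) *)

Section SurfaceType.
Context {R : realType}.
Implicit Types (U : set 'rV[R]_3) (x N : 'rV[R]_3 -> 'rV[R]_4).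

Definition insert (s : R) (w : 'rV[R]_2) : 'rV[R]_3 :=
  \row_j (if unlift ord0 j is Some k then w 0 k else s).

Lemma insert0 s w : insert s w 0 0 = s.
Proof. by rewrite mxE unlift_none. Qed.

Lemma insert_lift s w k : insert s w 0 (lift ord0 k) = w 0 k.
Proof. by rewrite mxE liftK. Qed.

Lemma tu_insert s w : tu (insert s w) = w.
Proof. by apply/rowP => k; rewrite mxE insert_lift. Qed.

Lemma insert_tu (q : 'rV[R]_3) : insert (q 0 0) (tu q) = q.
Proof.
apply/rowP => j; case: (unliftP ord0 j) => [k|] ->; last by rewrite insert0.
by rewrite insert_lift mxE.
Qed.

Lemma insertB s s' w : insert s w - insert s' w = (s - s') *: delta_mx 0 0.
Proof.
apply/rowP => j; rewrite mxE [X in _ + X]mxE [RHS]mxE [X in _ * X]mxE.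
case: (unliftP ord0 j) => [k|] ->; last by rewrite !insert0 /= mulr1.
by rewrite !insert_lift mulr0 subrr.
Qed.

Lemma insert_coordE s j : (fun w => insert s w 0 j) =
  if unlift ord0 j is Some k then (fun w => w 0 k) else cst s.
Proof. by rewrite funeqE => w; rewrite mxE; case: unlift. Qed.

Lemma smooth_insert s (L : set 'rV[R]_2) : open L -> smooth L (insert s).
Proof.
move=> oL k; apply: (Ck_row oL) => j; rewrite insert_coordE.
case: unlift => [i|]; last exact: Ck_cst.
apply: (Ck_coord 0 i oL); exact: Ck_id.
Qed.

Lemma insert_ball (c : 'rV[R]_3) r (q : 'rV[R]_3) s : 0 < r ->
  ball c r q -> ball (c 0 0) r s -> ball c r (insert s (tu q)).
Proof.
move=> r0 /(rV_ballP _ _ r0) cq cs; apply/(rV_ballP _ _ r0) => j.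
case: (unliftP ord0 j) => [k|] ->; last by rewrite insert0.
by rewrite insert_lift mxE.
Qed.

Lemma ball_insert (c : 'rV[R]_3) r : 0 < r ->
  [set q : 'rV[R]_3 | ball (c 0 0) r (q 0 0) /\ ball (tu c) r (tu q)] = ball c r.
Proof.
move=> r0; apply/seteqP; split=> q /=.
  move=> [q0 /(rV_ballP _ _ r0) qtu]; apply/(rV_ballP _ _ r0) => j.
  case: (unliftP ord0 j) => [k|] ->; last by [].
  by have := qtu k; rewrite !mxE.
move=> /(rV_ballP _ _ r0) cq; split; first exact: cq.
by apply/(rV_ballP _ _ r0) => k; rewrite !mxE.
Qed.

Lemma insert_ball_tu (c : 'rV[R]_3) r w : 0 < r ->
  ball (tu c) r w -> ball c r (insert (c 0 0) w).
Proof.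
move=> r0 cw; rewrite -(ball_insert c r0) /= insert0 tu_insert; split=> //.
exact: ballxx.
Qed.

Lemma derive0_insert {n} (F : 'rV[R]_3 -> 'rV[R]_n) (c : 'rV[R]_3) r q s :
  0 < r -> ball c r q -> ball (c 0 0) r s ->
  (forall z, ball c r z -> differentiable F z) ->
  (forall z, ball c r z -> 'D_(delta_mx 0 0) F z = 0) ->
  F q = F (insert s (tu q)).
Proof.
move=> r0 cq cs dF DF.
apply: (derive0_ball_eq (insert_ball r0 cq cs) cq dF) => z cz.
rewrite -{1}(insert_tu q) insertB (deriveZr _ _ (dF z cz)) DF//.
by rewrite scaler0.
Qed.

Lemma is_interval_ball (c r : R) : is_interval (ball c r).
Proof.
move=> s t + + u /andP[su ut]; rewrite -!ball_normE /= !ltr_norml.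
move=> /andP[s1 s2] /andP[t1 t2].
by apply/andP; split; lra.
Qed.

(* The chart is [(a, y_i, y_j)]: its first coordinate line is the integral curve
   of the radial field, along which [y] and [N] are constant. *)
Lemma ruled_surface_type U x N (i j : 'I_4) p : ruled U x N -> U p ->
  let y := direction x N in
  (forall v, 'D_v (slant x N) p = 0 -> 'D_v (fun q => y q 0 i) p = 0 ->
     'D_v (fun q => y q 0 j) p = 0 -> v = 0) ->
  exists W, [/\ open W, W p, W `<=` U & surface_type W x].
Proof.
move=> H Up y inj; have [H' _ NZ] := H; have [oU sxP [sN NP]] := H'.
have sa := smooth_slant H; have sy : smooth U y := smooth_direction H.
have syk k : smooth U (fun q => y q 0 k) by move=> l; exact: (Ck_coord _ _ oU).
have [r [W [psi [r0 Wp WU C]]]] := chart_exists oU Up sa (syk i) (syk j) inj.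
set Phi := triple _ _ _ in C; set c := Phi p in C.
have [[oW oD] sPhi spsi PhiP psiP] := C.
have psiU q : ball c r q -> U (psi q) by move=> /psiP[/WU].
have Phi0 q : Phi q 0 0 = slant x N q by rewrite mxE.
have Phi1 q : Phi q 0 1 = y q 0 i by rewrite mxE.
have Phi2 q : Phi q 0 2 = y q 0 j by rewrite mxE.
have pull n (g : 'rV[R]_3 -> 'rV[R]_n) : smooth U g -> smooth (ball c r) (g \o psi).
  move=> sg k; apply: (Ck_comp oD _ oU (spsi k) (sg k)) => q; exact: psiU.
(* In the chart the radial field is [a] times the first coordinate field, because ['D_Z a = a] and
   ['D_Z y = 0]. *)
have De0 q : ball c r q -> slant x N (psi q) *: 'D_(delta_mx 0 0) psi q =
    radial x N (psi q).
  move=> Dq; have Uq := psiU q Dq; have [Wq fq] := psiP q Dq.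
  have := chart_derive (radial x N (psi q)) C Wq; rewrite fq => <-.
  rewrite -(deriveZr _ _ (smooth_diff spsi Dq)); congr ('D_ _ _ _).
  rewrite derive_triple; try exact: smooth_diff Uq.
  have Dyk k : 'D_(radial x N (psi q)) (fun q => y q 0 k) (psi q) = 0.
    rewrite derive_coord; last exact/diff_derivable/(smooth_diff sy).
    by rewrite (derive_direction_radial H Uq) mxE.
  apply/rowP => -[[|[|[|//]]] kP]; rewrite !mxE /=.
  - by rewrite (derive_slant_radial H Uq) mulr1.
  - by rewrite mulr0; exact: esym (Dyk i).
  - by rewrite mulr0; exact: esym (Dyk j).
have const n (g : 'rV[R]_3 -> 'rV[R]_n) q : smooth U g ->
    (forall q, U q -> 'D_(radial x N q) g q = 0) -> ball c r q ->
    'D_(delta_mx 0 0) (g \o psi) q = 0.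
  move=> sg Dg Dq; have Uq := psiU q Dq; have dg := smooth_diff sg Uq.
  rewrite (chart_derive_comp _ C Dq dg); have := Dg _ Uq.
  rewrite -(De0 q Dq) (deriveZr _ _ dg) => /eqP; rewrite scaler_eq0 gt_eqF/=.
    by move/eqP.
  exact: (slant_gt0 H Uq).
have move0 n (g : 'rV[R]_3 -> 'rV[R]_n) q : smooth U g ->
    (forall q, U q -> 'D_(radial x N q) g q = 0) -> ball c r q ->
    g (psi q) = g (psi (insert (c 0 0) (tu q))).
  move=> sg Dg Dq; apply: (derive0_insert (F := g \o psi) r0 Dq (ballxx _ r0)).
    by move=> q' Dq'; exact: smooth_diff (pull _ g sg) Dq'.
  by move=> q' Dq'; exact: const.
have b_const q : ball c r q -> offset x N (psi q) = offset x N p.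
  move=> Dq; have Dc : ball c r c by exact: ballxx.
  have <- : psi c = p by have [_ ->] := PhiP p Wp.
  have sb := smooth_offset H.
  have db z : ball c r z -> differentiable (offset x N) (psi z).
    by move=> /psiU; exact: smooth_diff.
  apply: (derive0_ball_eqR (F := offset x N \o psi) Dc Dq) => z Dz.
    by apply: differentiable_comp; [exact: smooth_diff Dz|exact: db].
  rewrite (chart_derive_comp _ C Dz (db z Dz)).
  by rewrite (derive_offset H _ (psiU z Dz)).
(* As [y] and [N] do not depend on the first coordinate, they are read off on the slice through the
   centre [c]. *)
pose g w := psi (insert (c 0 0) w).
pose L := ball (tu c) r.
have oL : open L by exact: ball_open.
have LD w : L w -> ball c r (insert (c 0 0) w) by exact: insert_ball_tu.
have sg n (f : 'rV[R]_3 -> 'rV[R]_n) : smooth U f -> smooth L (f \o g).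
  move=> sf k.
  exact: (Ck_comp oL LD oD (smooth_insert (c 0 0) oL k) (pull n f sf k)).
have Df n (f : 'rV[R]_3 -> 'rV[R]_n) w v : smooth U f -> L w ->
    exists u, 'D_v (f \o g) w = 'D_u f (g w).
  move=> sf Lw; have Dw := LD w Lw.
  exists ('D_('D_v (insert (c 0 0)) w) psi (insert (c 0 0) w)).
  rewrite -(chart_derive_comp _ C Dw (smooth_diff sf (psiU _ Dw))).
  apply: (derive_comp v (smooth_diff (smooth_insert (c 0 0) openT) I)).
  exact: smooth_diff (pull n f sf) Dw.
have XE q : ball c r q -> surface_param (- offset x N p) (y \o g) (N \o g) q =
    x (psi q).
  move=> Dq; have Uq := psiU q Dq.
  rewrite (ruled_decomp H Uq) b_const// /surface_param scaleNr opprK.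
  have [_ fq] := psiP q Dq.
  have Ey : (y \o g) (tu q) = y (psi q).
    exact: (esym (move0 4 y q sy
      (fun q' => derive_direction_radial H (p := q')) Dq)).
  have EN : (N \o g) (tu q) = N (psi q) by exact: (esym (move0 4 N q sN NZ Dq)).
  by rewrite Ey EN -{1}fq Phi0.
exists W; split=> //.
(* The model subtracts its constant times the normal, so the constant is minus the offset. *)
exists (- offset x N p), (ball (c 0 0) r), L, (y \o g), (N \o g).
rewrite /= ball_insert//; split=> //.
- by split; [exact: ball_open|exact: is_interval_ball].
- split; first exact: sg.
  + by move=> w Lw; exact: (mink_direction H (psiU _ (LD w Lw))).
  (* The coordinates on the slice are [y_i] and [y_j] themselves, so a vector killed by the
     differential of [y \o g] has zero components. *)
  + move=> w Lw v Dv.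
    have comp k l : (forall q, Phi q 0 (lift ord0 k) = y q 0 l) -> v 0 k = 0.
      move=> Pk; have dyg := smooth_diff (sg _ y sy) Lw.
      have E w' : L w' -> (y \o g) w' 0 l = w' 0 k.
        move=> Lw'; have [_ fq] := psiP _ (LD w' Lw').
        by rewrite /= -Pk /g fq insert_lift.
      have := derive_coord 0 l (@diff_derivable _ _ _ _ _ v dyg).
      rewrite Dv mxE (derive_open_eq v oL E Lw).
      by rewrite (derive_coord (f := id) 0 k) ?derive_id//; exact: derivable_id.
    apply/rowP => -[[|[|//]] kP]; rewrite [RHS]mxE.
      by apply: (comp _ i) => q; rewrite -Phi1; congr (Phi q 0 _); exact/val_inj.
    by apply: (comp _ j) => q; rewrite -Phi2; congr (Phi q 0 _); exact/val_inj.
- split; last first.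
    by move=> w Lw; rewrite minkC; exact: (mink_direction_N H (psiU _ (LD w Lw))).
  split; first exact: sg.
  move=> w Lw; have Uw := psiU _ (LD w Lw); split; first exact: (mink_NN H' Uw).
  move=> v; have [u ->] := Df _ y w v sy Lw.
  by rewrite minkC; exact: (mink_derive_direction_N H u Uw).
split; last exact: chart_congruent C XE.
apply: chart_immersion C _ XE.
by have [_ ? _] := hypersurface_sub oW WU H'.
Qed.

End SurfaceType.

(** * Direction of rank one: a curve with a normal frame *)

Section RankOne.
Context {R : realType}.
Implicit Types (U : set 'rV[R]_3) (x N : 'rV[R]_3 -> 'rV[R]_4).

Definition axis_line (c : 'rV[R]_3) : R -> 'rV[R]_3 :=
  triple (fun=> c 0 0) (fun=> c 0 1) (fun t => t).

Lemma axis_line2 c t : axis_line c t 0 2 = t. Proof. by rewrite mxE. Qed.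

Lemma axis_line_id (c : 'rV[R]_3) : axis_line c (c 0 2) = c.
Proof.
by apply/rowP => -[[|[|[|//]]] kP]; rewrite mxE; congr (c _ _); exact/val_inj.
Qed.

Lemma smooth_axis_line c (T : set R) : open T -> smooth T (axis_line c).
Proof.
move=> oT; apply: (smooth_triple oT) => k.
- exact: Ck_cst.
- exact: Ck_cst.
- exact: Ck_id.
Qed.

Lemma axis_line_ball (c : 'rV[R]_3) r t : 0 < r ->
  ball (c 0 2) r t -> ball c r (axis_line c t).
Proof.
move=> r0 ct; apply/(rV_ballP _ _ r0) => -[[|[|[|//]]] kP]; rewrite mxE /tnth /=.
- by have := @ballxx _ _ (c 0 0) _ r0; congr ball; congr (c _ _); exact/val_inj.
- by have := @ballxx _ _ (c 0 1) _ r0; congr ball; congr (c _ _); exact/val_inj.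
- by move: ct; congr ball; congr (c _ _); exact/val_inj.
Qed.

Let derive_axis_line_dir {V : normedModType R} (F : 'rV[R]_3 -> V)
    (c q z : 'rV[R]_3) :
  differentiable F z -> 'D_(delta_mx 0 0) F z = 0 -> 'D_(delta_mx 0 1) F z = 0 ->
  'D_(q - axis_line c (q 0 2)) F z = 0.
Proof.
move=> dF D0 D1; rewrite (derive_row (q - axis_line c (q 0 2)) dF).
rewrite big1// => -[[|[|[|//]]] kP] _.
- have -> : Ordinal kP = 0 by exact/val_inj.
  by rewrite D0 scaler0.
- have -> : Ordinal kP = 1 by exact/val_inj.
  by rewrite D1 scaler0.
- have -> : Ordinal kP = 2 by exact/val_inj.
  by rewrite mxE [X in _ + X]mxE axis_line2 subrr scale0r.
Qed.

Lemma axis_line_const {n} (F : 'rV[R]_3 -> 'rV[R]_n) (c : 'rV[R]_3) r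
    (q : 'rV[R]_3) : 0 < r ->
  ball c r q -> (forall z, ball c r z -> differentiable F z) ->
  (forall z, ball c r z -> 'D_(delta_mx 0 0) F z = 0) ->
  (forall z, ball c r z -> 'D_(delta_mx 0 1) F z = 0) ->
  F q = F (axis_line c (q 0 2)).
Proof.
move=> r0 cq dF D0 D1; have cl : ball c r (axis_line c (q 0 2)).
  by apply: axis_line_ball => //; move/(rV_ballP _ _ r0) : cq.
apply: (derive0_ball_eq cl cq dF) => z cz.
by apply: derive_axis_line_dir; [exact: dF|exact: D0|exact: D1].
Qed.

Lemma axis_line_constR (F : 'rV[R]_3 -> R) (c : 'rV[R]_3) r (q : 'rV[R]_3) : 0 < r ->
  ball c r q -> (forall z, ball c r z -> differentiable F z) ->
  (forall z, ball c r z -> 'D_(delta_mx 0 0) F z = 0) ->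
  (forall z, ball c r z -> 'D_(delta_mx 0 1) F z = 0) ->
  F q = F (axis_line c (q 0 2)).
Proof.
move=> r0 cq dF D0 D1; have cl : ball c r (axis_line c (q 0 2)).
  by apply: axis_line_ball => //; move/(rV_ballP _ _ r0) : cq.
apply: (derive0_ball_eqR cl cq dF) => z cz.
by apply: derive_axis_line_dir; [exact: dF|exact: D0|exact: D1].
Qed.

Lemma smooth_comp {V : normedModType R} {n m} (A : set V) (D : set 'rV[R]_n)
    (f : V -> 'rV[R]_n) (g : 'rV[R]_n -> 'rV[R]_m) :
  open A -> open D -> (forall p, A p -> D (f p)) ->
  smooth A f -> smooth D g -> smooth A (g \o f).
Proof. by move=> oA oD AD sf sg k; exact: (Ck_comp oA AD oD (sf k) (sg k)). Qed.

(* Near [p] the direction is the curve [beta] of its own [i]-th coordinate, and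
   [F1], [F2] is a frame of the normal space of [beta] in de Sitter space. *)
Record adapted_frame U x N (i : 'I_4) p (r : R) (W : set 'rV[R]_3)
    (beta F1 F2 : R -> 'rV[R]_4) : Prop := AdaptedFrame {
  af_radius : 0 < r;
  af_dom : [/\ open W, W p & W `<=` U];
  af_smooth : let T := ball (direction x N p 0 i) r in
    [/\ smooth T beta, smooth T F1 & smooth T F2];
  af_point : forall m, W m -> [/\ ball (direction x N p 0 i) r (direction x N m 0 i),
    direction x N m = beta (direction x N m 0 i),
    mink (N m) ('D_1 beta (direction x N m 0 i)) = 0 &
    offset x N m = offset x N p];
  af_norm : forall t, ball (direction x N p 0 i) r t ->
    [/\ mink (beta t) (beta t) = 1, 0 < mink ('D_1 beta t) ('D_1 beta t),
        mink (F1 t) (F1 t) = -1 & mink (F2 t) (F2 t) = 1];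
  af_orth : forall t, ball (direction x N p 0 i) r t ->
    [/\ mink (F1 t) (F2 t) = 0, mink (F1 t) (beta t) = 0,
        mink (F1 t) ('D_1 beta t) = 0, mink (F2 t) (beta t) = 0 &
        mink (F2 t) ('D_1 beta t) = 0];
  af_base : F1 (direction x N p 0 i) = N p /\ offset x N p != 0;
  af_inj : forall v, 'D_v (slant x N) p = 0 ->
    'D_v (fun q => direction x N q 0 i) p = 0 ->
    mink ('D_v N p) (F2 (direction x N p 0 i)) = 0 -> v = 0 }.

(** In the chart [(a, q_l, y_i)] the second coordinate field [w] kills [a] and [y_i], and the
    dependence hypothesis makes it kill all of [y]; with the radial field, [y] becomes a function of
    the third coordinate alone. From ['D_w x = b *: 'D_w N] follows [b != 0]. Along the axis through
    the centre, [F1] is [N] and [F2] is the normalised ['D_w x]. *)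
Lemma rank_one_frame U x N (i : 'I_4) (l : 'I_3) p : ruled U x N -> U p ->
  let y := direction x N in
  (forall v, 'D_v (slant x N) p = 0 -> v 0 l = 0 ->
     'D_v (fun q => y q 0 i) p = 0 -> v = 0) ->
  (forall q j, U q -> exists v, [/\ v != 0, 'D_v (slant x N) q = 0,
     'D_v (fun q => y q 0 i) q = 0 & 'D_v (fun q => y q 0 j) q = 0]) ->
  exists r W beta F1 F2, adapted_frame U x N i p r W beta F1 F2.
Proof.
move=> H Up y inj rank1; have [H' _ NZ] := H; have [oU sxP [sN NP]] := H'.
have [sx x_gt0] := sxP.
have sa := smooth_slant H; have sy : smooth U y := smooth_direction H.
have sb := smooth_offset H.
have syk k : smooth U (fun q => y q 0 k) by move=> n; exact: (Ck_coord _ _ oU).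
have sl : smooth U (fun q : 'rV[R]_3 => q 0 l : R).
  by move=> k; apply: (Ck_coord 0 l oU); exact: Ck_id.
have Dl q v : 'D_v (fun q : 'rV[R]_3 => q 0 l : R) q = v 0 l.
  by rewrite (derive_coord (f := id) 0 l) ?derive_id//; exact: derivable_id.
have inj' v : 'D_v (slant x N) p = 0 -> 'D_v (fun q : 'rV[R]_3 => q 0 l : R) p = 0 ->
    'D_v (fun q => y q 0 i) p = 0 -> v = 0.
  by rewrite Dl; exact: inj.
have [r [W [psi [r0 Wp WU C]]]] := chart_exists oU Up sa sl (syk i) inj'.
set Phi := triple _ _ _ in C; set c := Phi p in C.
have [[oW oD] sPhi spsi PhiP psiP] := C.
have psiU q : ball c r q -> U (psi q) by move=> /psiP[/WU].
have DPhi q v : U q -> 'D_v Phi q =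
    triple ('D_v (slant x N)) (fun=> v 0 l) ('D_v (fun q => y q 0 i)) q.
  move=> Uq; rewrite derive_triple; try exact: smooth_diff Uq.
  by apply: row3P; rewrite !tripleE ?Dl.
pose w q := 'D_(delta_mx 0 1) psi q; pose u q := 'D_(delta_mx 0 2) psi q.
have DDpsi q v : ball c r q -> 'D_('D_v psi q) Phi (psi q) = v.
  by move=> Dq; exact: (chart_derive v (chart_sym C) Dq).
(* On the common kernel of the differentials of [a] and [y_i] only the second chart coordinate
   moves, so that kernel is the line of [w q]. *)
have Ew q v : ball c r q -> 'D_v (slant x N) (psi q) = 0 ->
    'D_v (fun q => y q 0 i) (psi q) = 0 -> v = v 0 l *: w q.
  move=> Dq va vi; have Uq := psiU q Dq; have Wq : W (psi q) by have [] := psiP q Dq.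
  have E1 : 'D_v Phi (psi q) = v 0 l *: delta_mx 0 1.
    rewrite (DPhi (psi q) v Uq).
    apply: row3P; rewrite tripleE mxE delta3E ?mulr0 ?mulr1.
    + exact: va.
    + by [].
    + exact: vi.
  have X := chart_derive v C Wq.
  rewrite E1 (psiP q Dq).2 (deriveZr _ _ (smooth_diff spsi Dq)) in X.
  exact: esym X.
have wP q : ball c r q -> [/\ w q != 0, 'D_(w q) (slant x N) (psi q) = 0 &
    'D_(w q) y (psi q) = 0].
  move=> Dq; have Uq := psiU q Dq; have := DDpsi q (delta_mx 0 1) Dq.
  rewrite -/(w q) (DPhi _ _ Uq) => /rowP E.
  have Ea : 'D_(w q) (slant x N) (psi q) = 0.
    by have := E 0; rewrite tripleE delta3E.
  have wl : w q 0 l = 1 by have := E 1; rewrite tripleE delta3E.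
  split=> //.
    apply/negP => /eqP w0; move: wl; rewrite w0 mxE => /esym/eqP.
    by rewrite oner_eq0.
  apply/rowP => j; have [v [v0 va vi vj]] := rank1 (psi q) j Uq.
  have Ev := Ew q v Dq va vi.
  have vl : v 0 l != 0 by apply: contraNneq v0 => vl0; rewrite Ev vl0 scale0r.
  have := vj; rewrite {1}Ev (deriveZr _ _ (smooth_diff (syk j) Uq)) => /eqP.
  rewrite scaler_eq0 (negbTE vl) /= derive_coord; last first.
    exact/diff_derivable/(smooth_diff sy).
  by move/eqP => ->; rewrite mxE.
(* The radial field combines the first two coordinate fields, with the positive coefficient [a] on
   the first; it kills [y], and so does the second field [w]. *)
have D0 q : ball c r q -> 'D_('D_(delta_mx 0 0) psi q) y (psi q) = 0.
  move=> Dq; have Uq := psiU q Dq; have [Wq Pq] := psiP q Dq.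
  set Z := radial x N (psi q).
  have E1 : 'D_Z Phi (psi q) =
      slant x N (psi q) *: delta_mx 0 0 + Z 0 l *: delta_mx 0 1.
    rewrite (DPhi (psi q) Z Uq) /=.
    apply: row3P; rewrite tripleE lin3E ?mulr0 ?mulr1 ?addr0 ?add0r//.
    + exact: (derive_slant_radial H Uq).
    + rewrite derive_coord; last exact/diff_derivable/(smooth_diff sy).
      by rewrite (derive_direction_radial H Uq) mxE.
  have X := chart_derive Z C Wq; have dpsi := smooth_diff spsi Dq.
  rewrite E1 Pq (deriveDr _ _ dpsi) !(deriveZr _ _ dpsi) -/(w q) in X.
  have dy := smooth_diff sy Uq; have [_ _ wy] := wP q Dq.
  have Y := etrans (congr1 (fun v => 'D_v y (psi q)) X)
    (derive_direction_radial H Uq).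
  have alg (s t : R) (v1 v2 : 'rV[R]_4) :
      s *: v1 + t *: v2 = 0 -> v2 = 0 -> 0 < s -> v1 = 0.
    move=> /[swap] -> /eqP + s0; rewrite scaler0 addr0 scaler_eq0 gt_eqF//=.
    by move/eqP.
  exact: (alg _ _ _ _ (etrans (esym (derive_lin2 _ _ _ _ dy)) Y) wy
    (slant_gt0 H Uq)).
have cE : c 0 2 = y p 0 i by rewrite /c tripleE.
pose T : set R := ball (c 0 2) r.
have oT : open T by exact: ball_open.
have TD t : T t -> ball c r (axis_line c t) by exact: axis_line_ball.
have svl := smooth_axis_line c oT.
pose gam t := psi (axis_line c t).
have spull (g : 'rV[R]_3 -> 'rV[R]_4) : smooth U g -> smooth (ball c r) (g \o psi).
  by move=> sg; exact: (smooth_comp oD oU psiU spsi sg).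
have sgam (g : 'rV[R]_3 -> 'rV[R]_4) :
    smooth (ball c r) g -> smooth T (g \o axis_line c).
  by move=> sg k; exact: (Ck_comp oT TD oD (svl k) (sg k)).
pose beta := (y \o psi) \o axis_line c.
have sbeta : smooth T beta by exact: sgam (spull _ sy).
have Tq q : ball c r q -> T (q 0 2) by move=> /(rV_ballP _ _ r0)/(_ 2).
have yq q : ball c r q -> y (psi q) = beta (q 0 2).
  move=> Dq; apply: (axis_line_const (F := y \o psi) r0 Dq) => z Dz.
  - exact: smooth_diff (spull _ sy) Dz.
  - by rewrite (chart_derive_comp _ C Dz (smooth_diff sy (psiU z Dz))) D0.
  - rewrite (chart_derive_comp _ C Dz (smooth_diff sy (psiU z Dz))).
    by have [_ _] := wP z Dz.
have Dbeta q : ball c r q -> 'D_1 beta (q 0 2) = 'D_(u q) y (psi q).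
  move=> Dq; have dy := smooth_diff sy (psiU q Dq).
  rewrite -(chart_derive_comp _ C Dq dy).
  pose crd (q : 'rV[R]_3) : R := q 0 2.
  have dcrd : differentiable crd q by exact: differentiable_coord.
  have Dcrd : 'D_(delta_mx 0 2) crd q = 1.
    rewrite (derive_coord (f := id) 0 2); last exact: derivable_id.
    by rewrite derive_id delta3E.
  apply/esym; apply: etrans (derive_open_eq (g := beta \o crd) _ oD yq Dq) _.
  by rewrite (derive_comp _ dcrd (smooth_diff sbeta (Tq q Dq))) Dcrd.
have bw q : ball c r q -> offset x N (psi q) *: 'D_(w q) N (psi q) =
    'D_(w q) x (psi q).
  move=> Dq; have [_ wa wy] := wP q Dq.
  rewrite (derive_decomp H (w q) (psiU q Dq)) wa wy.
  by rewrite scale0r scaler0 !add0r.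
have xw_gt0 q : ball c r q -> 0 < mink ('D_(w q) x (psi q)) ('D_(w q) x (psi q)).
  by move=> Dq; have [w0 _ _] := wP q Dq; exact: x_gt0 (psiU q Dq) _ w0.
have b_neq0 q : ball c r q -> offset x N (psi q) != 0.
  move=> Dq; apply/negP => /eqP b0; have := xw_gt0 q Dq.
  by rewrite -bw// b0 scale0r mink0l ltxx.
have uy_gt0 q : ball c r q -> 0 < mink ('D_(u q) y (psi q)) ('D_(u q) y (psi q)).
  move=> Dq; have Uq := psiU q Dq.
  apply: (derive_direction_spacelike H Uq); apply/negP => /eqP uy.
  have := DDpsi q (delta_mx 0 2) Dq; rewrite -/(u q) (DPhi _ _ Uq) => /rowP /(_ 2).
  rewrite tripleE delta3E derive_coord; last exact/diff_derivable/(smooth_diff sy).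
  by rewrite uy mxE => /esym/eqP; rewrite oner_eq0.
have xw_N q : ball c r q -> mink ('D_(w q) x (psi q)) (N (psi q)) = 0.
  by move=> Dq; rewrite minkC (mink_Ndx H')//; exact: psiU.
have xw_y q : ball c r q -> mink ('D_(w q) x (psi q)) (y (psi q)) = 0.
  move=> Dq; rewrite minkC -(derive_slant H _ (psiU q Dq)).
  by have [] := wP q Dq.
(* Pair ['D_w x] with the decomposition of ['D_u x]: by self-adjointness the term with ['D_u N]
   already gives all of [<'D_w x, 'D_u x>], so the term with ['D_u y] vanishes. *)
have xw_uy q : ball c r q -> mink ('D_(w q) x (psi q)) ('D_(u q) y (psi q)) = 0.
  move=> Dq; have Uq := psiU q Dq.
  have alg (a b ua : R) (yy xw uy xu wN uN : 'rV[R]_4) :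
      xu = ua *: yy + a *: uy + b *: uN -> 0 < a -> b *: wN = xw ->
      mink xw yy = 0 -> mink uN xw = mink wN xu -> mink xw uy = 0.
    move=> E a0 bwN xwy sym; have : mink xw xu = a * mink xw uy + mink xw xu.
      rewrite {1}E 2!minkDr !minkZr xwy mulr0 add0r; congr (_ + _).
      by rewrite minkC sym -minkZl bwN.
    move=> E2; have /eqP : a * mink xw uy = 0 by lra.
    by rewrite mulf_eq0 gt_eqF//= => /eqP.
  exact: (alg _ _ _ _ _ _ _ _ _ (derive_decomp H (u q) Uq) (slant_gt0 H Uq)
    (bw q Dq) (xw_y q Dq) (shape_selfadjoint H' (u q) (w q) Uq)).
(* ['D_w x] written as a derivative of [x \o psi], which shows its smoothness. *)
pose G q := 'D_(delta_mx 0 1) (x \o psi) q.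
have GE q : ball c r q -> G q = 'D_(w q) x (psi q).
  by move=> Dq; exact: (chart_derive_comp _ C Dq (smooth_diff sx (psiU q Dq))).
have sG : smooth (ball c r) G by exact: smooth_derive (spull _ sx).
pose f2 := G \o axis_line c.
have sf2 : smooth T f2 by exact: sgam.
pose s t := Num.sqrt (mink (f2 t) (f2 t)).
have f2_gt0 t : T t -> 0 < mink (f2 t) (f2 t).
  by move=> /TD Dt; rewrite /f2 /= GE// xw_gt0.
have s_gt0 t : T t -> 0 < s t by move=> Tt; rewrite sqrtr_gt0 f2_gt0.
have s_neq0 t : T t -> s t != 0 by move=> Tt; rewrite gt_eqF// s_gt0.
pose F2 t := (s t)^-1 *: f2 t.
have sF2 : smooth T F2.
  move=> k; apply: (Ck_scale oT) (sf2 k); apply: (CkV oT s_neq0).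
  exact: (Ck_comp1R oT f2_gt0 (Ck_mink oT (sf2 k) (sf2 k)) (Ck_sqrt k)).
have f2s t : T t -> mink (f2 t) (f2 t) = s t ^+ 2.
  by move=> Tt; rewrite sqr_sqrtr// ltW// f2_gt0.
have Dbeta' t : T t -> 'D_1 beta t = 'D_(u (axis_line c t)) y (gam t).
  by move=> /TD Dt; have := Dbeta _ Dt; rewrite axis_line2.
have psic : psi c = p by have [_ ->] := PhiP p Wp.
have T0 : T (y p 0 i) by rewrite -cE; exact: ballxx.
have Dc : ball c r c by exact: ballxx.
exists r, W, beta, ((N \o psi) \o axis_line c), F2.
split; rewrite -?cE => //.
- by split=> //; exact: sgam (spull _ sN).
- move=> m Wm; have [Dm Em] := PhiP m Wm.
  have mi : Phi m 0 2 = y m 0 i by rewrite tripleE.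
  have Um := WU m Wm; split.
  + by rewrite -mi; exact: Tq.
  + by have := yq _ Dm; rewrite Em mi.
  + have E := Dbeta _ Dm; rewrite mi Em in E; rewrite -/y E minkC.
    exact: (mink_derive_direction_N H _ Um).
  + have db z : ball c r z -> differentiable (offset x N) (psi z).
      by move=> /psiU; exact: smooth_diff.
    suff : (offset x N \o psi) (Phi m) = (offset x N \o psi) c.
      by rewrite /= Em psic.
    apply: (derive0_ball_eqR (F := offset x N \o psi) Dc Dm) => z Dz.
      by apply: differentiable_comp; [exact: smooth_diff Dz|exact: db].
    rewrite (chart_derive_comp _ C Dz (db z Dz)).
    by rewrite (derive_offset H _ (psiU z Dz)).
- move=> t Tt; have Dt := TD t Tt; have Ut := psiU _ Dt; split.
  + exact: (mink_direction H Ut).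
  + by rewrite Dbeta'// uy_gt0.
  + exact: (mink_NN H' Ut).
  + by rewrite minkZl minkZr f2s//; field; exact: s_neq0.
- move=> t Tt; have Dt := TD t Tt; have Ut := psiU _ Dt; split.
  + by rewrite minkZr minkC /f2 /= GE// xw_N// mulr0.
  + by rewrite minkC; exact: (mink_direction_N H Ut).
  + by rewrite Dbeta'// minkC; exact: (mink_derive_direction_N H _ Ut).
  + by rewrite minkZl /f2 /= GE// xw_y// mulr0.
  + by rewrite minkZl Dbeta'// /f2 /= GE// xw_uy// mulr0.
- split; first by rewrite /= axis_line_id psic.
  by rewrite -psic; exact: b_neq0.
(* Such a [v] is a multiple [v 0 l *: w c]. As ['D_w x = b *: 'D_w N], the last hypothesis makes
   [v 0 l] times the positive square of ['D_w x] vanish. *)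
- move=> v va vi; have := Ew c v Dc; rewrite psic => /(_ va vi) Ev.
  have := xw_gt0 c Dc; have := bw c Dc; rewrite psic => bwc w_gt0 vF.
  have F2c : F2 (c 0 2) = (s (c 0 2))^-1 *: 'D_(w c) x p.
    have f2c : f2 (c 0 2) = 'D_(w c) x (psi c).
      by rewrite /f2 /= axis_line_id; exact: GE.
    by rewrite /F2 f2c psic.
  have E : v 0 l * mink ('D_(w c) N p) ('D_(w c) x p) = 0.
    move: vF; rewrite F2c {1}Ev (deriveZr _ _ (smooth_diff sN Up)) minkZl minkZr.
    move/eqP; rewrite mulrCA mulf_eq0 invr_eq0 (negbTE (s_neq0 _ _)) /=.
      by move/eqP.
    by rewrite cE.
  have /eqP : v 0 l * mink ('D_(w c) x p) ('D_(w c) x p) = 0.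
    by rewrite -{1}bwc minkZl mulrCA E mulr0.
  by rewrite mulf_eq0 (gt_eqF w_gt0) orbF => /eqP vl; rewrite Ev vl scale0r.
Qed.

End RankOne.

(** * Direction of rank one: type (ii) *)

Section CurveType.
Context {R : realType}.
Implicit Types (U : set 'rV[R]_3) (x N : 'rV[R]_3 -> 'rV[R]_4).

Lemma mink_suml {n} (c : 'I_n -> R) (f : 'I_n -> 'rV[R]_4) (d : 'rV[R]_4) :
  mink (\sum_i c i *: f i) d = \sum_i c i * mink (f i) d.
Proof.
elim/big_ind2 : _ => [|a b a' b' <- <-|i _]; first exact: mink0l.
  exact: minkDl.
exact: minkZl.
Qed.

Lemma orthogonal_frame_eq0 (f : 'I_4 -> 'rV[R]_4) (d : 'rV[R]_4) :
  (forall i j, i != j -> mink (f i) (f j) = 0) ->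
  (forall i, mink (f i) (f i) != 0) -> (forall i, mink d (f i) = 0) -> d = 0.
Proof.
move=> orth nz dorth; pose M : 'M[R]_4 := \matrix_i f i.
have ME v : v *m M = \sum_i v 0 i *: f i.
  by rewrite mulmx_sum_row; apply: eq_bigr => i _; rewrite rowK.
have coord (v : 'rV[R]_4) j : mink (v *m M) (f j) = v 0 j * mink (f j) (f j).
  rewrite ME mink_suml (bigD1 j)//= big1 ?addr0// => i ij.
  by rewrite orth// mulr0.
have uM : M \in unitmx.
  rewrite unitmxE unitfE; apply/negP => /det0P[v v0 vM].
  move: v0; suff -> : v = 0 by rewrite eqxx.
  apply/rowP => j; rewrite mxE; have := coord v j; rewrite vM mink0l => /esym/eqP.
  by rewrite mulf_eq0 (negbTE (nz j)) orbF => /eqP.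
have dE : d = d *m invmx M *m M by rewrite mulmxKV.
suff d0 : d *m invmx M = 0 by rewrite dE d0 mul0mx.
apply/rowP => j; rewrite [RHS]mxE; have := coord (d *m invmx M) j.
rewrite -dE dorth => /esym/eqP.
by rewrite mulf_eq0 (negbTE (nz j)) orbF => /eqP.
Qed.

(** In the plane of [A1] and [A2] one has [n = p A1 + q A2] with [p^2 - q^2 = 1], and
    [mink n (A2 - A1) = p + q]. Its positivity selects the branch [p > 0] of the hyperbola; there
    [p - q] is the inverse of [p + q], and the logarithm of [p + q] is the hyperbolic angle. *)
Lemma timelike_in_frame (al be A1 A2 n : 'rV[R]_4) :
  mink al al = 1 -> 0 < mink be be -> mink A1 A1 = -1 -> mink A2 A2 = 1 ->
  mink al be = 0 -> mink A1 A2 = 0 -> mink A1 al = 0 -> mink A1 be = 0 ->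
  mink A2 al = 0 -> mink A2 be = 0 ->
  mink n al = 0 -> mink n be = 0 -> mink n n = -1 -> 0 < mink n (A2 - A1) ->
  n = cosh (ln (mink n (A2 - A1))) *: A1 + sinh (ln (mink n (A2 - A1))) *: A2.
Proof.
move=> al1 be0 a1 a2 albe a12 a1al a1be a2al a2be nal nbe nn E0.
set p := - mink n A1; set q := mink n A2.
have nE : n = p *: A1 + q *: A2.
  apply/eqP; rewrite -subr_eq0; apply/eqP.
  apply: (orthogonal_frame_eq0 (f := tnth [tuple al; be; A1; A2])).
  - by do 2![case=> [[|[|[|[|//]]]] ?]]; rewrite /tnth //= => _ //; rewrite minkC.
  - case=> [[|[|[|[|//]]]] ?]; rewrite /tnth /=.
    + by rewrite al1 oner_eq0.
    + by rewrite gt_eqF.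
    + by rewrite a1 oppr_eq0 oner_eq0.
    + by rewrite a2 oner_eq0.
  - case=> [[|[|[|[|//]]]] ?]; rewrite /tnth /= minkBl minkDl !minkZl.
    + by rewrite nal a1al a2al; ring.
    + by rewrite nbe a1be a2be; ring.
    + by rewrite a1 [mink A2 A1]minkC a12 /p; ring.
    + by rewrite a12 a2 /q; ring.
have pq : q ^+ 2 - p ^+ 2 = -1.
  rewrite -nn [in RHS]nE !(minkDl, minkDr, minkZl, minkZr) a1 a2 a12.
  by rewrite [mink A2 A1]minkC a12; ring.
have EE : mink n (A2 - A1) = p + q by rewrite minkBr /p /q addrC.
rewrite EE in E0 *; rewrite {1}nE /cosh /sinh expRN lnK ?posrE//.
have pqV : (p + q)^-1 = p - q.
  apply: (mulfI (lt0r_neq0 E0)); rewrite mulfV ?lt0r_neq0//.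
  by rewrite mulrC -subr_sqr; lra.
by rewrite pqV; congr (_ *: _ + _ *: _); field.
Qed.

(* The second coordinate is [t = c * ln E], with [E] the null component
   [mink N (F2 - F1)], because [E = cosh (t / c) + sinh (t / c)] in the model. *)
Lemma ruled_curve_type U x N (i : 'I_4) p r W0 beta F1 F2 : ruled U x N ->
  adapted_frame U x N i p r W0 beta F1 F2 ->
  exists W, [/\ open W, W p, W `<=` U & curve_type W x].
Proof.
move=> H [r0 [oW0 W0p W0U] [sbeta sF1 sF2] pt norm orth [F1p bp] inj].
pose y := direction x N; pose T := ball (y p 0 i) r.
have H0 : ruled W0 x N := ruled_sub oW0 W0U H.
have [H' _ NZ] := H0; have [_ sxP [sN NP]] := H'.
have sa := smooth_slant H0; have sy : smooth W0 y := smooth_direction H0.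
have syi : smooth W0 (fun q => y q 0 i) by move=> n; exact: (Ck_coord _ _ oW0).
have oT : open T by exact: ball_open.
have Tp : T (y p 0 i) by exact: ballxx.
have sDbeta : smooth T (fun t => 'D_1 beta t) by exact: smooth_derive.
have beta_gt0 t : T t -> 0 < mink ('D_1 beta t) ('D_1 beta t).
  by move=> /norm[].
pose mu t := Num.sqrt (mink ('D_1 beta t) ('D_1 beta t)).
have mu_gt0 t : T t -> 0 < mu t by move=> Tt; rewrite sqrtr_gt0 beta_gt0.
have smu : smooth T mu.
  move=> k; exact: (Ck_comp1R oT beta_gt0 (Ck_mink oT (sDbeta k) (sDbeta k))
    (Ck_sqrt k)).
(* [len] is an arc length of [beta], whose own parameter is the coordinate [y_i]. *)
have [len [slen Dlen]] := smooth_antiderivative r0 smu.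
pose T' := ball (y p 0 i) (r / 2).
have oT' : open T' by exact: ball_open.
have T'T : T' `<=` T by apply: le_ball; rewrite ler_pdivrMr// ler_pMr// ler1n.
have T'p : T' (y p 0 i) by apply: ballxx; rewrite divr_gt0.
pose c := - offset x N p; have c0 : c != 0 by rewrite oppr_eq0.
pose W1 := [set m | W0 m /\ T' (y m 0 i)].
have oW1 : open W1 := open_preimage_in oW0 oT' syi.
have W1W0 : W1 `<=` W0 by move=> m [].
pose G t := F2 t - F1 t.
have sG : smooth T G by move=> k; exact: (CkD oT (sF2 k) (CkN oT (sF1 k))).
pose Gy m := G (y m 0 i).
have sGy : smooth W1 Gy.
  move=> k; apply: (@Ck_comp1 _ _ _ k W1 T (fun m => y m 0 i) G oW1 _ oT) => //.
  - by move=> m [_ /T'T].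
  - exact: Ck_sub W1W0 (syi k).
pose E m := mink (N m) (Gy m).
have sE : smooth W1 E.
  by move=> k; exact: (Ck_mink oW1 (Ck_sub W1W0 (sN k)) (sGy k)).
(* At [p] the normal is [F1], so [E p = 1]; the positivity that the logarithm asks for holds on a
   neighbourhood. *)
pose W2 := [set m | W1 m /\ [set t : R | 0 < t] (E m)].
have oW2 : open W2 := open_preimage_in oW1 open_pos sE.
have W2W1 : W2 `<=` W1 by move=> m [].
have W2W0 : W2 `<=` W0 := subset_trans W2W1 W1W0.
have Ep : E p = 1.
  have [_ _ n1 _] := norm _ Tp; have [h12 _ _ _ _] := orth _ Tp.
  by rewrite /E /Gy /G minkBr -/y -F1p h12 n1 sub0r opprK.
have W2p : W2 p by split; [split|rewrite /= Ep].
pose f1 m := c * ln (E m).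
have sf1 : smooth W2 f1.
  move=> k; apply: (CkM oW2); first exact: Ck_cst.
  apply: (Ck_comp1R oW2 _ (Ck_sub W2W1 (sE k)) (Ck_ln k)).
  by move=> m [].
pose f2 m := len (y m 0 i).
have sf2 : smooth W2 f2.
  move=> k; apply: (@Ck_comp1R _ _ k W2 T' (fun m => y m 0 i) len oW2) => //.
    by move=> m [[]].
  exact: Ck_sub W2W0 (syi k).
have Df2 m v : W2 m -> 'D_v f2 m = 'D_v (fun m => y m 0 i) m * mu (y m 0 i).
  move=> W2m; have [[W0m T'm] _] := W2m.
  have dyi := smooth_diff syi W0m; have dlen := smooth_diff slen T'm.
  apply: etrans (derive_comp v dyi dlen) _.
  set d := 'D_v _ m; rewrite -[d in 'D_d _ _](mulr1 d).
  by rewrite (deriveZr d (1 : R) dlen) Dlen.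
have inj2 v : 'D_v (slant x N) p = 0 -> 'D_v f1 p = 0 -> 'D_v f2 p = 0 -> v = 0.
  move=> va v1; rewrite Df2// => /eqP; rewrite mulf_eq0 (gt_eqF (mu_gt0 _ Tp)) orbF.
  move=> /eqP vi; apply: inj => //.
  (* [E] is the exponential of [f1 / c], so a direction that kills [f1] kills [E]. At [p] the
     derivative of [E] along [v] is [<'D_v N, F2>]: [Gy] does not move, and ['D_v N] is orthogonal
     to [N p = F1]. *)
  pose h (t : R) : R := expR (t / c).
  have sh : smooth [set: R] h.
    move=> k; apply: (Ck_comp1R openT _ _ (Ck_expR k)) => //.
    by apply: (CkM openT); [exact: Ck_id|exact: Ck_cst].
  have Eh m : W2 m -> E m = (h \o f1) m.
    by move=> [_ Em]; rewrite /= /h /f1 mulrAC mulfV// mul1r lnK.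
  have DE : 'D_v E p = 0.
    apply: etrans (derive_open_eq v oW2 Eh W2p) _.
    have dh : differentiable h (f1 p) by exact: (smooth_diff sh).
    by rewrite (derive_comp v (smooth_diff sf1 W2p) dh) v1 derive0.
  have [W1p _] := W2p.
  have DG : 'D_v Gy p = 0.
    have dyi := smooth_diff syi W0p; have dG := smooth_diff sG Tp.
    apply: etrans (derive_comp (f := fun m => y m 0 i) v dyi dG) _.
    by rewrite vi derive0.
  have dN := smooth_diff sN W0p.
  move: DE; rewrite (derive_mink v dN (smooth_diff sGy W1p)) DG mink0r addr0.
  rewrite /Gy /G minkBr {2}/y F1p [X in _ - X]minkC.
  by rewrite (mink_NdN H' v W0p) subr0.
have [r2 [W [psi [r20 Wp WW2 C]]]] := chart_exists oW2 W2p
  (smooth_sub W2W0 sa) sf1 sf2 inj2.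
set Phi := triple _ _ _ in C; set c2 := Phi p in C.
have [[oW oD] sPhi spsi PhiP psiP] := C.
have psiW2 q : ball c2 r2 q -> W2 (psi q) by move=> /psiP[/WW2].
have psiW0 q : ball c2 r2 q -> W0 (psi q) by move=> /psiW2/W2W0.
pose J : set R := ball (c2 0 2) r2.
have oJ : open J by exact: ball_open.
have JD u : J u -> ball c2 r2 (axis_line c2 u) by exact: axis_line_ball.
have DJ q : ball c2 r2 q -> J (q 0 2) by move=> /(rV_ballP _ _ r20)/(_ 2).
pose yi m : R := y m 0 i.
have f2psi q : ball c2 r2 q -> f2 (psi q) = q 0 2.
  by move=> Dq; have [_ {2}<-] := psiP q Dq; rewrite /Phi tripleE.
have syip : smooth (ball c2 r2) (yi \o psi).
  move=> k; exact: (Ck_compR oD psiW0 (spsi k) (syi k)).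
(* The inverse of the arc length: [y_i] as a function of the third coordinate [f2]. *)
pose tau := (yi \o psi) \o axis_line c2.
have stau : smooth J tau.
  by move=> k; exact: (Ck_compR oJ JD (smooth_axis_line c2 oJ k) (syip k)).
have Dyi0 q (k : 'I_3) : ball c2 r2 q -> k != 2 ->
    'D_(delta_mx 0 k) (yi \o psi) q = 0.
  move=> Dq k2; have W2q := psiW2 q Dq; have [[_ T'q] _] := W2q.
  rewrite (chart_derive_comp _ C Dq (smooth_diff syi (psiW0 q Dq))).
  have := Df2 _ ('D_(delta_mx 0 k) psi q) W2q.
  rewrite -(chart_derive_comp _ C Dq (smooth_diff sf2 W2q)).
  pose crd (q : 'rV[R]_3) : R := q 0 2.
  rewrite (derive_open_eq (g := crd) (delta_mx 0 k) oD f2psi Dq).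
  rewrite (derive_coord (f := id) 0 2); last exact: derivable_id.
  rewrite derive_id delta3E (negbTE k2) => /esym/eqP; rewrite mulf_eq0.
  by rewrite (gt_eqF (mu_gt0 _ (T'T _ T'q))) orbF => /eqP.
have ytau q : ball c2 r2 q -> y (psi q) 0 i = tau (q 0 2).
  move=> Dq; apply: (axis_line_constR (F := yi \o psi) r20 Dq) => z Dz.
  - exact: smooth_diff syip Dz.
  - exact: Dyi0.
  - exact: Dyi0.
have tauT' u : J u -> T' (tau u) by move=> /JD/psiW2[[]].
have tauT u : J u -> T (tau u) by move=> /tauT'/T'T.
have lentau u : J u -> (len \o tau) u = id u.
  by move=> /JD /f2psi; rewrite axis_line2.
(* Differentiating [len (tau u) = u]; this gives [beta \o tau] unit speed. *)
have Dtau u : J u -> 'D_1 tau u * mu (tau u) = 1.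
  move=> Ju; have dlen := smooth_diff slen (tauT' u Ju).
  have := derive_open_eq (1 : R) oJ lentau Ju.
  rewrite derive_id (derive_comp (1 : R) (smooth_diff stau Ju) dlen).
  set d := 'D_1 tau u; rewrite -[d in 'D_d _ _](mulr1 d).
  by rewrite (deriveZr d (1 : R) dlen) Dlen//; exact: tauT'.
have sJ (F : R -> 'rV[R]_4) : smooth T F -> smooth J (F \o tau).
  by move=> sF k; exact: (Ck_comp1 oJ tauT oT (stau k) (sF k)).
have Dalpha u : J u -> 'D_1 (beta \o tau) u = 'D_1 tau u *: 'D_1 beta (tau u).
  move=> Ju; have dbeta := smooth_diff sbeta (tauT u Ju).
  rewrite (derive_comp (1 : R) (smooth_diff stau Ju) dbeta).
  set d := 'D_1 tau u; rewrite -[d in 'D_d _ _](mulr1 d).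
  by rewrite (deriveZr d (1 : R) dbeta).
have beta_orth t : T t -> mink (beta t) ('D_1 beta t) = 0.
  move=> Tt; have dbeta := smooth_diff sbeta Tt.
  have b1 t' : T t' -> mink (beta t') (beta t') = 1 by move=> /norm[].
  have := derive_open_cst (1 : R) oT b1 Tt.
  by rewrite (derive_mink (1 : R) dbeta dbeta) [mink _ (beta t)]minkC; lra.
have XE q : ball c2 r2 q ->
    curve_param c (beta \o tau) (F1 \o tau) (F2 \o tau) q = x (psi q).
  move=> Dq; have W2m := psiW2 q Dq; set m := psi q in W2m *.
  have [[W0m T'm] Em] := W2m; have Tm := T'T _ T'm.
  have [_ ym mNb bm] := pt m W0m.
  have q0 : q 0 0 = slant x N m.
    by have [_ {1}<-] := psiP q Dq; rewrite /Phi tripleE.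
  have q1 : q 0 1 = c * ln (E m).
    by have [_ {1}<-] := psiP q Dq; rewrite /Phi tripleE.
  have qm : tau (q 0 2) = y m 0 i by rewrite ytau.
  have [n1 n2 n3 n4] := norm _ Tm; have [h1 h2 h3 h4 h5] := orth _ Tm.
  have Nm := timelike_in_frame n1 n2 n3 n4 (beta_orth _ Tm) h1 h2 h3 h4 h5.
  have {Nm} Nm : N m =
      cosh (ln (E m)) *: F1 (y m 0 i) + sinh (ln (E m)) *: F2 (y m 0 i).
    apply: Nm => //.
    - by rewrite -[beta _]ym minkC; exact: (mink_direction_N H0).
    - exact: (mink_NN H').
  rewrite (ruled_decomp H0 W0m) bm ym /curve_param /= qm q0 q1.
  have -> : c * ln (E m) / c = ln (E m) by rewrite mulrAC mulfV// mul1r.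
  by rewrite -Nm /c scaleNr opprK.
exists W; split=> //.
  by move=> m /WW2/W2W0/W0U.
exists c, J, (beta \o tau), (F1 \o tau), (F2 \o tau), (ball c2 r2); split=> //.
- by split=> //; exact: is_interval_ball.
- split; [exact: sJ|exact: sJ|exact: sJ|move=> u Ju].
  have Tu := tauT u Ju; have [n1 n2 n3 n4] := norm _ Tu.
  have [h1 h2 h3 h4 h5] := orth _ Tu; have Du := Dalpha u Ju.
  split; [exact: n1| |exact: n3|exact: n4|].
  + rewrite Du minkZl minkZr mulrA.
    have mu2 : mink ('D_1 beta (tau u)) ('D_1 beta (tau u)) = mu (tau u) ^+ 2.
      by rewrite sqr_sqrtr// ltW.
    by rewrite mu2 -expr2 -exprMn Dtau// expr1n.
  + by split; [exact: h1|exact: h2|rewrite Du minkZr h3 mulr0|exact: h4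
      |rewrite Du minkZr h5 mulr0].
- split; last exact: chart_congruent C XE.
  apply: chart_immersion C _ XE.
  by have [_ ? _] := hypersurface_sub oW (subset_trans WW2 W2W0) H'.
Qed.

End CurveType.

(** * Constant direction, type (i), and density of the classified points *)

Section LocalClassification.
Context {R : realType}.
Implicit Types (U : set 'rV[R]_3) (x N : 'rV[R]_3 -> 'rV[R]_4).

Let reflection (n : 'rV[R]_4) : mink n n != 0 -> exists A : 'M[R]_4,
  linear_isometry A /\
  forall v : 'rV[R]_4, v *m A = v - (2 * mink v n / mink n n) *: n.
Proof.
(* [col_] is [n] with its index lowered by the metric, so that [v *m col_] is [mink v n]; [A] is the
   reflection along [n]. *)
move=> n0; pose col_ : 'cV[R]_4 := \col_i (if i == 0 then - n 0 0 else n 0 i).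
pose A : 'M[R]_4 := 1%:M - (2 / mink n n) *: (col_ *m n).
have AE (v : 'rV[R]_4) : v *m A = v - (2 * mink v n / mink n n) *: n.
  rewrite mulmxBr mulmx1 -scalemxAr mulmxA.
  have -> : v *m col_ = (mink v n)%:M.
    rewrite [LHS]mx11_scalar; congr (_%:M); rewrite mxE minkE.
    rewrite !big_ord_recl big_ord0 !mxE /=.
    have -> : lift ord0 ord0 = 1 :> 'I_4 by exact/val_inj.
    have -> : lift ord0 (lift ord0 ord0) = 2 :> 'I_4 by exact/val_inj.
    have -> : lift ord0 (lift ord0 (lift ord0 ord0)) = 3 :> 'I_4 by exact/val_inj.
    by have -> : ord0 = 0 :> 'I_4 by []; ring.
  by rewrite mul_scalar_mx scalerA mulrAC.
exists A; split=> // a b; rewrite !AE !(minkBl, minkBr, minkZl, minkZr).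
by rewrite [mink n b]minkC; field.
Qed.

(** The reflection along [e - a3] sends [e] to the last axis [a3], unless [e - a3] has square 0,
    that is, [e 0 3 = 1]; then [e + a3] has square 4 and its reflection sends [e] to [- a3]. The
    squares in the conclusion absorb this sign. *)
Lemma isometry_to_axis (e : 'rV[R]_4) : mink e e = 1 -> exists A : 'M[R]_4,
  linear_isometry A /\ forall v : 'rV[R]_4, (v *m A) 0 3 ^+ 2 = mink v e ^+ 2.
Proof.
move=> e1; pose a3 : 'rV[R]_4 := delta_mx 0 3.
have a3E (v : 'rV[R]_4) : mink v a3 = v 0 3.
  by rewrite minkE /a3 !mxE /=; ring.
have a31 : mink a3 a3 = 1 by rewrite a3E mxE.
have [e3|e3] := eqVneq (e 0 3) 1.
- have nn : mink (e + a3) (e + a3) = 4.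
    by rewrite minkDl !minkDr e1 a31 [mink a3 e]minkC a3E e3; ring.
  have [|A [Ai AE]] := @reflection (e + a3); first by rewrite nn pnatr_eq0.
  exists A; split=> // v; rewrite -a3E -[mink v e](Ai v e) [e *m A]AE nn.
  have -> : e - (2 * mink e (e + a3) / 4) *: (e + a3) = - a3.
    rewrite minkDr e1 a3E e3 (_ : 2 * (1 + 1) / 4 = 1); last by field.
    by rewrite scale1r opprD addrA subrr sub0r.
  by rewrite minkNr sqrrN.
- have nn : mink (e - a3) (e - a3) = 2 * (1 - e 0 3).
    by rewrite minkBl !minkBr e1 a31 [mink a3 e]minkC a3E; ring.
  have n3 : 1 - e 0 3 != 0 by rewrite subr_eq0 eq_sym.
  have [|A [Ai AE]] := @reflection (e - a3).
    by rewrite nn mulf_neq0// pnatr_eq0.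
  exists A; split=> // v; rewrite -a3E -[mink v e](Ai v e) [e *m A]AE nn.
  have -> : e - (2 * mink e (e - a3) / (2 * (1 - e 0 3))) *: (e - a3) = a3.
    rewrite minkBr e1 a3E (_ : _ / _ = 1); last by field.
    by rewrite scale1r opprB addrC subrK.
  by [].
Qed.

Lemma hypercylinderE (c : R) (q : 'rV[R]_4) :
  hypercylinder c q <-> mink q q - q 0 3 ^+ 2 = - c ^+ 2.
Proof.
by rewrite /hypercylinder /= minkE; split=> <-; rewrite !expr2; ring.
Qed.

(** With [y] and [b] constant, [x = a y + b N] gives [<x, x> - <x, y>^2 = - b^2], the equation of a
    hypercylinder with axis [y]. *)
Lemma ruled_hypercylinder U x N p : ruled U x N -> U p ->
  (forall q v, U q -> 'D_v (direction x N) q = 0) ->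
  exists W, [/\ open W, W p, W `<=` U & hypercylinder_type W x].
Proof.
move=> H Up y0; have [H' _ _] := H; have [oU [sx _] _] := H'.
have /nbhs_ballP[r /= r0 rU] := open_nbhs_nbhs (conj oU Up).
have sy := smooth_direction H; have sb := smooth_offset H.
exists (ball p r); split=> //; [exact: ball_open|exact: ballxx|].
have [A [Ai AE]] := isometry_to_axis (mink_direction H Up).
(* For [b = 0] the differential of [x] would take values in the line of [y], against its
   injectivity. *)
have b0 : offset x N p != 0.
  apply/negP => /eqP b0; have dx := smooth_diff sx Up.
  have Dx v : 'D_v x p = 'D_v (slant x N) p *: direction x N p.
    by rewrite (derive_decomp H v Up) y0// b0 scale0r scaler0 !addr0.
  pose e k : 'rV[R]_3 := delta_mx 0 k; pose d k := 'D_(e k) (slant x N) p.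
  have alg (s t : R) (u0 u1 w : 'rV[R]_4) :
      u0 = s *: w -> u1 = t *: w -> t *: u0 + (- s) *: u1 = 0.
    by move=> -> ->; rewrite !scalerA mulNr mulrC scaleNr subrr.
  have := immersion_inj H' Up (etrans (derive_lin2 (d 1) (- d 0) (e 0) (e 1) dx)
    (alg _ _ _ _ _ (Dx (e 0)) (Dx (e 1)))).
  move=> /rowP /(_ 1); rewrite lin3E mxE /= mulr0 add0r mulr1 => /eqP.
  rewrite oppr_eq0 => /eqP d0.
  have De0 : 'D_(e 0) x p = 0.
    exact: etrans (Dx (e 0)) (etrans (congr1 ( *:%R^~ _) d0) (scale0r _)).
  have /rowP/(_ 0) := immersion_inj H' Up De0.
  by rewrite delta3E mxE => /eqP; rewrite oner_eq0.
exists `|offset x N p|, A; split=> //; first by rewrite normr_gt0.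
move=> q pq; have Uq := rU q pq; apply/hypercylinderE; rewrite Ai AE.
have yq : direction x N q = direction x N p.
  apply: (derive0_ball_eq (ballxx p r0) pq) => z /rU Uz; last exact: y0.
  exact: smooth_diff sy Uz.
have bq : offset x N q = offset x N p.
  apply: (derive0_ball_eqR (ballxx p r0) pq) => z /rU Uz.
    exact: smooth_diff sb Uz.
  exact: (derive_offset H).
have yy := mink_direction H Uq; have yN := mink_direction_N H Uq.
have NN := mink_NN H' Uq.
have alg (a b : R) (v y n : 'rV[R]_4) : mink y y = 1 -> mink y n = 0 ->
    mink n n = -1 -> v = a *: y + b *: n -> mink v v - mink v y ^+ 2 = - b ^+ 2.
  move=> y1 yn nn ->; rewrite !(minkDl, minkDr, minkZl, minkZr) y1 yn nn.
  by rewrite [mink n y]minkC yn; ring.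
rewrite real_normK ?num_real// -yq -bq.
exact: (alg _ _ _ _ _ yy yN NN (ruled_decomp H Uq)).
Qed.

(** Meant for [al = da], [ga = dy_i] and the radial vector [Z]. The hypothesis for each coordinate
    [l] makes one minor of [al] and [ga] vanish, so the two forms are parallel; evaluation at [Z]
    shows that [ga] is the zero multiple of [al]. *)
Lemma dependent_forms (al ga Z : 'rV[R]_3) :
  (forall l, exists v : 'rV[R]_3, [/\ v != 0, \sum_k v 0 k * al 0 k = 0, v 0 l = 0 &
    \sum_k v 0 k * ga 0 k = 0]) ->
  \sum_k Z 0 k * al 0 k != 0 -> \sum_k Z 0 k * ga 0 k = 0 -> ga = 0.
Proof.
move=> dep Za Zg.
have sum3 (v w : 'rV[R]_3) :
    \sum_k v 0 k * w 0 k = v 0 0 * w 0 0 + v 0 1 * w 0 1 + v 0 2 * w 0 2.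
  rewrite !big_ord_recl big_ord0 addr0 addrA.
  by congr (_ + v 0 _ * w 0 _ + v 0 _ * w 0 _); exact/val_inj.
have minor (a1 a2 g1 g2 s t : R) : s * a1 + t * a2 = 0 -> s * g1 + t * g2 = 0 ->
    (s != 0) || (t != 0) -> a1 * g2 = a2 * g1.
  move=> E1 E2 /orP[s0|t0].
    apply: (mulfI s0); have -> : s * (a1 * g2) = (s * a1 + t * a2) * g2
      - a2 * (s * g1 + t * g2) + s * (a2 * g1) by ring.
    by rewrite E1 E2; ring.
  apply: (mulfI t0); have -> : t * (a1 * g2) = a1 * (s * g1 + t * g2)
    - (s * a1 + t * a2) * g1 + t * (a2 * g1) by ring.
  by rewrite E1 E2; ring.
have nz (v : 'rV[R]_3) : v != 0 -> [|| v 0 0 != 0, v 0 1 != 0 | v 0 2 != 0].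
  apply: contraNT; rewrite !negb_or !negbK => /and3P[/eqP v0 /eqP v1 /eqP v2].
  by apply/eqP; apply: row3P; rewrite mxE.
have m12 : al 0 1 * ga 0 2 = al 0 2 * ga 0 1.
  have [v [/nz + va vl vg]] := dep 0; rewrite !sum3 vl !mul0r !add0r in va vg.
  by rewrite vl eqxx; exact: minor va vg.
have m02 : al 0 0 * ga 0 2 = al 0 2 * ga 0 0.
  have [v [/nz + va vl vg]] := dep 1; rewrite !sum3 vl !mul0r !addr0 in va vg.
  by rewrite vl eqxx; exact: minor va vg.
have m01 : al 0 0 * ga 0 1 = al 0 1 * ga 0 0.
  have [v [/nz + va vl vg]] := dep 2; rewrite !sum3 vl !mul0r !addr0 in va vg.
  by rewrite vl eqxx orbF; exact: minor va vg.
rewrite !sum3 in Za Zg.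
apply: row3P; rewrite mxE; apply: (mulfI Za); rewrite mulr0.
- transitivity ((Z 0 0 * ga 0 0 + Z 0 1 * ga 0 1 + Z 0 2 * ga 0 2) * al 0 0).
    rewrite !mulrDl -!mulrA [ga 0 1 * _]mulrC m01 [ga 0 2 * _]mulrC m02.
    by ring.
  by rewrite Zg mul0r.
- transitivity ((Z 0 0 * ga 0 0 + Z 0 1 * ga 0 1 + Z 0 2 * ga 0 2) * al 0 1).
    rewrite !mulrDl -!mulrA [ga 0 0 * _]mulrC -m01 [ga 0 2 * _]mulrC m12.
    by ring.
  by rewrite Zg mul0r.
- transitivity ((Z 0 0 * ga 0 0 + Z 0 1 * ga 0 1 + Z 0 2 * ga 0 2) * al 0 2).
    rewrite !mulrDl -!mulrA [ga 0 0 * _]mulrC -m02 [ga 0 1 * _]mulrC -m12.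
    by ring.
  by rewrite Zg mul0r.
Qed.

(** [V] is taken as large as possible. On an open [O] missing it type (iii) fails at every point, so
    any [da], [dy_i], [dy_j] are dependent. That is what the construction of type (ii) presupposes,
    and its failure makes any [da], [dq_l], [dy_i] dependent. Hence [dy = 0] on [O], which is type
    (i), a contradiction. *)
Lemma ruled_locally_classified U x N : ruled U x N -> locally_classified U x.
Proof.
move=> H; have [[oU _ _] _ _] := H.
pose V := [set p : 'rV[R]_3 | exists W : set 'rV[R]_3, [/\ open W, W p, W `<=` U &
  hypercylinder_type W x \/ curve_type W x \/ surface_type W x]].
exists V; split.
- rewrite openE => p [W [oW Wp WU HW]].
  by apply: filterS (open_nbhs_nbhs (conj oW Wp)) => q Wq; exists W.
- by move=> p [W [oW Wp WU HW]]; exact: WU.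
- move=> p Up B pB; apply: contrapT => noV.
  pose O := U `&` B^°.
  have oO : open O by apply: openI => //; exact: open_interior.
  have OU : O `<=` U by move=> q [].
  have Op : O p by [].
  have nV q : O q -> ~ V q.
    by move=> [Uq Bq] Vq; apply: noV; exists q; split=> //; exact: interior_subset.
  have HO := ruled_sub oO OU H.
  have sa := smooth_slant HO; have sy := smooth_direction HO.
  have dep2 q i j : O q -> exists v, [/\ v != 0, 'D_v (slant x N) q = 0,
     'D_v (fun q => direction x N q 0 i) q = 0 &
     'D_v (fun q => direction x N q 0 j) q = 0].
    move=> Oq; apply: contrapT => nex; apply: (nV q Oq).
    have [v va vi vj|W [oW Wq WO HW]] := ruled_surface_type (i := i) (j := j) HO Oq.
      by apply: contrapT => /eqP v0; apply: nex; exists v.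
    by exists W; split=> //; [exact: subset_trans WO OU|right; right].
  have dep1 q i l : O q -> exists v, [/\ v != 0, 'D_v (slant x N) q = 0,
     v 0 l = 0 & 'D_v (fun q => direction x N q 0 i) q = 0].
    move=> Oq; apply: contrapT => nex; apply: (nV q Oq).
    have [v va vl vi|q' j Oq'|r [W0 [beta [F1 [F2 fr]]]]] :=
        @rank_one_frame _ O x N i l q HO Oq.
    - by apply: contrapT => /eqP v0; apply: nex; exists v.
    - exact: dep2.
    have [W [oW Wq WO HW]] := ruled_curve_type HO fr.
    by exists W; split=> //; [exact: subset_trans WO OU|right; left].
  apply: (nV p Op).
  have [q v Oq|W [oW Wp WO HW]] := ruled_hypercylinder HO Op; last first.
    by exists W; split=> //; [exact: subset_trans WO OU|left].
  have da := smooth_diff sa Oq; have dy := smooth_diff sy Oq.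
  apply/rowP => i; rewrite [RHS]mxE.
  have dyi := differentiable_mx_coord 0 i dy.
  rewrite -(derive_coord 0 i (@diff_derivable _ _ _ _ _ v dy)).
  pose grad (f : 'rV[R]_3 -> R) : 'rV[R]_3 := \row_k 'D_(delta_mx 0 k) f q.
  have gradE f w : differentiable f q -> 'D_w f q = \sum_k w 0 k * grad f 0 k.
    by move=> df; rewrite (derive_row w df); apply: eq_bigr => k _; rewrite mxE.
  rewrite (gradE _ _ dyi).
  have -> : grad (fun q => direction x N q 0 i) = 0.
    apply: (dependent_forms (al := grad (slant x N)) (Z := radial x N q)).
    - move=> l; have [w [w0 wa wl wi]] := dep1 q i l Oq; exists w.
      by rewrite -(gradE _ _ da) -(gradE _ _ dyi).
    - rewrite -(gradE _ _ da) (derive_slant_radial HO Oq) gt_eqF//.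
      exact: (slant_gt0 HO Oq).
    - rewrite -(gradE _ _ dyi).
      rewrite (derive_coord 0 i (@diff_derivable _ _ _ _ _ _ dy)).
      by rewrite (derive_direction_radial HO Oq) mxE.
  by apply: big1 => k _; rewrite mxE mulr0.
- by [].
Qed.

End LocalClassification.

(** * The models are generalized constant ratio *)

Section Converse.
Context {R : realType}.
Implicit Types (U W D : set 'rV[R]_3) (x N : 'rV[R]_3 -> 'rV[R]_4).

(** Both fields are unit and normal, so [M = e N] with [e * e = 1]. Differentiating the last
    equation gives [e] zero derivative, whichever sign it has. *)
Lemma unit_normal_unique W x N M p v : hypersurface W x N ->
  (forall q, W q -> differentiable M q) ->
  (forall q, W q -> mink (M q) (M q) = -1) ->
  (forall q u, W q -> mink (M q) ('D_u x q) = 0) -> W p ->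
  (mink (M p) (N p) != 0 /\ M p = - mink (M p) (N p) *: N p) /\
  ('D_v M p = 0 -> 'D_v N p = 0).
Proof.
move=> H dM MM Mx Wp; have [oW _ [sN _]] := H.
pose e q := - mink (M q) (N q).
have ME q : W q -> M q = e q *: N q.
  move=> Wq; apply/eqP; rewrite -subr_eq0; apply/eqP.
  apply: (mink_frame_eq0 H Wq) => [|u]; rewrite minkBl minkZl.
    by rewrite (mink_NN H Wq) /e; ring.
  by rewrite Mx// (mink_Ndx H)//; ring.
have ee q : W q -> e q * e q = 1.
  move=> Wq; have := MM q Wq; rewrite ME// minkZl minkZr (mink_NN H)//; lra.
have e0 : e p != 0.
  apply/negP => /eqP e0; have := ee p Wp; rewrite e0 mul0r => /esym/eqP.
  by rewrite oner_eq0.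
split; first by split; [rewrite -oppr_eq0|exact: ME].
have dN := smooth_diff sN Wp.
have dm := differentiable_mink (dM p Wp) dN.
have de : differentiable e p by exact: differentiableN.
have De : 'D_v e p = 0.
  have := derive_open_cst v oW ee Wp.
  have -> : (fun q => e q * e q) = e * e by [].
  have de' := @diff_derivable _ _ _ _ _ v de.
  rewrite (deriveM de' de') /GRing.scale /= => E.
  have /eqP : e p * 'D_v e p = 0 by lra.
  by rewrite mulf_eq0 (negbTE e0) => /eqP.
rewrite (derive_open_eq v oW ME Wp) (derive_scale v de dN) De scale0r add0r.
by move=> /eqP; rewrite scaler_eq0 (negbTE e0) => /eqP.
Qed.

Lemma isometry_unitmx (A : 'M[R]_4) : linear_isometry A -> A \in unitmx.
Proof.
move=> Ai; rewrite unitmxE unitfE; apply/negP => /det0P[v v0 vA].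
have v_orth w : mink v w = 0 by rewrite -Ai vA mink0l.
move: v0; suff -> : v = 0 by rewrite eqxx.
have c0 : v 0 0 = 0 by have := v_orth (delta_mx 0 0); rewrite minkE !mxE /=; lra.
have c1 : v 0 1 = 0 by have := v_orth (delta_mx 0 1); rewrite minkE !mxE /=; lra.
have c2 : v 0 2 = 0 by have := v_orth (delta_mx 0 2); rewrite minkE !mxE /=; lra.
have c3 : v 0 3 = 0 by have := v_orth (delta_mx 0 3); rewrite minkE !mxE /=; lra.
apply/rowP => -[[|[|[|[|//]]]] jP]; rewrite mxE.
- by rewrite -c0; congr (v _ _); exact/val_inj.
- by rewrite -c1; congr (v _ _); exact/val_inj.
- by rewrite -c2; congr (v _ _); exact/val_inj.
- by rewrite -c3; congr (v _ _); exact/val_inj.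
Qed.

(** The tangential part is quadratic in the normal, hence blind to its sign. *)
Lemma tangential_unit x N p (M : 'rV[R]_4) (e : R) : e * e = 1 -> M = e *: N p ->
  tangential_part x N p = x p + mink (x p) M *: M.
Proof.
by move=> ee ->; rewrite minkZr scalerA mulrAC ee mul1r.
Qed.

(** A unit normal is the component of [x] orthogonal to the axis [e], divided by [c]; then [x^T] is
    [<x, e> e], and moving along the axis does not change that component. *)
Lemma hypercylinder_radial W x N p : hypersurface W x N ->
  hypercylinder_type W x -> W p -> 'D_(radial x N p) N p = 0.
Proof.
move=> H [c [A [c0 Ai xA]]] Wp; have [oW [sx _] _] := H.
have uA := isometry_unitmx Ai.
(* The last coordinate axis, carried back by the isometry. *)
pose e : 'rV[R]_4 := delta_mx 0 3 *m invmx A.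
have eA : e *m A = delta_mx 0 3 by rewrite mulmxKV.
have xe v : mink v e = (v *m A) 0 3.
  by rewrite -Ai eA minkE !mxE /=; ring.
have ee : mink e e = 1 by rewrite xe eA mxE.
have cyl q : W q -> mink (x q) (x q) - mink (x q) e * mink (x q) e = - c ^+ 2.
  by move=> /xA/hypercylinderE; rewrite Ai -xe expr2.
have cN0 : c != 0 by rewrite gt_eqF.
pose M q := c^-1 *: (x q - mink (x q) e *: e).
have dx q : W q -> differentiable x q by exact: smooth_diff.
have dxe q : W q -> differentiable (fun q => mink (x q) e) q.
  by move=> Wq; apply: (differentiable_mink (dx q Wq)); exact: differentiable_cst.
have Dxe q u : W q -> 'D_u (fun q => mink (x q) e) q = mink ('D_u x q) e.
  move=> Wq; rewrite (derive_mink (g := fun=> e) u (dx q Wq)); last first.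
    exact: differentiable_cst.
  by rewrite derive_cst mink0r addr0.
have dxee q : W q -> differentiable (fun q => mink (x q) e *: e) q.
  by move=> Wq; exact: differentiableZl (dxe q Wq).
have DM q u : W q -> differentiable M q /\
    'D_u M q = c^-1 *: ('D_u x q - mink ('D_u x q) e *: e).
  move=> Wq; have d1 := differentiableB (dx q Wq) (dxee q Wq).
  have -> : M = c^-1 \*: (x - (fun q => mink (x q) e *: e)) by [].
  split; first exact: differentiableZ.
  rewrite deriveZ; last exact: diff_derivable.
  rewrite deriveB; [|exact/diff_derivable/dx|exact/diff_derivable/dxee].
  congr (_ *: (_ - _)).
  rewrite (derive_scale (f := fun=> e) u (dxe q Wq)); last exact: differentiable_cst.
  by rewrite derive_cst scaler0 addr0 Dxe.
have MM q : W q -> mink (M q) (M q) = -1.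
  move=> Wq; have := cyl q Wq.
  rewrite /M !(minkBl, minkBr, minkZl, minkZr) ee [mink e _]minkC => E.
  have -> : mink (x q) (x q) = mink (x q) e * mink (x q) e - c ^+ 2 by lra.
  by field.
have Mx q u : W q -> mink (M q) ('D_u x q) = 0.
  move=> Wq; have := derive_open_cst u oW cyl Wq.
  have -> : (fun q => mink (x q) (x q) - mink (x q) e * mink (x q) e) =
    (fun q => mink (x q) (x q)) - (fun q => mink (x q) e) * (fun q => mink (x q) e).
    by [].
  have d1 := differentiable_mink (dx q Wq) (dx q Wq).
  have d2 := dxe q Wq; have d2' := @diff_derivable _ _ _ _ _ u d2.
  rewrite deriveB; [|exact: diff_derivable|exact/diff_derivable/differentiableM].
  rewrite (deriveM d2' d2') (derive_mink u (dx q Wq) (dx q Wq)) Dxe//.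
  rewrite /M minkZl minkBl minkZl [mink ('D_u x q) (x q)]minkC [mink e _]minkC.
  rewrite /GRing.scale /= => E.
  have -> : mink (x q) ('D_u x q) = mink (x q) e * mink ('D_u x q) e by lra.
  by rewrite subrr mulr0.
have [[e0 ME] DMN] := unit_normal_unique (radial x N p) H
  (fun q Wq => (DM q 0 Wq).1) MM Mx Wp.
apply: DMN; rewrite (DM p _ Wp).2 (derive_radial H Wp).
have ME1 : (- mink (M p) (N p)) * (- mink (M p) (N p)) = 1.
  have := MM p Wp; rewrite {1 2}ME minkZl minkZr (mink_NN H)//; lra.
have xM : mink (x p) (M p) = - c.
  rewrite /M minkZr minkBr minkZr; have := cyl p Wp => E.
  have -> : mink (x p) (x p) = mink (x p) e * mink (x p) e - c ^+ 2 by lra.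
  by field.
have -> : tangential_part x N p = mink (x p) e *: e.
  rewrite (tangential_unit x ME1 ME) xM /M scalerA mulNr mulfV// scaleN1r.
  by rewrite opprB addrC subrK.
by rewrite minkZl ee mulr1 subrr scaler0.
Qed.

(** Types (ii) and (iii) both have the form [s Y - c n] with [Y] and [n] independent of [s]. Pulled
    back by the congruence, [n] is a unit normal and [s Y] the tangential part, so the radial field
    is [s] times the field of the first parameter, along which [n] is constant. *)
Lemma ruled_form_radial W x N D X Y n (c : R) p : hypersurface W x N ->
  (forall q, W q -> tangential_part x N q != 0) ->
  open D -> congruent W x D X ->
  (forall q, D q -> X q = q 0 0 *: Y q - c *: n q) ->
  (forall q, D q -> differentiable Y q /\ differentiable n q) ->
  (forall q, D q -> mink (n q) (n q) = -1 /\ mink (n q) (Y q) = 0) ->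
  (forall q v, D q -> mink (n q) ('D_v Y q) = 0) ->
  (forall q, D q -> 'D_(delta_mx 0 0) Y q = 0 /\ 'D_(delta_mx 0 0) n q = 0) ->
  W p -> 'D_(radial x N p) N p = 0.
Proof.
move=> H z0 oD [A [phi [Ai [psi [sphi spsi phiP psiP]] xA]]] XE dYn nn nDY D0 Wp.
have [oW [sx _] _] := H; have uA := isometry_unitmx Ai.
have C : chart W D phi psi by split.
pose crd (q : 'rV[R]_3) : R := q 0 0.
have dcrd q : differentiable crd q by exact: differentiable_coord.
have Dcrd q v : 'D_v crd q = v 0 0.
  by rewrite (derive_coord (f := id) 0 0) ?derive_id//; exact: derivable_id.
have DX q v : D q -> 'D_v X q =
    v 0 0 *: Y q + q 0 0 *: 'D_v Y q - c *: 'D_v n q.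
  move=> Dq; have [dY dn] := dYn q Dq.
  apply: etrans (derive_open_eq v oD XE Dq) _.
  have d1 := differentiable_scale (dcrd q) dY.
  have -> : (fun q : 'rV[R]_3 => q 0 0 *: Y q - c *: n q) =
    (fun q => crd q *: Y q) - c \*: n by [].
  rewrite deriveB; [|exact: diff_derivable|exact/diff_derivable/differentiableZ].
  rewrite (derive_scale v (dcrd q) dY) Dcrd deriveZ//; exact: diff_derivable.
have nDn q v : D q -> mink (n q) ('D_v n q) = 0.
  move=> Dq; have [_ dn] := dYn q Dq.
  have := derive_open_cst v oD (fun q Dq => (nn q Dq).1) Dq.
  rewrite (derive_mink v dn dn) [mink _ (n q)]minkC; lra.
have nDX q v : D q -> mink (n q) ('D_v X q) = 0.
  move=> Dq; rewrite DX// minkBr minkDr !minkZr nDn// nDY// (nn q Dq).2.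
  by ring.
have dphi q : W q -> differentiable phi q by exact: smooth_diff.
have Dphi q : W q -> D (phi q) by move=> /phiP[].
have dX q : D q -> differentiable X q.
  move=> Dq; have [dY dn] := dYn q Dq.
  apply: (@differentiable_near_eq _ _ _ (fun q => crd q *: Y q - c *: n q)).
    by apply: (open_near oD) Dq => q' Dq'; rewrite XE.
  apply: differentiableB; first exact: differentiable_scale.
  exact: differentiableZ.
have DxA q v : W q -> 'D_v x q *m A = 'D_('D_v phi q) X (phi q).
  move=> Wq; rewrite -derive_comp_mulmxr; last exact: smooth_diff sx Wq.
  apply: etrans (derive_open_eq (g := X \o phi) v oW xA Wq) _.
  exact: (derive_comp v (dphi q Wq) (dX _ (Dphi q Wq))).
pose M q := n (phi q) *m invmx A.
have MA q : M q *m A = n (phi q) by rewrite mulmxKV.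
have dnphi q : W q -> differentiable (n \o phi) q.
  move=> Wq; apply: differentiable_comp; first exact: dphi.
  by have [] := dYn _ (Dphi q Wq).
have dM q : W q -> differentiable M q.
  by move=> Wq; exact: (differentiable_comp_mulmxr (invmx A) (dnphi q Wq)).
have MM q : W q -> mink (M q) (M q) = -1.
  by move=> Wq; rewrite -Ai MA; have [] := nn _ (Dphi q Wq).
have Mx q u : W q -> mink (M q) ('D_u x q) = 0.
  by move=> Wq; rewrite -Ai MA DxA// nDX//; exact: Dphi.
have Dq := Dphi p Wp; have [nn1 nY] := nn _ Dq.
have [[e0 ME] _] := unit_normal_unique 0 H dM MM Mx Wp.
have ME1 : (- mink (M p) (N p)) * (- mink (M p) (N p)) = 1.
  have := MM p Wp; rewrite {1 2}ME minkZl minkZr (mink_NN H)//; lra.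
pose s := phi p 0 0; pose v := s *: 'D_(delta_mx 0 0) psi (phi p).
have zA : tangential_part x N p *m A = s *: Y (phi p).
  rewrite (tangential_unit x ME1 ME) mulmxDl -scalemxAl MA -Ai MA xA// XE//.
  rewrite minkBl !minkZl [mink (Y _) _]minkC nY nn1.
  by rewrite mulr0 mulrN1 sub0r opprK subrK.
have Dphiv : 'D_('D_(delta_mx 0 0) psi (phi p)) phi p = delta_mx 0 0.
  have := chart_derive (delta_mx 0 0) (chart_sym C) Dq.
  by have [_ ->] := phiP p Wp.
have DY0 := D0 _ Dq.
have xv : 'D_v x p = tangential_part x N p.
  apply: (can_inj (mulmxK uA)); rewrite zA.
  rewrite /v (deriveZr s _ (smooth_diff sx Wp)) -scalemxAl DxA// Dphiv DX//.
  by rewrite DY0.1 DY0.2 delta3E /= !scaler0 addr0 subr0 scale1r.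
have vE : radial x N p = v.
  by apply: (tangent_coord_unique H Wp); rewrite xv (derive_radial H Wp).
have [_ DMNv] := unit_normal_unique v H dM MM Mx Wp.
rewrite vE; apply: DMNv.
rewrite (derive_comp_mulmxr (f := n \o phi) (invmx A) v (dnphi p Wp)).
have [_ dn] := dYn _ Dq.
rewrite (derive_comp v (dphi p Wp) dn) /v (deriveZr s _ (dphi p Wp)) Dphiv.
by rewrite (deriveZr s _ dn) DY0.2 scaler0 mul0mx.
Qed.

End Converse.

(** * Types (iii) and (ii) in the common ruled form *)

Section Types.
Context {R : realType}.
Implicit Types (U W D : set 'rV[R]_3) (x N : 'rV[R]_3 -> 'rV[R]_4).

Lemma derive_invariant {V V' : normedModType R} (f : V -> V') p v :
  (forall h : R, f (h *: v + p) = f p) -> 'D_v f p = 0.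
Proof.
move=> fv; rewrite /derive.
rewrite (_ : (fun h => _) = fun=> 0); first exact: lim_cst.
by rewrite funeqE => h /=; rewrite fv subrr scaler0.
Qed.

Lemma shift0_coord (h : R) (q : 'rV[R]_3) (j : 'I_3) :
  (h *: delta_mx 0 0 + q) 0 j = h * (0 == j)%:R + q 0 j.
Proof. by rewrite mxE [X in X + _]mxE delta3E. Qed.

Lemma surface_type_radial W x N p : hypersurface W x N ->
  (forall q, W q -> tangential_part x N q != 0) ->
  surface_type W x -> W p -> 'D_(radial x N p) N p = 0.
Proof.
move=> H z0 [c [I [L [y [n [[oI _] oL [sy dS _] [[sn nP] ny] [_ cong]]]]]]] Wp.
set D := [set q : 'rV[R]_3 | _] in cong.
have tuE (q : 'rV[R]_3) k : tu q 0 k = q 0 (lift ord0 k) by rewrite mxE.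
have stu : smooth [set: 'rV[R]_3] (@tu R).
  move=> k; apply: (Ck_row openT) => j.
  apply: (@Ck_ext _ _ _ _ _ (fun q : 'rV[R]_3 => q 0 (lift ord0 j)) _ openT) => //.
  by apply: (Ck_coord _ _ openT); exact: Ck_id.
have dtu q : differentiable (@tu R) q by exact: (smooth_diff stu).
have oD : open D.
  pose crd (q : 'rV[R]_3) : R := q 0 0.
  rewrite openE => q [Iq Lq].
  apply: (@filterI _ (nbhs q) _ (crd @^-1` I) (@tu R @^-1` L)).
    have cc : {for q, continuous crd} by exact: coord_continuous.
    by apply: cc; apply: open_nbhs_nbhs; split.
  have ct := differentiable_continuous (dtu q).
  by apply: ct; apply: open_nbhs_nbhs; split.
have tu0 h q : tu (h *: delta_mx 0 0 + q) = tu q :> 'rV[R]_2.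
  by apply/rowP => k; rewrite !tuE shift0_coord /= mulr0 add0r.
apply: (ruled_form_radial (Y := y \o @tu R) (n := n \o @tu R) H z0 oD cong) => //.
- move=> q [_ Lq]; split; apply: differentiable_comp => //.
    exact: smooth_diff Lq.
  exact: smooth_diff Lq.
- by move=> q [_ Lq]; split; [have [] := nP _ Lq|exact: ny].
- move=> q v [_ Lq].
  rewrite (derive_comp v (dtu q) (smooth_diff sy Lq)) /=.
  by have [_ ->] := nP _ Lq.
- by move=> q _; split; apply: derive_invariant => h /=; rewrite tu0.
Qed.

Lemma Ck_cosh k : Ck k [set: R] (@cosh R).
Proof.
apply: (CkM openT); last exact: Ck_cst.
apply: (CkD openT); first exact: Ck_expR.
apply: (Ck_comp1R openT _ _ (Ck_expR k)) => //.
by apply: (CkN openT); exact: Ck_id.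
Qed.

Lemma Ck_sinh k : Ck k [set: R] (@sinh R).
Proof.
apply: (CkM openT); last exact: Ck_cst.
apply: (CkD openT); first exact: Ck_expR.
apply: (CkN openT); apply: (Ck_comp1R openT _ _ (Ck_expR k)) => //.
by apply: (CkN openT); exact: Ck_id.
Qed.

Lemma cosh_sinh (t : R) : cosh t * cosh t - sinh t * sinh t = 1.
Proof.
have E : expR t * expR (- t) = 1 by rewrite -expRD subrr expR0.
rewrite /cosh /sinh; transitivity (expR t * expR (- t)); last by [].
by field.
Qed.

Lemma curve_type_radial W x N p : hypersurface W x N ->
  (forall q, W q -> tangential_part x N q != 0) ->
  curve_type W x -> W p -> 'D_(radial x N p) N p = 0.
Proof.
move=> H z0 [c [J [al [F1 [F2 [D]]]]]].
move=> [c0 [oJ _] [sal sF1 sF2 nf] [oD DJ] [_ cong]] Wp.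
pose t1 (q : 'rV[R]_3) : R := q 0 1 / c; pose t2 (q : 'rV[R]_3) : R := q 0 2.
(* The vector that the model subtracts with factor [c]; [cosh_sinh] makes it unit time-like. *)
pose n q := cosh (t1 q) *: F1 (t2 q) + sinh (t1 q) *: F2 (t2 q).
have st1 : smooth D t1.
  move=> k; apply: (CkM oD); last exact: Ck_cst.
  by apply: (Ck_coord _ _ oD); exact: Ck_id.
have st2 : smooth D t2.
  by move=> k; apply: (Ck_coord _ _ oD); exact: Ck_id.
have sJ (F : R -> 'rV[R]_4) : smooth J F -> smooth D (F \o t2).
  by move=> sF k; exact: (Ck_comp1 oD DJ oJ (st2 k) (sF k)).
have sn : smooth D n.
  move=> k; apply: (CkD oD); apply: (Ck_scale oD).
  - exact: (Ck_comp1R oD (fun _ _ => I) (st1 k) (Ck_cosh k)).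
  - exact: sJ.
  - exact: (Ck_comp1R oD (fun _ _ => I) (st1 k) (Ck_sinh k)).
  - exact: sJ.
have t10 h q : t1 (h *: delta_mx 0 0 + q) = t1 q.
  by rewrite /t1 shift0_coord /= mulr0 add0r.
have t20 h q : t2 (h *: delta_mx 0 0 + q) = t2 q.
  by rewrite /t2 shift0_coord /= mulr0 add0r.
apply: (ruled_form_radial (Y := al \o t2) (n := n) H z0 oD cong) => //.
- move=> q Dq; split; last exact: smooth_diff Dq.
  exact: smooth_diff (sJ _ sal) Dq.
- move=> q Dq; have [_ _ n1 n2 [h12 h1 _ h2 _]] := nf _ (DJ q Dq).
  rewrite /n /= /t2; split; last by rewrite minkDl !minkZl h1 h2; ring.
  rewrite !(minkDl, minkDr, minkZl, minkZr) [mink (F2 _) (F1 _)]minkC n1 n2 h12.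
  by have := cosh_sinh (t1 q); lra.
- move=> q v Dq; have [_ _ _ _ [_ _ h1 _ h2]] := nf _ (DJ q Dq).
  have dal := smooth_diff sal (DJ q Dq); have dt2 := smooth_diff st2 Dq.
  rewrite (derive_comp v dt2 dal); set d := 'D_v t2 q.
  rewrite -[d in 'D_d _ _](mulr1 d) (deriveZr d (1 : R) dal) minkZr.
  by rewrite /n minkDl !minkZl h1 h2; ring.
- move=> q Dq; split; apply: derive_invariant => h /=; first by rewrite t20.
  by rewrite /n t10 t20.
Qed.

End Types.

Theorem theorem15 (R : realType) (U : set 'rV[R]_3)
    (x N : 'rV[R]_3 -> 'rV[R]_4) (S : 'rV[R]_3 -> 'M[R]_3)
    (openU : open U)
    (x_spacelike : spacelike_immersion U x)
    (N_normal : timelike_unit_normal U x N)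
    (S_shape : shape_operator U x N S)
    (x_pos : forall p, U p -> 0 < mink (x p) (x p))
    (xT_neq0 : forall p, U p -> tangential_part x N p != 0)
    (GK0 : forall p, U p -> gauss_kronecker S p = 0) :
  GCR U x N S <-> locally_classified U x.
Proof.
have H : hypersurface U x N by split.
split=> [HG|[V [oV VU UV HV]] p Up].
  apply: (@ruled_locally_classified R U x N); split=> //.
  exact: GCR_radial S_shape GK0 HG.
have sDZN := smooth_derive_field openU N_normal.1 (smooth_radial H).
have NV q : V q -> 'D_(radial x N q) N q = 0.
  move=> /HV[W [oW Wq WU types]]; have HW := hypersurface_sub oW WU H.
  have z0 q' : W q' -> tangential_part x N q' != 0 by move=> /WU; exact: xT_neq0.
  case: types => [hT|[cT|sT]].
  - exact: hypercylinder_radial HW hT Wq.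
  - exact: curve_type_radial HW z0 cT Wq.
  - exact: surface_type_radial HW z0 sT Wq.
(* The points of [U] where a given entry of this derivative is nonzero form an open set, which the
   dense [V] would meet. *)
have NU : 'D_(radial x N p) N p = 0.
  apply/rowP => j; rewrite [RHS]mxE; apply: contrapT => /eqP Nj.
  pose g q : R := ('D_(radial x N q) N q) 0 j.
  have sg : smooth U g by move=> k; exact: (Ck_coord 0 j openU (sDZN k)).
  have oO := open_preimage_in openU open_neq0 sg.
  have [q [Vq [_ gq]]] := UV p Up _ (open_nbhs_nbhs (conj oO (conj Up Nj))).
  by move: gq; rewrite /g /= NV// mxE eqxx.
(* The principal curvature is 0: as [N] is stationary in the radial direction and [x] is an
   immersion, [S] kills that direction. *)
exists (radial x N p), 0; split.
- exact: derive_radial H Up.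
- apply/negP => /eqP Z0; have := xT_neq0 p Up.
  by rewrite -(derive_radial H Up) Z0 derive0 eqxx.
- rewrite scale0r; apply: (immersion_inj H Up); apply/eqP.
  by rewrite -oppr_eq0 -(S_shape p Up) NU.
Qed.
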